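(* The optimization problem $\mathcal P_1$, $$\max_{\mathcal A\subseteq\mathcal V} f(\mathcal A)\quad\text{s.t.}\quad \|\mathbf u_i^a\|\le\bar u\ \ \forall i\in\mathcal V,\qquad \sum_{i\in\mathcal A}c(i)\le\Omega,\qquad \int_0^{t_c}\theta(\tau)\,d\tau\le\bar g,$$ under the time-invariant attack strategy $\theta(t)=\theta$ (constant in $t$), is NP-hard.
   Context: An instance of $\mathcal P_1$ consists of the following data. $\mathcal G=(\mathcal V,\mathcal E)$ is a connected undirected graph without self-loops, $\mathcal V=\{1,\dots,n\}$, with maximum degree $d_{\max}$ and Laplacian $L$; $A,B\in\mathbb R^{m\times m}$ are constant matrices, $\bar d\in(0,1/d_{\max})$, and $M=I_n\otimes A-\bar dL\otimes B\in\mathbb R^{mn\times mn}$, with $(A,B)$ controllable and $M$ Hurwitz stable. The attack-free global state $\mathbf x(t)\in\mathbb R^{mn}$ satisfies $\dot{\mathbf x}=M\mathbf x$. For a set $\mathcal A\subseteq\mathcal V$ of compromised agents with indicator vector $\mu^{\mathcal A}\in\{0,1\}^n$, the false data injected at agent $i$ is $\mathbf u_i^a(t)=\theta(t)\in\mathbb R^m$ if $i\in\mathcal A$ and $\mathbf 0$ otherwise, where $\theta$ is a given attack strategy, and the attacked state is $\mathbf x(\mu^{\mathcal A},t)=e^{Mt}\mathbf x(0)+\int_0^te^{M(t-\tau)}(\mu^{\mathcal A}\otimes\theta(\tau))\,d\tau$. The objective is the convergence error $f(\mathcal A)=\lim_{t\to t_c}\|\mathbf x(\mu^{\mathcal A},t)-\mathbf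 x(t)\|$ (Euclidean norm), where $t_c>0$ is a given time greater than the convergence time of the attack-free system. $c(i)\in\mathbb R_{\ge0}$ is the cost of compromising agent $i$, $\Omega\in\mathbb R_{\ge0}$ the total attack cost budget, $\bar u$ the upper bound on the false data, and $\bar g$ the upper bound on the attack energy (the integral inequality is read entrywise). *)

(* Defs.v *)
From HB Require Import structures.
From mathcomp Require Import all_boot all_order all_algebra.
From mathcomp Require Import complex mxtens.
From mathcomp Require Import all_classical all_reals all_analysis.

Set Implicit Arguments.
Unset Strict Implicit.
Unset Printing Implicit Defensive.
Import Order.TTheory GRing.Theory Num.Theory.
Import numFieldNormedType.Exports.
Local Open Scope classical_set_scope.
Local Open Scope ring_scope.

(** * Polynomial time, NP and NP-hardness *)

Definition bits := seq bool.

(* A cell holds a bit or is blank ([None]). A tape is infinite in both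
   directions: beyond the stored cells everything is blank, and the cells to
   the left of the head are listed nearest first. *)
Definition cell := option bool.

Record tape := Tape { tape_left : seq cell; tape_head : cell; tape_right : seq cell }.

Inductive direction := MoveLeft | Stay | MoveRight.

Definition write_tape (c : cell) (t : tape) : tape :=
  Tape (tape_left t) c (tape_right t).

Definition move_tape (d : direction) (t : tape) : tape :=
  let: Tape l c r := t in
  match d with
  | MoveLeft => Tape (behead l) (head None l) (c :: r)
  | Stay => t
  | MoveRight => Tape (c :: l) (head None r) (behead r)
  end.

Definition tape_of_bits (w : bits) : tape :=
  let s := [seq Some b | b <- w] in Tape [::] (head None s) (behead s).

Fixpoint leading_bits (s : seq cell) : bits :=
  if s is Some b :: s' then b :: leading_bits s' else [::].

Definition bits_of_tape (t : tape) : bits :=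
  leading_bits (tape_head t :: tape_right t).

(* Deterministic Turing machines with [tm_tapes.+1] tapes. *)
Record turing_machine := TuringMachine {
  tm_tapes : nat;
  tm_state : finType;
  tm_start : tm_state;
  tm_halting : pred tm_state;
  tm_trans : tm_state -> {ffun 'I_tm_tapes.+1 -> cell} ->
             tm_state * ('I_tm_tapes.+1 -> cell * direction)
}.

Definition tm_config (M : turing_machine) : Type :=
  (tm_state M * ('I_(tm_tapes M).+1 -> tape))%type.

Definition tm_step (M : turing_machine) (c : tm_config M) : tm_config M :=
  if tm_halting c.1 then c else
  let: (q, act) := tm_trans c.1 [ffun i => tape_head (c.2 i)] in
  (q, fun i => move_tape (act i).2 (write_tape (act i).1 (c.2 i))).

(* The [i]-th input word is written on the [i]-th tape. *)
Definition tm_init (M : turing_machine) (ws : seq bits) : tm_config M :=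
  (tm_start M, fun i : 'I_(tm_tapes M).+1 => tape_of_bits (nth [::] ws i)).

(* The output is read on the first tape, from the head to the first blank. *)
Definition tm_computes (M : turing_machine) (t : nat) (ws : seq bits) (out : bits) :=
  let c := iter t (@tm_step M) (tm_init M ws) in
  tm_halting c.1 /\ bits_of_tape (c.2 ord0) = out.

Definition polytime_fun (f : bits -> bits) : Prop :=
  exists (M : turing_machine) (a d : nat), forall x : bits,
    tm_computes M (a * size x ^ d + a)%N [:: x] (f x).

Definition polytime_rel (V : bits -> bits -> bool) : Prop :=
  exists (M : turing_machine) (a d : nat), forall x y : bits,
    tm_computes M (a * (size x + size y) ^ d + a)%N [:: x; y] [:: V x y].

Definition in_NP (L : bits -> Prop) : Prop :=
  exists V : bits -> bits -> bool, polytime_rel V /\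
  exists a d : nat, forall x : bits,
    L x <-> exists y : bits, (size y <= a * size x ^ d + a)%N /\ V x y.

(* Binary digits, least significant first; each digit is preceded by [true] and
   the end is marked by [false], which makes the code self-delimiting. *)
Fixpoint nat_digits (fuel n : nat) : bits :=
  if fuel is k.+1 then
    if n == 0%N then [::] else odd n :: nat_digits k n./2
  else [::].

Definition nat_code (n : nat) : bits :=
  flatten [seq [:: true; b] | b <- nat_digits n n] ++ [:: false].

Definition int_code (z : int) : bits := (z < 0) :: nat_code `|z|%N.

Definition ints_code (s : seq int) : bits := flatten [seq int_code z | z <- s].

(* The data of an instance are presented as a sequence of integers. *)
Record maximization_problem (R : realType) := MaximizationProblem {
  mp_inst : Type;
  mp_data : mp_inst -> seq int;
  mp_valid : mp_inst -> Prop;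
  mp_sol : mp_inst -> Type;
  mp_feasible : forall I : mp_inst, mp_sol I -> Prop;
  mp_objective : forall I : mp_inst, mp_sol I -> R
}.

Definition rat_data (q : rat) : seq int := [:: numq q; denq q].

Definition decision_code (R : realType) (P : maximization_problem R)
    (IK : mp_inst P * rat) : bits :=
  ints_code (mp_data IK.1 ++ rat_data IK.2).

Definition decision (R : realType) (P : maximization_problem R)
    (IK : mp_inst P * rat) : Prop :=
  exists s : mp_sol IK.1, mp_feasible s /\ ratr IK.2 <= mp_objective s.

(* NP-hardness of the decision version. All queries made by a reduction are
   valid instances, so that the hardness cannot come from recognizing them. *)
Definition NP_hard (R : realType) (P : maximization_problem R) : Prop :=
  forall L : bits -> Prop, in_NP L ->
  exists g : bits -> mp_inst P * rat,
    [/\ forall x, mp_valid (g x).1,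
        polytime_fun (fun x => decision_code (g x)) &
        forall x, L x <-> decision (g x)].

(** * Linear systems *)

Definition norm2 (R : realType) (p : nat) (v : 'cV[R]_p) : R :=
  Num.sqrt (\sum_(i < p) v i 0 ^+ 2).

Definition expmx (R : realType) (p : nat) (X : 'M[R]_p) : 'M[R]_p :=
  \matrix_(i, j) limn (series (fun k : nat => (X ^+ k) i j / k`!%:R)).

Definition integral_cV (R : realType) (p : nat) (t : R) (w : R -> 'cV[R]_p) : 'cV[R]_p :=
  \col_i (\int[lebesgue_measure]_(tau in `[0, t]) (w tau i 0))%R.

Definition free_state (R : realType) (p : nat) (F : 'M[R]_p) (x0 : 'cV[R]_p) (t : R) :
  'cV[R]_p := expmx (t *: F) *m x0.

Definition forced_state (R : realType) (p : nat) (F : 'M[R]_p) (x0 : 'cV[R]_p)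
    (w : R -> 'cV[R]_p) (t : R) : 'cV[R]_p :=
  expmx (t *: F) *m x0 +
  integral_cV t (fun tau => expmx ((t - tau) *: F) *m w tau).

Section MatrixExponential.
Variables (R : realType) (p : nat) (F : 'M[R]_p).

Let cvg_bigsum (u : 'I_p -> nat -> R) (l : 'I_p -> R) :
  (forall i, u i @ \oo --> l i) ->
  (fun N => \sum_i u i N) @ \oo --> \sum_i l i.
Proof.
move=> ul; have -> : (fun N => \sum_i u i N) = \sum_i u i.
  by apply/funext => N; rewrite fct_sumE.
by elim/big_ind2 : _ => // [|x1 x2 y1 y2 H1 H2]; [exact: cvg_cst|exact: cvgD].
Qed.

Let coef (i j : 'I_p) (k : nat) : R := (F ^+ k) i j / k`!%:R.

Let powS k (i j : 'I_p) : (F ^+ k.+1) i j = \sum_l F i l * (F ^+ k) l j.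
Proof. by rewrite exprS !mxE. Qed.

Lemma expmxE t i j : expmx (t *: F) i j = limn (pseries (coef i j) t).
Proof.
rewrite mxE; congr (limn (series _)); apply/funext => k.
suff -> : (t *: F) ^+ k = t ^+ k *: F ^+ k by rewrite mxE /coef -mulrA mulrC.
elim: k => [|k IH]; first by rewrite !expr0 scale1r.
by rewrite !exprS IH -mulmxE -scalemxAl -scalemxAr scalerA.
Qed.

Let bnd : R := \sum_(i < p) \sum_(j < p) `|F i j|.

Let pow_bound k i j : `|(F ^+ k) i j| <= bnd ^+ k.
Proof.
elim: k i j => [|k IH] i j.
  by rewrite !expr0 mxE; case: (i == j); rewrite ?normr1 ?normr0.
rewrite powS exprS (le_trans (ler_norm_sum _ _ _))//.
apply: (@le_trans _ _ (\sum_l `|F i l| * bnd ^+ k)).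
  by apply: ler_sum => l _; rewrite normrM ler_wpM2l.
rewrite -mulr_suml ler_wpM2r//.
  by rewrite exprn_ge0// sumr_ge0// => a _; rewrite sumr_ge0.
by rewrite /bnd [leRHS](bigD1 i)//= lerDl sumr_ge0// => a _; rewrite sumr_ge0.
Qed.

Let cvg_coef i j t : cvgn (pseries (coef i j) t).
Proof.
rewrite /pseries; apply: normed_cvg.
apply: (series_le_cvg _ _ _ (is_cvg_series_exp_coeff (bnd * `|t|))) => k //=.
  by rewrite exp_coeff_ge0// mulr_ge0// sumr_ge0// => a _; rewrite sumr_ge0.
rewrite /exp_coeff /= !normrM normfV normrX normr_nat exprMn mulrAC.
by rewrite ler_pM2r ?invr_gt0 ?ltr0n ?fact_gt0// ler_wpM2r ?exprn_ge0.
Qed.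


Let diffs_coef i j :
  pseries_diffs (coef i j) = fun k => \sum_l F i l * coef l j k.
Proof.
apply/funext => k; rewrite /pseries_diffs /coef powS factS natrM invfM.
rewrite mulrCA mulrA -mulrA mulVKf ?pnatr_eq0//.
by rewrite mulr_suml; apply: eq_bigr => l _; rewrite mulrA.
Qed.

Let cvg_diffs i j t : cvgn (pseries (pseries_diffs (coef i j)) t) /\
  limn (pseries (pseries_diffs (coef i j)) t) =
  \sum_l F i l * limn (pseries (coef l j) t).
Proof.
rewrite diffs_coef.
have -> : pseries (fun k => \sum_l F i l * coef l j k) t =
    fun N => \sum_l F i l * pseries (coef l j) t N.
  apply/funext => N; rewrite /pseries /series /=.
  under eq_bigr do rewrite mulr_suml.
  rewrite exchange_big; apply: eq_bigr => l _; rewrite mulr_sumr.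
  by apply: eq_bigr => k _; rewrite mulrA.
have H : (fun N => \sum_l F i l * pseries (coef l j) t N) @ \oo -->
    \sum_l F i l * limn (pseries (coef l j) t).
  by apply: cvg_bigsum => l; apply: cvgMl_tmp; apply: cvg_coef.
by split; [apply/cvg_ex; eexists; exact: H | exact: cvg_lim H].
Qed.

Lemma expmx_derive (t : R) (i j : 'I_p) :
  is_derive t (1 : R) (fun s : R => expmx (s *: F) i j) ((F *m expmx (t *: F)) i j).
Proof.
have -> : (F *m expmx (t *: F)) i j = limn (pseries (pseries_diffs (coef i j)) t).
  by rewrite (cvg_diffs i j t).2 mxE; apply: eq_bigr => l _; rewrite expmxE.
under eq_fun do rewrite expmxE.
apply: (@pseries_snd_diffs _ _ (`|t| + 1)).
- exact: cvg_coef.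
- exact: (cvg_diffs _ _ _).1.
- rewrite diffs_coef.
  have -> : pseries_diffs (fun k => \sum_l F i l * coef l j k) =
      fun k => \sum_l F i l * pseries_diffs (coef l j) k.
    apply/funext => k; rewrite /pseries_diffs mulr_sumr.
    by apply: eq_bigr => l _; rewrite mulrCA.
  have -> : pseries (fun k => \sum_l F i l * pseries_diffs (coef l j) k) (`|t| + 1) =
      fun N => \sum_l F i l * pseries (pseries_diffs (coef l j)) (`|t| + 1) N.
    apply/funext => N; rewrite /pseries /series /=.
    under eq_bigr do rewrite mulr_suml.
    rewrite exchange_big; apply: eq_bigr => l _; rewrite mulr_sumr.
    by apply: eq_bigr => k _; rewrite mulrA.
  apply/cvg_ex; eexists; apply: cvg_bigsum => l; apply: cvgMl_tmp.
  exact: (cvg_diffs _ _ _).1.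
- by rewrite (lt_le_trans _ (ler_norm _))// ltrDl.
Qed.

Lemma expmx0 : expmx (0 *: F) = 1.
Proof.
apply/matrixP => i j; rewrite expmxE.
rewrite (_ : limn _ = coef i j 0%N); first by rewrite /coef expr0 fact0 divr1.
apply: cvg_lim => //; apply/cvgrPdist_lt => e e0; near=> N.
rewrite /pseries /series /=; have -> : N = N.-1.+1 by rewrite prednK//; near: N; exists 1%N.
rewrite big_nat_recl// big1 ?addr0 => [|k _]; last by rewrite expr0n mulr0.
by rewrite expr0 mulr1 subrr normr0.
Unshelve. all: by end_near. Qed.

(* [free_state] solves the attack-free dynamics. *)
Lemma free_state_derive (x0 : 'cV[R]_p) (t : R) (i : 'I_p) :
  is_derive t (1 : R) (fun s : R => free_state F x0 s i 0) ((F *m free_state F x0 t) i 0).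
Proof.
rewrite /free_state mulmxA mxE.
have -> : (fun s => (expmx (s *: F) *m x0) i 0) =
    \sum_j (fun s => expmx (s *: F) i j * x0 j 0).
  by apply/funext => s; rewrite mxE fct_sumE.
apply: is_derive_sum => j.
have H := expmx_derive t i j.
have -> : (fun s => expmx (s *: F) i j * x0 j 0) =
    (x0 j 0) *: (fun s => expmx (s *: F) i j).
  by apply/funext => s; rewrite /= mulrC.
by rewrite mulrC; exact: is_deriveZ.
Qed.

Lemma free_state0 (x0 : 'cV[R]_p) : free_state F x0 0 = x0.
Proof. by rewrite /free_state expmx0 mul1mx. Qed.
End MatrixExponential.

(* Every state can be steered to every state in some finite time by some
   continuous input of dx/dt = A x + B u. *)
Definition controllable (R : realType) (m : nat) (A B : 'M[R]_m) : Prop :=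
  forall x0 x1 : 'cV[R]_m, exists (T : R) (u : R -> 'cV[R]_m),
    [/\ 0 < T, forall i, continuous (fun t => u t i 0) &
        forced_state A x0 (fun t => B *m u t) T = x1].

Definition hurwitz (R : realType) (p : nat) (F : 'M[R]_p) : Prop :=
  forall z : complex R,
    eigenvalue (map_mx (real_complex R) F) z -> complex.Re z < 0.

(* First time from which the state stays within distance [eps] of its limit,
   which is 0 for a Hurwitz stable system. *)
Definition convergence_time (R : realType) (eps : R) (p : nat) (F : 'M[R]_p)
    (x0 : 'cV[R]_p) : R :=
  inf [set T : R | 0 <= T /\ forall t, T <= t -> norm2 (free_state F x0 t) <= eps].

(** * The attack selection problem *)

Section Graph.
Variables (n : nat) (adj : 'M[bool]_n).

Definition degree (i : 'I_n) : nat := #|[set j | adj i j]|.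

Definition max_degree : nat := (\max_(i < n) degree i)%N.

Definition laplacian (R : realType) : 'M[R]_n :=
  \matrix_(i, j) ((if i == j then (degree i)%:R else 0) - (adj i j)%:R).

Definition connected_simple_graph : Prop :=
  [/\ symmetric adj, irreflexive adj & forall i j, connect adj i j].
End Graph.

(* All the data of an instance but the attack strategy, over a set [K] of
   numbers; the agents are 'I_n. *)
Record p1_data (K : Type) := P1Data {
  p1_n : nat;
  p1_m : nat;
  p1_adj : 'M[bool]_p1_n;
  p1_A : 'M[K]_p1_m;
  p1_B : 'M[K]_p1_m;
  p1_dbar : K;
  p1_x0 : 'cV[K]_(p1_n * p1_m);
  p1_cost : 'cV[K]_p1_n;
  p1_Omega : K;
  p1_ubar : K;
  p1_gbar : 'cV[K]_p1_m;
  p1_tc : K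
}.

Section Problem.
Variables (R : realType) (D : p1_data R).
Let n := p1_n D.
Let m := p1_m D.

Definition p1_M : 'M[R]_(n * m) :=
  1%:M *t p1_A D - (p1_dbar D *: laplacian (p1_adj D) R) *t p1_B D.

Record p1_well_posed (eps : R) : Prop := P1WellPosed {
  p1_agents : (0 < n)%N;
  p1_dim : (0 < m)%N;
  p1_graph : connected_simple_graph (p1_adj D);
  p1_dbar_range : 0 < p1_dbar D < 1 / (max_degree (p1_adj D))%:R;
  p1_controllable : controllable (p1_A D) (p1_B D);
  p1_stable : hurwitz p1_M;
  p1_cost_ge0 : forall i, 0 <= p1_cost D i 0;
  p1_Omega_ge0 : 0 <= p1_Omega D;
  p1_tc_gt0 : 0 < p1_tc D;
  p1_tc_late : convergence_time eps p1_M (p1_x0 D) < p1_tc D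
}.

Variable theta : R -> 'cV[R]_m.

Definition p1_false_data (S : {set 'I_n}) (i : 'I_n) (t : R) : 'cV[R]_m :=
  if i \in S then theta t else 0.

Definition p1_indicator (S : {set 'I_n}) : 'cV[R]_n := \col_i (i \in S)%:R.

Definition p1_attacked_state (S : {set 'I_n}) (t : R) : 'cV[R]_(n * m) :=
  forced_state p1_M (p1_x0 D) (fun tau => p1_indicator S *t theta tau) t.

Definition p1_error (S : {set 'I_n}) : R :=
  lim ((fun t => norm2 (p1_attacked_state S t - free_state p1_M (p1_x0 D) t))
         @ (p1_tc D)^').

Definition p1_admissible (S : {set 'I_n}) : Prop :=
  [/\ forall i t, 0 <= t <= p1_tc D -> norm2 (p1_false_data S i t) <= p1_ubar D,
      \sum_(i in S) p1_cost D i 0 <= p1_Omega D &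
      forall k, integral_cV (p1_tc D) theta k 0 <= p1_gbar D k 0].
End Problem.

(* Finite instances: rational data and a constant attack vector. *)
Record p1_instance := P1Instance {
  inst_data : p1_data rat;
  inst_theta : 'cV[rat]_(p1_m inst_data)
}.

Definition mx_data (K : Type) (f : K -> seq int) (p q : nat) (X : 'M[K]_(p, q)) :
  seq int := flatten [seq f (X i j) | i <- enum 'I_p, j <- enum 'I_q].

Definition inst_ints (I : p1_instance) : seq int :=
  let D := inst_data I in
  [:: (p1_n D)%:Z; (p1_m D)%:Z] ++
  mx_data (fun b : bool => [:: (b : nat)%:Z]) (p1_adj D) ++
  mx_data rat_data (p1_A D) ++ mx_data rat_data (p1_B D) ++
  rat_data (p1_dbar D) ++ mx_data rat_data (p1_x0 D) ++
  mx_data rat_data (p1_cost D) ++ rat_data (p1_Omega D) ++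
  rat_data (p1_ubar D) ++ mx_data rat_data (p1_gbar D) ++
  rat_data (p1_tc D) ++ mx_data rat_data (inst_theta I).

Definition real_data (R : realType) (D : p1_data rat) : p1_data R :=
  {| p1_n := p1_n D;
     p1_m := p1_m D;
     p1_adj := p1_adj D;
     p1_A := map_mx ratr (p1_A D);
     p1_B := map_mx ratr (p1_B D);
     p1_dbar := ratr (p1_dbar D);
     p1_x0 := map_mx ratr (p1_x0 D);
     p1_cost := map_mx ratr (p1_cost D);
     p1_Omega := ratr (p1_Omega D);
     p1_ubar := ratr (p1_ubar D);
     p1_gbar := map_mx ratr (p1_gbar D);
     p1_tc := ratr (p1_tc D) |}.

(* The problem under time-invariant attack strategies; [eps] is the tolerance
   to which the convergence time refers. *)
Definition P1_time_invariant (R : realType) (eps : R) : maximization_problem R :=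
  {| mp_inst := p1_instance;
     mp_data := inst_ints;
     mp_valid := fun I => p1_well_posed (real_data R (inst_data I)) eps;
     mp_sol := fun I => {set 'I_(p1_n (inst_data I))};
     mp_feasible := fun I S =>
       @p1_admissible R (real_data R (inst_data I))
         (fun _ => map_mx ratr (inst_theta I)) S;
     mp_objective := fun I S =>
       @p1_error R (real_data R (inst_data I))
         (fun _ => map_mx ratr (inst_theta I)) S |}.

Section Codes.
Let parsable (T U : Type) (f : T -> seq U) : Prop :=
  forall x y s t, f x ++ s = f y ++ t -> x = y /\ s = t.

Let parsable_nat_code : parsable nat_code.
Proof.
pose val (w : bits) : nat := foldr (fun (b : bool) n => b + n.*2)%N 0%N w.
have digitsK n : val (nat_digits n n) = n.
  suff H k : forall m, (m <= k)%N -> val (nat_digits k m) = m by exact: H.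
  elim: k => [|k IH] m /=; first by rewrite leqn0 => /eqP ->.
  case: eqP => [-> //|/eqP]; rewrite -lt0n => m0 mk /=.
  rewrite IH ?odd_double_half// -ltnS; apply: leq_trans mk.
  by rewrite -divn2 ltn_Pdiv.
move=> n m s t; rewrite /nat_code -!catA /= => E.
suff [H ->] : nat_digits n n = nat_digits m m /\ s = t by rewrite -(digitsK n) H digitsK.
elim: (nat_digits n n) (nat_digits m m) E => [|a u IH] [|b v] //=; first by case.
by case=> -> /IH[-> ->].
Qed.

Let parsable_int_code : parsable int_code.
Proof.
move=> x y s t /= [Es /parsable_nat_code[Ea ->]]; split=> //.
rewrite (intEsign x) (intEsign y); congr (_ * _); last by rewrite Ea.
by congr ((-1) ^+ _); rewrite Es.
Qed.

Lemma ints_code_inj : injective ints_code.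
Proof.
elim=> [|x u IH] [|y v] // E.
have [-> /IH ->] // := @parsable_int_code x y (ints_code u) (ints_code v) E.
Qed.

Let parsable_rat_data : parsable rat_data.
Proof.
move=> x y s t [En Ed ->]; split=> //.
by rewrite -(divq_num_den x) -(divq_num_den y) En Ed.
Qed.

Let parsable_bool : parsable (fun b : bool => [:: (b : nat)%:Z]).
Proof. by move=> [] [] s t // [->]. Qed.

Let parsable_mx_data (K : eqType) (f : K -> seq int) p q :
  parsable f -> parsable (@mx_data K f p q).
Proof.
move=> pf X Y s t; rewrite /mx_data.
set l := [seq (i, j) | i <- enum 'I_p, j <- enum 'I_q].
have E (Z : 'M[K]_(p, q)) : [seq f (Z i j) | i <- enum 'I_p, j <- enum 'I_q] =
    [seq f (Z ij.1 ij.2) | ij <- l] by rewrite map_allpairs.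
rewrite (E X) (E Y) => {}E.
suff [H ->] : (forall ij, ij \in l -> X ij.1 ij.2 = Y ij.1 ij.2) /\ s = t.
  split=> //; apply/matrixP => i j; apply: (H (i, j)).
  by apply/allpairsP; exists (i, j); rewrite !mem_enum.
elim: l E => [|ij l IH] //=; rewrite -!catA => /pf[Eij /IH[H ->]]; split=> //.
by move=> kl; rewrite inE => /predU1P[-> //|/H].
Qed.

(* Distinct pairs of an instance and a threshold have distinct codes. *)
Lemma decision_code_inj (R : realType) (eps : R) :
  injective (@decision_code R (P1_time_invariant eps)).
Proof.
have pr := parsable_rat_data.
have pm p q := @parsable_mx_data rat rat_data p q parsable_rat_data.
have pb p q := @parsable_mx_data bool _ p q parsable_bool.
move=> [[[n m adj A B d x0 c W u g tc] th] K] [[[n' m' adj' A' B' d' x0' c' W' u' g' tc'] th'] K'].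
move=> /ints_code_inj E.
have {E} : inst_ints (P1Instance th) ++ rat_data K =
           inst_ints (P1Instance th') ++ rat_data K' by exact: E.
have p2 (i i' j j' : nat) (s t : seq int) :
    [:: i%:Z; j%:Z] ++ s = [:: i'%:Z; j'%:Z] ++ t -> [/\ i = i', j = j' & s = t].
  by case=> -> -> ->.
rewrite /inst_ints -!catA => /p2[En Em].
change (n = n') in En; change (m = m') in Em; subst n' m'.
move=> /pb[E1] /pm[E2] /pm[E3] /pr[E4] /pm[E5] /pm[E6].
move=> /pr[E7] /pr[E8] /pm[E9] /pr[E10] /pm[E11] [EK1 EK2].
move: E1 E2 E3 E4 E5 E6 E7 E8 E9 E10 E11 => /= -> -> -> -> -> -> -> -> -> -> ->.
by rewrite -(divq_num_den K) -(divq_num_den K') EK1 EK2.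
Qed.
End Codes.

(* Main.v *)
(* Reduction from a verifier. On a given input, the accepting computations for
   all certificates of bounded size are the tableaux of W * W squares that obey
   conditions on single squares and on pairs of squares. Take a vertex for every
   position and every content of a square, and join two vertices when their
   contents are incompatible: the accepting computations are the independent sets
   of W * W admissible vertices. Every vertex also gets a dummy twin, such that a
   candidate is joined to exactly one of any vertex and its twin; hence all
   candidates have degree N / 2, where N is the number of all vertices.

   The vertices are agents with scalar states, A = -2, B = -1, dbar = 1 / N and
   x(0) = 0, so that M = -2 + L / N. To second order in tc,
     f(S)^2 = (tc theta)^2 (|S| (1 - 3/2 tc) - (tc / N) e(S)),
   where e(S) counts the ordered adjacent pairs in S: the degrees only contribute
   to the first term because they are equal. The costs (1 for the admissible
   agents, N for the others) and the budget W^2 restrict S to at most W^2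
   admissible agents, and for tc of order 1 / N^2 a suitable theta makes f(S) >= W
   equivalent to |S| = W^2 and e(S) = 0. Since x(0) = 0, the attack-free system
   has converged from the start, and every tc > 0 is late enough. *)

Require Import Defs.
From HB Require Import structures.
From mathcomp Require Import all_boot all_order all_algebra.
From mathcomp Require Import complex mxtens.
From mathcomp Require Import all_classical all_reals all_analysis.
From mathcomp Require Import ring lra zify.

Set Implicit Arguments.
Unset Strict Implicit.
Unset Printing Implicit Defensive.
Import Order.TTheory GRing.Theory Num.Theory.
Import numFieldNormedType.Exports.
Local Open Scope ring_scope.

(** * Exponentials of matrices with bounded rows *)

(** The objective is an irrational value of a matrix exponential, so the reduction needs a rational
    threshold with a certified gap. A constant input can be written [F *m v] because [F] is
    invertible, which turns the response into [expmx (t *: F) *m v - v] and leaves only a Taylor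
    estimate. The gap is the loss 2 t / N caused by one edge, counted as two ordered pairs. The
    total Taylor error is at most 12 N t^2, and t = 1 / (100 N^2) makes it 0.12 t / N. The attack is
    tuned so that k = W^2 independent vertices overshoot k by about t / N, while every other set
    falls short by about as much or more.

    The other obstacle is that polynomial time means an explicit Turing machine. It does no
    arithmetic: every large number of the instance is a polynomial in W whose coefficients depend
    only on the verifier, and is counted in binary within nested loops over unary rulers of length
    W. The number of contents of a square is constant, so loops over contents are unrolled, and the
    compatibility of two squares is a table indexed by what marks on a few tapes show about their
    relative position. *)

Section BoundedRows.
Local Open Scope classical_set_scope.
Variables (R : realType) (p : nat) (F : 'M[R]_p).
Hypothesis rowF : forall i, \sum_j `|F i j| <= 2.

Lemma mulmx_row_bound (u : 'cV[R]_p) (c : R) :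
  (forall j, `|u j 0| <= c) -> forall i, `|(F *m u) i 0| <= 2 * c.
Proof.
move=> uc i; rewrite mxE (le_trans (ler_norm_sum _ _ _)) //.
apply: (@le_trans _ _ (\sum_j `|F i j| * c)).
  by apply: ler_sum => j _; rewrite normrM ler_wpM2l.
rewrite -mulr_suml ler_wpM2r ?rowF //.
exact: le_trans (uc i).
Qed.

Lemma expr_row_bound (u : 'cV[R]_p) (c : R) k :
  (forall j, `|u j 0| <= c) -> forall i, `|(F ^+ k *m u) i 0| <= 2 ^+ k * c.
Proof.
move=> uc; elim: k => [|k IH] i; first by rewrite expr0 mul1mx expr0 mul1r.
rewrite exprS -mulmxE -mulmxA (le_trans (mulmx_row_bound IH i)) //.
by rewrite exprS mulrA.
Qed.

Lemma expr_entry_bound k i j : `|(F ^+ k) i j| <= 2 ^+ k.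
Proof.
have -> : (F ^+ k) i j = (F ^+ k *m delta_mx j (0 : 'I_1)) i 0.
  by rewrite -[RHS]/((F ^+ k *m delta_mx j 0) i 0) -colE mxE.
rewrite -[leRHS]mulr1; apply: expr_row_bound => l.
by rewrite mxE eqxx andbT; case: eqP; rewrite ?normr1 ?normr0.
Qed.

Lemma expr_scale s k : (s *: F) ^+ k = s ^+ k *: F ^+ k.
Proof.
elim: k => [|k IH]; first by rewrite !expr0 scale1r.
by rewrite !exprS IH -mulmxE -scalemxAl -scalemxAr scalerA.
Qed.

Lemma cvg_expmx s i j :
  series (fun k => s ^+ k / k`!%:R * (F ^+ k) i j) @ \oo --> expmx (s *: F) i j.
Proof.
rewrite mxE.
have -> : (fun k => s ^+ k / k`!%:R * (F ^+ k) i j) =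
    (fun k => ((s *: F) ^+ k) i j / k`!%:R).
  by apply/funext => k; rewrite expr_scale [in RHS]mxE mulrAC.
apply: normed_cvg.
apply: (series_le_cvg _ _ _ (is_cvg_series_exp_coeff (2 * `|s|))) => k //=.
  by rewrite exp_coeff_ge0 // mulr_ge0.
rewrite expr_scale [in leLHS]mxE !normrM normfV normrX normr_nat /exp_coeff /=.
rewrite exprMn ler_pM2r ?invr_gt0 ?ltr0n ?fact_gt0 // mulrC ler_wpM2r ?exprn_ge0 //.
exact: expr_entry_bound.
Qed.

Definition exp_term (s : R) (u : 'cV[R]_p) (i : 'I_p) (k : nat) : R :=
  s ^+ k / k`!%:R * (F ^+ k *m u) i 0.

Lemma cvg_finsum (T : Type) (G : set_system T) (FG : Filter G) (J : finType)
    (u : J -> T -> R) (l : J -> R) :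
  (forall j, u j @ G --> l j) -> (fun n => \sum_j u j n) @ G --> \sum_j l j.
Proof.
move=> ul; have -> : (fun n => \sum_j u j n) = \sum_j u j.
  by apply/funext => n; rewrite fct_sumE.
by elim/big_ind2 : _ => // [|x1 x2 y1 y2 H1 H2]; [exact: cvg_cst|exact: cvgD].
Qed.

Lemma cvg_exp_term s u i : series (exp_term s u i) @ \oo --> (expmx (s *: F) *m u) i 0.
Proof.
rewrite mxE; have -> : series (exp_term s u i) = fun n =>
    \sum_j series (fun k => s ^+ k / k`!%:R * (F ^+ k) i j) n * u j 0.
  apply/funext => n; rewrite /series /=.
  under [RHS]eq_bigr do rewrite mulr_suml.
  rewrite exchange_big; apply: eq_bigr => k _; rewrite /exp_term mxE mulr_sumr.
  by apply: eq_bigr => j _; rewrite mulrA.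
by apply: cvg_finsum => j; apply: cvgMr_tmp; exact: cvg_expmx.
Qed.

(** The derivative of the free state carries [F] on the left, the integrand of the response carries
    it next to [v]; this reconciles them. *)
Lemma expmx_comm s (v : 'cV[R]_p) : expmx (s *: F) *m (F *m v) = F *m (expmx (s *: F) *m v).
Proof.
apply/colP => i; have c1 := @cvg_exp_term s (F *m v) i.
suff c2 : series (exp_term s (F *m v) i) @ \oo --> (F *m (expmx (s *: F) *m v)) i 0.
  by apply: (cvg_unique _ c1 c2).
rewrite mxE; have -> : series (exp_term s (F *m v) i) = fun n =>
    \sum_j F i j * series (exp_term s v j) n.
  apply/funext => n; rewrite /series /=.
  under [RHS]eq_bigr do rewrite mulr_sumr.
  rewrite exchange_big; apply: eq_bigr => k _; rewrite /exp_term.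
  have -> : F ^+ k *m (F *m v) = F *m (F ^+ k *m v) by rewrite !mulmxA !mulmxE -exprSr exprS.
  rewrite mxE mulr_sumr.
  by apply: eq_bigr => j _; rewrite mulrCA.
by apply: cvg_finsum => j; apply: cvgMl_tmp; exact: cvg_exp_term.
Qed.

(** The offset 3 skips the terms of degree 0, 1 and 2, which the Taylor estimate below subtracts. *)
Lemma cvg_abs_le (u : nat -> R) (l a b : R) :
  u @ \oo --> l -> (forall n, `|u (n + 3)%N - a| <= b) -> `|l - a| <= b.
Proof.
move=> ul H; apply/ler_addgt0Pr => e e0.
have /cvgrPdist_le/(_ e e0) [N _ /(_ (N + 3)%N (leq_addr _ _))] := ul.
rewrite /= => h; rewrite -(subrK (u (N + 3)%N) l) -addrA (le_trans (ler_normD _ _)) //.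
by rewrite [leRHS]addrC lerD.
Qed.

(* [expmx (s *: F) *m v - v] is the response to the constant input [F v]. *)
Lemma expmx_taylor (v : 'cV[R]_p) (c s : R) i : 0 <= s <= 4^-1 ->
  (forall j, `|(F *m v) j 0| <= c) ->
  `|(expmx (s *: F) *m v - v) i 0 - (s * (F *m v) i 0 + s ^+ 2 / 2 * (F *m (F *m v)) i 0)|
    <= 2 * c * s ^+ 3.
Proof.
move=> /andP[s0 s4] vc; have c0 : 0 <= c by exact: le_trans (vc i).
set T := s * _ + _.
have l := @cvg_exp_term s v i; rewrite mxE [(- v) i 0]mxE -addrA -opprD.
apply: (cvg_abs_le l) => n.
(* The term of degree n + 3 is at most c s^3 (2 s)^n, and 2 s <= 1/2: the tail is dominated by a
   geometric series. *)
suff H : `|series (exp_term s v i) (n + 3)%N - (v i 0 + T)| <= 2 * c * s ^+ 3 * (1 - 2^-1 ^+ n).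
  apply: (le_trans H); apply: ler_piMr; first by rewrite !mulr_ge0 ?exprn_ge0.
  by rewrite lerBlDr lerDl exprn_ge0 // invr_ge0.
elim: n => [|n IH].
  rewrite add0n /series /= !big_nat_recr //= big_geq // add0r /exp_term.
  rewrite !expr0 !expr1 !expr2 mul1mx !divr1 !mul1r -mulmxE -mulmxA.
  by rewrite -expr2 (_ : 2`! = 2%N) // -addrA -/T !subrr normr0 mulr0.
rewrite addSn seriesSr addrAC (le_trans (ler_normD _ _)) //.
have -> : 2 * c * s ^+ 3 * (1 - 2^-1 ^+ n.+1) =
    2 * c * s ^+ 3 * (1 - 2^-1 ^+ n) + c * s ^+ 3 * 2^-1 ^+ n by rewrite (exprS _ n); move: (2^-1 ^+ n) => x; field.
rewrite lerD // /exp_term addnS [F ^+ _]exprSr -mulmxE -mulmxA normrM.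
have /le_trans -> // : `|s ^+ (n + 2).+1 / ((n + 2).+1)`!%:R| * `|(F ^+ (n + 2) *m (F *m v)) i 0| <=
    (s ^+ (n + 2).+1 / 4) * (2 ^+ (n + 2) * c).
  apply: ler_pM => //; last exact: expr_row_bound.
  rewrite ger0_norm ?divr_ge0 ?exprn_ge0 // ler_wpM2l ?exprn_ge0 //.
  rewrite lef_pV2 ?posrE ?ltr0n ?fact_gt0 // ler_nat.
  by rewrite addn2 factS (@leq_mul 2 2) // (leq_trans _ (fact_geq _)).
have -> : s ^+ (n + 2).+1 / 4 * (2 ^+ (n + 2) * c) = c * s ^+ 3 * (2 * s) ^+ n.
  by rewrite -addnS !exprD exprMn; move: (s ^+ n) (2 ^+ n) => x y; field.
rewrite ler_wpM2l ?mulr_ge0 ?exprn_ge0 // lerXn2r ?nnegrE ?mulr_ge0 //.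
by lra.
Qed.

Lemma continuous_free (v : 'cV[R]_p) i : continuous (fun s : R => free_state F v s i 0).
Proof.
move=> s; apply: differentiable_continuous; apply/derivable1_diffP.
exact: (@ex_derive _ _ _ _ _ _ _ (free_state_derive F v s i)).
Qed.

Lemma integral_free (v : 'cV[R]_p) (t : R) i : 0 < t ->
  (\int[lebesgue_measure]_(tau in `[0%R, t]) (expmx ((t - tau) *: F) *m (F *m v)) i 0)%R =
  (expmx (t *: F) *m v - v) i 0.
Proof.
move=> t0.
(* [G] is an antiderivative of the integrand, for the fundamental theorem of calculus. *)
pose G (tau : R) : R := - free_state F v (t - tau) i 0.
pose f (tau : R) : R := free_state F (F *m v) (t - tau) i 0.
have dsub (tau : R) : is_derive tau (1 : R) (fun s : R => t - s) (- 1 : R).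
  by rewrite -[X in is_derive _ _ _ X]add0r; apply: is_deriveB.
have dG (tau : R) : is_derive tau (1 : R) G (f tau).
  have h := is_deriveN (@is_derive1_comp R (fun s => free_state F v s i 0) (fun s => t - s)
    tau _ _ (free_state_derive F v (t - tau) i) (dsub tau)).
  by move: h; rewrite mulrN1 opprK /f /free_state expmx_comm.
have csub : continuous (fun s : R => t - s).
  move=> s; apply: differentiable_continuous; apply/derivable1_diffP.
  exact: (@ex_derive _ _ _ _ _ _ _ (dsub s)).
have cf : continuous f.
  by move=> s; apply: (@continuous_comp _ _ _ (fun s => t - s)
    (fun s => free_state F (F *m v) s i 0)); [exact: csub | exact: continuous_free].
have cG : continuous G.
  move=> s; apply: differentiable_continuous; apply/derivable1_diffP.
  exact: (@ex_derive _ _ _ _ _ _ _ (dG s)).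
have := @continuous_FTC2 R f G 0 t t0.
rewrite /Rintegral /f /free_state => ->; last 3 first.
- exact: continuous_subspaceT.
- split; first by move=> x _; exact: (@ex_derive _ _ _ _ _ _ _ (dG x)).
  + by apply: cvg_at_right_filter; exact: cG.
  + by apply: cvg_at_left_filter; exact: cG.
- by move=> x _; rewrite derive1E; exact: (@derive_val _ _ _ _ _ _ _ (dG x)).
by rewrite -EFinB /= /G subrr subr0 free_state0 opprK addrC [RHS]mxE [X in _ = _ + X]mxE.
Qed.

Lemma forced_minus_free (x0 : 'cV[R]_p) (v : 'cV[R]_p) (t : R) : 0 < t ->
  forced_state F x0 (fun _ => F *m v) t - free_state F x0 t = expmx (t *: F) *m v - v.
Proof.
move=> t0; rewrite /forced_state /free_state addrAC subrr add0r.
by apply/colP => i; rewrite mxE integral_free.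
Qed.

(** The punctured limit is the value at [t] by continuity in time; the closed form of the error
    requires a positive time, which holds near [t]. *)
Lemma lim_forced_error (x0 : 'cV[R]_p) (v : 'cV[R]_p) (t : R) : 0 < t ->
  lim ((fun s => norm2 (forced_state F x0 (fun _ => F *m v) s - free_state F x0 s)) @ t^') =
  norm2 (expmx (t *: F) *m v - v).
Proof.
move=> t0; apply: cvg_lim => //.
pose g s := norm2 (expmx (s *: F) *m v - v).
have cg : g @ t --> g t.
  pose h s := \sum_(i < p) (expmx (s *: F) *m v - v) i 0 ^+ 2.
  suff ch : h @ t --> h t.
    exact: (continuous_cvg _ (@sqrt_continuous R (h t)) ch).
  rewrite /h; apply: cvg_finsum => i; apply: cvgM;
    (under eq_fun do rewrite mxE); rewrite mxE;
    by apply: cvgD; [exact: continuous_free | exact: cvg_cst].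
have gE : {near t^', g =1 (fun s => norm2 (forced_state F x0 (fun _ => F *m v) s - free_state F x0 s))}.
  near=> s; rewrite /g forced_minus_free //; near: s.
  by apply: nbhs_dnbhs; exact: lt_nbhsr.
apply: cvg_trans; first exact: (near_eq_cvg gE).
apply: cvg_trans cg; apply: cvg_app; exact: nbhs_dnbhs.
Unshelve. all: by end_near. Qed.
End BoundedRows.

(** * The threshold *)

Section Threshold.
Variables (R : realType) (k N t : R).
Hypotheses (k1 : 1 <= k) (kN : k <= N) (N2 : 2 <= N) (tE : 100 * N ^+ 2 * t = 1).

(** This is the value of [t * theta]. Its square is about 1 + 3/2 t + t / (N k): the first part
    cancels the factor 1 - 3/2 t common to all sets, the second lifts k by t / N, half of what one
    edge costs. *)
Let gain := 1 + 3 / 4 * t + t / (2 * N * k).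

Let tau := t / N.
Let sigma := tau / k.

Let t0 : 0 < t.
Proof.
have : 0 < 100 * N ^+ 2 * t by rewrite tE.
rewrite pmulr_rgt0 // mulr_gt0 // exprn_gt0 //.
exact: lt_le_trans N2.
Qed.

Let N0 : N != 0. Proof. by apply/lt0r_neq0/(lt_le_trans _ N2). Qed.
Let k0 : k != 0. Proof. by apply/lt0r_neq0/(lt_le_trans _ k1). Qed.
Let tau0 : 0 < tau. Proof. by rewrite divr_gt0 // (lt_le_trans _ N2). Qed.
Let sigma0 : 0 < sigma. Proof. by rewrite divr_gt0 // (lt_le_trans _ k1). Qed.
Let ksigma : k * sigma = tau. Proof. by rewrite /sigma mulrC divfK. Qed.
Let Ntau : N * tau = t. Proof. by rewrite /tau mulrC divfK. Qed.
(** The origin of the factor 100: the error 12 N t^2 becomes 12/100 of [tau], the margin on either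
    side of the threshold. *)
Let Nt2 : N * t ^+ 2 = tau / 100.
Proof.
have -> : N * t ^+ 2 = (100 * N ^+ 2 * t) * (tau / 100) by rewrite -Ntau; field.
by rewrite tE mul1r.
Qed.
Let N12 : 12 * N * t ^+ 2 = 12 * (tau / 100). Proof. by rewrite -mulrA Nt2. Qed.
Let kt2 : k * t ^+ 2 <= tau / 100.
Proof. by rewrite -Nt2 ler_wpM2r // exprn_ge0 // ltW. Qed.
Let tsmall : t <= 1 / 400. Proof.
have h4 : 4 <= N ^+ 2 by rewrite expr2; have := N2; nra.
have : 0 <= (N ^+ 2 - 4) * t by rewrite mulr_ge0 ?subr_ge0 // ltW.
by have := tE; rewrite mulrBl -mulrA; move: (N ^+ 2 * t) => x; lra.
Qed.
Let tau_le : tau <= t / 2. Proof. by rewrite ler_pdivlMr // mulrC -Ntau ler_wpM2r // ltW. Qed.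
Let sigma_le : sigma <= tau. Proof. by rewrite -ksigma ler_peMl // ltW. Qed.
Let tau_t : t * tau <= tau / 400.
Proof. by rewrite mulrC -[400^-1]mul1r ler_wpM2l // ltW. Qed.
Let tau_sigma : tau * sigma <= tau / 800.
Proof.
by rewrite ler_wpM2l ?(ltW tau0) // (le_trans sigma_le) // (le_trans tau_le) //; have h := tsmall; lra.
Qed.
Let gainE : gain = 1 + 3 / 4 * t + sigma / 2.
Proof. by rewrite /gain /sigma /tau; field; rewrite N0 k0. Qed.

Lemma threshold_yes g : k * (1 - 3 / 2 * t) - 12 * N * t ^+ 2 <= g -> k <= gain ^+ 2 * g.
Proof.
(* The square of 3/4 t + sigma/2 is dropped. *)
move=> hg; have h1 : 1 + 3 / 2 * t + sigma <= gain ^+ 2.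
  rewrite gainE; have h1 := t0; have h2 := sigma0; nra.
have h2 : 0 <= k * (1 - 3 / 2 * t) - 12 * N * t ^+ 2.
  by rewrite N12; have h3 := tsmall; have h4 := tau_le; have h5 := k1; have h6 := t0; nra.
apply: (@le_trans _ _ ((1 + 3 / 2 * t + sigma) * (k * (1 - 3 / 2 * t) - 12 * N * t ^+ 2))).
  rewrite N12.
  have -> : (1 + 3 / 2 * t + sigma) * (k * (1 - 3 / 2 * t) - 12 * (tau / 100)) =
    k + k * sigma - 9 / 4 * (k * t ^+ 2) - 3 / 2 * t * (k * sigma)
      - 12 / 100 * tau * (1 + 3 / 2 * t + sigma) by field.
  rewrite ksigma; have h7 := kt2; have h8 := tau0; have h9 := tsmall; have h28 := sigma_le.
  have h10 := tau_t; have h11 := tau_sigma; move: h7 h8 h10 h11.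
  by move: (k * t ^+ 2) => x; nra.
apply: ler_pM => //; have h12 := t0; have h13 := sigma0; nra.
Qed.

Lemma threshold_no g : g <= k * (1 - 3 / 2 * t) - 2 * t / N + 12 * N * t ^+ 2 ->
  gain ^+ 2 * g < k.
Proof.
have -> : 2 * t / N = 2 * tau by rewrite -mulrA.
rewrite N12 => hg.
(* The square of 3/4 t + sigma/2 is at most 2 t^2, because sigma <= t / 2. *)
have h1 : gain ^+ 2 <= 1 + 3 / 2 * t + sigma + 2 * t ^+ 2.
  rewrite gainE; have h14 := t0; have h15 := sigma0; have h16 := sigma_le; have h17 := tau_le; nra.
set G := k * _ - _ + _ in hg.
have G0 : 0 <= G.
  by rewrite /G; have h18 := tsmall; have h19 := tau_le; have h20 := k1; have h21 := t0; nra.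
apply: (@le_lt_trans _ _ ((1 + 3 / 2 * t + sigma + 2 * t ^+ 2) * G)).
  apply: (@le_trans _ _ (gain ^+ 2 * G)); first by rewrite ler_wpM2l // sqr_ge0.
  by rewrite ler_wpM2r.
(* The constant 188/100 is 2 - 12/100, the loss from an edge less the error; it outweighs the
   surplus [k * sigma], which is [tau]. *)
have -> : (1 + 3 / 2 * t + sigma + 2 * t ^+ 2) * G =
    k + k * sigma - 9 / 4 * (k * t ^+ 2) - 3 / 2 * t * (k * sigma)
    + 2 * (k * t ^+ 2) * (1 - 3 / 2 * t)
    - (188 / 100) * tau * (1 + 3 / 2 * t + sigma + 2 * t ^+ 2) by rewrite /G; field.
rewrite ksigma; have h22 := kt2; have h23 := tau0; have h24 := tsmall; have h30 := sigma_le.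
have h25 := tau_t; have h26 := t0; have h31 := sigma0.
have h32 : 0 <= k * t ^+ 2 by rewrite mulr_ge0 ?sqr_ge0 // (le_trans _ k1).
have h33 : 0 <= tau * t ^+ 2 by rewrite mulr_ge0 ?sqr_ge0 // ltW.
have h34 : 0 <= k * t ^+ 2 * t by rewrite mulr_ge0 // ltW.
have h35 : 0 <= t * tau by rewrite mulr_ge0 // ltW.
have h36 : 0 <= tau * sigma by rewrite mulr_ge0 // ltW.
move: h22 h32 h34; move: (k * t ^+ 2) => x; nra.
Qed.

(** Here [a] is a coordinate of the indicator, [b] the same coordinate of its image under the system
    matrix and [r] the Taylor remainder. Beyond first order only the square of t/2 b + r and 2 a r
    are left, each at most 4 t^2. *)
Lemma response_term (a b r : R) : 0 <= a <= 1 -> `|b| <= 2 -> `|r| <= 2 * t ^+ 2 ->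
  `|(a + t / 2 * b + r) ^+ 2 - (a ^+ 2 + t * (a * b))| <= 12 * t ^+ 2.
Proof.
move=> /andP[a0 a1]; rewrite !ler_norml => /andP[b1 b2] /andP[r1 r2].
have ht0 := t0; have ht := tsmall.
have -> : (a + t / 2 * b + r) ^+ 2 - (a ^+ 2 + t * (a * b)) =
  (t / 2 * b + r) ^+ 2 + 2 * a * r by field.
have hr : - (4 * t ^+ 2) <= 2 * a * r <= 4 * t ^+ 2 by apply/andP; split; nra.
have hu : - (2 * t) <= t / 2 * b + r <= 2 * t by apply/andP; split; nra.
have hv : 0 <= (t / 2 * b + r) ^+ 2 <= 4 * t ^+ 2.
  by rewrite sqr_ge0 /=; move: hu; move: (_ + r) => u /andP[u1 u2]; nra.
by move: hr hv => /andP[? ?] /andP[? ?]; apply/andP; split; lra.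
Qed.

End Threshold.

(** * One-dimensional agents *)

Lemma controllable_scalar (R : realType) :
  controllable (const_mx (- 2) : 'M[R]_1) (const_mx (- 1)).
Proof.
set A : 'M[R]_1 := const_mx (- 2).
have rowA i : \sum_j `|A i j| <= 2 by rewrite big_ord1 mxE normrN ger0_norm.
pose E := expmx (4^-1 *: A); pose e := E 0 0.
have mulE (X : 'M[R]_1) (v : 'cV[R]_1) : (X *m v) 0 0 = X 0 0 * v 0 0.
  by rewrite mxE big_ord1.
(* Steering needs e to differ from 1. The Taylor estimate at time 1/4 gives e - 1 <= -1/2 + 1/8 +
   1/16. *)
have e1 : e - 1 < 0.
  have h4 : 0 <= (4^-1 : R) <= 4^-1 by rewrite invr_ge0 lexx andbT.
  have hb (j : 'I_1) : `|(A *m (const_mx 1 : 'cV[R]_1)) j 0| <= 2.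
    by rewrite (ord1 j) mulE !mxE mulr1 normrN ger0_norm.
  have := expmx_taylor rowA 0 h4 hb; rewrite [X in `|X - _|]mxE !mulE -/E -/e !mxE !mulr1.
  by rewrite ler_norml => /andP[_]; move: (e) => x; lra.
(* [d] is what the free motion misses of the target. A constant input with B u = A v adds (e - 1) v
   by time 1/4, and [v] is chosen to make this [d]. *)
move=> x0 x1; pose d := (x1 - E *m x0) 0 0; pose v : 'cV[R]_1 := const_mx (d / (e - 1)).
exists 4^-1, (fun _ => const_mx (2 * (d / (e - 1)))); split.
- by rewrite invr_gt0.
- by move=> i; exact: cst_continuous.
have -> : (fun _ : R => (const_mx (- 1) : 'M[R]_1) *m (const_mx (2 * (d / (e - 1))) : 'cV[R]_1))
    = (fun _ : R => A *m v).
  apply/funext => t; apply/colP => i; rewrite (ord1 i) !mulE !mxE; ring.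
have /eqP := @forced_minus_free R 1 A rowA x0 v 4^-1 ltac:(by rewrite invr_gt0).
rewrite subr_eq => /eqP ->; apply/colP => i; rewrite (ord1 i) mxE [X in X + _]mxE.
rewrite mulE -/E -/e [(- v) 0 0]mxE /v mxE /free_state -/E.
have -> : e * (d / (e - 1)) + - (d / (e - 1)) = d by field; rewrite lt_eqF.
by rewrite /d [(x1 - _) 0 0]mxE [(- (E *m x0)) 0 0]mxE subrK.
Qed.

Lemma convergence_time0 (R : realType) (eps : R) (p : nat) (F : 'M[R]_p) :
  0 < eps -> convergence_time eps F 0 <= 0.
Proof.
move=> eps0; apply: ge_inf; first by exists 0 => T [].
split=> // t _; rewrite /free_state mulmx0 /norm2 big1 ?sqrtr0 ?ltW // => i _.
by rewrite mxE expr0n.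
Qed.

Definition agents_data (N : nat) (adj : 'M[bool]_N) (cost : 'cV[rat]_N)
    (Om ub gb tc : rat) : p1_data rat :=
  {| p1_n := N; p1_m := 1; p1_adj := adj; p1_A := const_mx (-2); p1_B := const_mx (-1);
     p1_dbar := N%:R^-1; p1_x0 := 0; p1_cost := cost; p1_Omega := Om; p1_ubar := ub;
     p1_gbar := const_mx gb; p1_tc := tc |}.

Definition agent (N : nat) (k : 'I_(N * 1)) : 'I_N := (mxtens_unindex k).1.

(** * Negative definiteness and stability of the network matrix *)

Section Network.
Variables (R : realType) (N : nat) (adj : 'M[bool]_N).
Hypotheses (N1 : (1 < N)%N) (adj_sym : symmetric adj) (adj_irr : irreflexive adj).

Local Notation deg i := ((degree adj i)%:R : R).
Local Notation a i j := ((adj i j)%:R : R).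

(* [degree] counts a classical set. *)
Lemma degreeE i : degree adj i = #|[pred j | adj i j]|.
Proof. by apply: eq_card => j; apply/idP/idP; rewrite !inE. Qed.

Lemma deg_sum i : deg i = \sum_j a i j.
Proof.
rewrite degreeE -sum1_card natr_sum big_mkcond /=; apply: eq_bigr => j _.
by rewrite inE; case: (adj i j).
Qed.

Lemma degree_lt i : (degree adj i < N)%N.
Proof.
rewrite degreeE -[X in (_ < X)%N]card_ord; apply: proper_card.
by apply/properP; split; [exact/fintype.subsetP | exists i; rewrite ?inE ?adj_irr].
Qed.

Let NR : 0 < N%:R :> R. Proof. by rewrite ltr0n ltnW. Qed.

Lemma deg_le i : 0 <= deg i <= N%:R - 1.
Proof.
by rewrite ler0n lerBrDr natr1 ler_nat degree_lt.
Qed.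

Definition coupling (i j : 'I_N) : R :=
  (if i == j then - 2 else 0) + N%:R^-1 * laplacian adj R i j.

(** Every edge occurs in the double sum from both ends, whence the factor 1/2. *)
Lemma laplacian_form (x : 'I_N -> R) :
  \sum_i \sum_j x i * laplacian adj R i j * x j =
  2^-1 * \sum_i \sum_j a i j * (x i - x j) ^+ 2.
Proof.
have E1 : \sum_i \sum_j x i * laplacian adj R i j * x j =
    \sum_i x i ^+ 2 * deg i - \sum_i \sum_j a i j * (x i * x j).
  rewrite -sumrB; apply: eq_bigr => i _.
  transitivity (\sum_j ((if i == j then x i * deg i * x j else 0) - a i j * (x i * x j))).
    apply: eq_bigr => j _; rewrite mxE.
    by case: eqP => _; ring.
  rewrite sumrB -big_mkcond /= (big_pred1 i) => [|j]; last by rewrite eq_sym.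
  by congr (_ - _); ring.
have E2 : \sum_i \sum_j a i j * (x i - x j) ^+ 2 =
    \sum_i x i ^+ 2 * deg i + \sum_i x i ^+ 2 * deg i - 2 * \sum_i \sum_j a i j * (x i * x j).
  have E3 : \sum_i x i ^+ 2 * deg i = \sum_i \sum_j a i j * x i ^+ 2.
    by apply: eq_bigr => i _; rewrite deg_sum mulr_sumr; apply: eq_bigr => j _; rewrite mulrC.
  have E4 : \sum_i x i ^+ 2 * deg i = \sum_i \sum_j a i j * x j ^+ 2.
    rewrite E3 exchange_big; apply: eq_bigr => i _; apply: eq_bigr => j _.
    by rewrite adj_sym.
  rewrite {1}E3 E4 mulr_sumr -big_split -sumrB; apply: eq_bigr => i _ /=.
  rewrite mulr_sumr -big_split -sumrB; apply: eq_bigr => j _ /=; ring.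
by rewrite E1 E2; field.
Qed.

Lemma coupling_form (x : 'I_N -> R) :
  \sum_i \sum_j x i * coupling i j * x j =
  - 2 * \sum_i x i ^+ 2 + (2 * N%:R)^-1 * \sum_i \sum_j a i j * (x i - x j) ^+ 2.
Proof.
transitivity (- 2 * (\sum_i x i ^+ 2) + N%:R^-1 * \sum_i \sum_j x i * laplacian adj R i j * x j).
  rewrite !mulr_sumr -big_split; apply: eq_bigr => i _ /=.
  rewrite mulr_sumr; transitivity (\sum_j ((if i == j then -2 * (x i * x j) else 0) +
      N%:R^-1 * (x i * laplacian adj R i j * x j))).
    by apply: eq_bigr => j _; rewrite /coupling; case: eqP => _; ring.
  by rewrite big_split /= -big_mkcond /= (big_pred1 i) // => j; rewrite eq_sym.
by rewrite laplacian_form mulrA invfM [N%:R^-1 * _]mulrC.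
Qed.

(** From (x - y)^2 <= 2 x^2 + 2 y^2 and degrees at most N - 1, the Laplacian is at most 2 (N - 1),
    hence -2 + L / N <= -2 / N. Invertibility and Hurwitz stability both follow from this. *)
Lemma coupling_neg (x : 'I_N -> R) :
  \sum_i \sum_j x i * coupling i j * x j <= - (2 / N%:R) * \sum_i x i ^+ 2.
Proof.
rewrite coupling_form.
have H : \sum_i \sum_j a i j * (x i - x j) ^+ 2 <= 4 * (N%:R - 1) * \sum_i x i ^+ 2.
  have H1 : \sum_i \sum_j a i j * (2 * x i ^+ 2) <= 2 * (N%:R - 1) * \sum_i x i ^+ 2.
    rewrite mulr_sumr; apply: ler_sum => i _; rewrite -mulr_suml -deg_sum.
    by rewrite mulrCA -mulrA ler_wpM2l // ler_wpM2r ?sqr_ge0 //; case/andP: (deg_le i).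
  have H2 : \sum_i \sum_j a i j * (2 * x j ^+ 2) <= 2 * (N%:R - 1) * \sum_i x i ^+ 2.
    rewrite exchange_big; apply: le_trans H1; apply: ler_sum => i _; apply: ler_sum => j _.
    by rewrite adj_sym.
  have -> : 4 * (N%:R - 1) * (\sum_i x i ^+ 2) =
    2 * (N%:R - 1) * (\sum_i x i ^+ 2) + 2 * (N%:R - 1) * \sum_i x i ^+ 2 by ring.
  apply: le_trans (lerD H1 H2); rewrite -big_split; apply: ler_sum => i _ /=.
  rewrite -big_split; apply: ler_sum => j _ /=; rewrite -mulrDr ler_wpM2l ?ler0n //.
  by have := sqr_ge0 (x i + x j); rewrite sqrrB sqrrD; lra.
have -> : - (2 / N%:R) * (\sum_i x i ^+ 2) =
    -2 * (\sum_i x i ^+ 2) + (2 * N%:R)^-1 * (4 * (N%:R - 1) * \sum_i x i ^+ 2).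
  by field; rewrite lt0r_neq0.
by rewrite lerD2l ler_wpM2l // invr_ge0 mulr_ge0 // ltW.
Qed.

(** The diagonal entry has absolute value 2 - d / N and the other entries contribute d / N in all,
    where d is the degree. This is the bound 2 assumed in the estimates of the exponential. *)
Lemma coupling_row i : \sum_j `|coupling i j| <= 2.
Proof.
have /andP[d0 dN] := deg_le i.
have dle : N%:R^-1 * deg i <= 1.
  rewrite mulrC ler_pdivrMr // mul1r; apply: (le_trans dN); by rewrite gerBl.
apply: (@le_trans _ _ (\sum_j ((if i == j then 2 - N%:R^-1 * deg i else 0) + N%:R^-1 * a i j))).
  apply: ler_sum => j _; rewrite /coupling mxE.
  case: eqP => [<-|_].
    have -> : a i i = 0 by rewrite adj_irr.
    by rewrite subr0 mulr0 addr0 addrC distrC ger0_norm // subr_ge0 (le_trans dle) // ler1n.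
  by rewrite !add0r mulrN normrN ger0_norm // mulr_ge0 // invr_ge0 ltW.
rewrite big_split /= -big_mkcond /= (big_pred1 i) => [|j]; last by rewrite eq_sym.
by rewrite -mulr_sumr -deg_sum subrK.
Qed.

(* [p1_M] is indexed by the pairs of an agent and a coordinate. *)
Variables (cost : 'cV[rat]_N) (Om ub gb tc : rat).
Let D := real_data R (agents_data adj cost Om ub gb tc).
Let F : 'M[R]_(N * 1) := p1_M D.

Lemma sum_agents (f : 'I_N -> R) : \sum_k f (agent k) = \sum_i f i.
Proof.
rewrite (reindex (fun i : 'I_N => mxtens_index (i, ord0 : 'I_1))) /=.
  by apply: eq_bigr => i _; rewrite /agent mxtens_indexK.
exists (@agent N) => [i _|k _]; first by rewrite /agent mxtens_indexK.
case: (mxtens_indexP k) => i j; rewrite /agent mxtens_indexK /=.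
by rewrite (ord1 j).
Qed.

Lemma p1_M_agents k l : F k l = coupling (agent k) (agent l).
Proof.
rewrite /F /p1_M !mxE /= /coupling -/(agent k) -/(agent l) !mxE /=.
rewrite !rmorphN /= rmorph1 rmorphV /= ?ratr_nat //; last first.
  by rewrite unitfE pnatr_eq0 -lt0n ltnW.
rewrite mulrN1 opprK; congr (_ + _).
by case: eqP => _ /=; rewrite ?mul1r ?mul0r.
Qed.

Lemma p1_M_row k : \sum_l `|F k l| <= 2.
Proof.
under eq_bigr do rewrite p1_M_agents.
by rewrite (sum_agents (fun j => `|coupling (agent k) j|)) coupling_row.
Qed.

Lemma p1_M_neg (x : 'I_(N * 1) -> R) :
  \sum_k \sum_l x k * F k l * x l <= - (2 / N%:R) * \sum_k x k ^+ 2.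
Proof.
pose y i := x (mxtens_index (i, ord0 : 'I_1)).
have xE k : x k = y (agent k).
  by rewrite /y /agent; case: (mxtens_indexP k) => i j; rewrite mxtens_indexK /= (ord1 j).
under eq_bigr => k _ do under eq_bigr => l _ do rewrite p1_M_agents !xE.
under eq_bigr => k _ do rewrite (sum_agents (fun j => y (agent k) * coupling (agent k) j * y j)).
rewrite (sum_agents (fun i => \sum_j y i * coupling i j * y j)).
under [X in _ <= _ * X]eq_bigr do rewrite xE.
by rewrite (sum_agents (fun i => y i ^+ 2)) coupling_neg.
Qed.

(** A kernel vector would make the negative definite form vanish. Invertibility is what allows the
    attack input to be written as [F *m v]. *)
Lemma p1_M_unit : F \in unitmx.
Proof.
rewrite -row_free_unit; apply: inj_row_free => v vF.
have : \sum_k \sum_l v 0 k * F k l * v 0 l = 0.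
  rewrite exchange_big big1 // => l _ /=; rewrite -mulr_suml.
  by have /rowP/(_ l) := vF; rewrite !mxE => ->; rewrite mul0r.
have := p1_M_neg (v 0) => le E; rewrite E in le.
have : \sum_k v 0 k ^+ 2 == 0.
  rewrite eq_le sumr_ge0 ?andbT => [|k _]; last exact: sqr_ge0.
  have h : 0 < 2 / N%:R :> R by rewrite divr_gt0.
  by rewrite -(pmulr_rle0 _ h) -oppr_ge0 -mulNr.
rewrite psumr_eq0 => [/allP z|k _]; last exact: sqr_ge0.
apply/rowP => k; rewrite [RHS]mxE; apply/eqP; rewrite -sqrf_eq0.
exact: z (mem_index_enum k).
Qed.

Lemma p1_M_hurwitz : hurwitz F.
Proof.
move=> z /eigenvalueP[v vF v0].
pose u k := complex.Re (v 0 k); pose w k := complex.Im (v 0 k).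
have E l : \sum_k v 0 k * real_complex R (F k l) = z * v 0 l.
  have /rowP/(_ l) := vF; rewrite [LHS]mxE [RHS]mxE => <-.
  by apply: eq_bigr => k _; rewrite [map_mx _ _ _ _]mxE.
have Eu l : \sum_k u k * F k l = complex.Re z * u l - complex.Im z * w l.
  have := congr1 (@complex.Re R) (E l); rewrite raddf_sum /=.
  rewrite (_ : complex.Re (z * v 0 l) = complex.Re z * u l - complex.Im z * w l); last first.
    by rewrite /u /w; case: (z) (v 0 l) => [x y] [x' y'].
  move=> <-; apply: eq_bigr => k _; rewrite /u.
  by case: (v 0 k) => x y /=; rewrite mulr0 subr0.
have Ew l : \sum_k w k * F k l = complex.Re z * w l + complex.Im z * u l.
  have := congr1 (@complex.Im R) (E l); rewrite raddf_sum /=.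
  rewrite (_ : complex.Im (z * v 0 l) = complex.Re z * w l + complex.Im z * u l); last first.
    by rewrite /u /w; case: (z) (v 0 l) => [x y] [x' y'].
  move=> <-; apply: eq_bigr => k _; rewrite /w.
  by case: (v 0 k) => x y /=; rewrite mulr0 add0r.
have q (x : 'I_(N * 1) -> R) : \sum_k \sum_l x k * F k l * x l =
    \sum_l (\sum_k x k * F k l) * x l.
  by rewrite exchange_big; apply: eq_bigr => l _; rewrite mulr_suml.
have := lerD (p1_M_neg u) (p1_M_neg w); rewrite !q -big_split /=.
(* When the forms of the real and the imaginary part of the eigenvector are added, the terms with
   the imaginary part of [z] cancel. *)
have EE l : (complex.Re z * u l - complex.Im z * w l) * u l +
    (complex.Re z * w l + complex.Im z * u l) * w l = complex.Re z * (u l ^+ 2 + w l ^+ 2) by ring.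
under eq_bigr do rewrite Eu Ew EE.
rewrite -mulrDr -big_split /=.
rewrite -mulr_sumr; set T := \sum_l _ => le.
have T0 : 0 < T.
  have T_ge : 0 <= T by apply: sumr_ge0 => k _; rewrite addr_ge0 // sqr_ge0.
  rewrite lt_neqAle T_ge andbT eq_sym; apply: contraNneq v0 => T_eq.
  apply/eqP/rowP => k; rewrite [RHS]mxE.
  have : u k ^+ 2 + w k ^+ 2 = 0.
    by apply: (psumr_eq0P _ T_eq) => // l _; rewrite addr_ge0 // sqr_ge0.
  move=> /eqP; rewrite paddr_eq0 ?sqr_ge0 // !sqrf_eq0 /u /w.
  by case: (v 0 k) => x y /= /andP[/eqP -> /eqP ->].
have h : 0 < 2 / N%:R :> R by rewrite divr_gt0.
by move: le; rewrite ler_pM2r // => /le_lt_trans -> //; rewrite oppr_lt0.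
Qed.

Hypothesis adj_conn : forall i j, connect adj i j.

(** Positivity matters because 1 / 0 is 0 here: with maximal degree 0 the range for [p1_dbar] would
    be empty. *)
Lemma max_degree_bounds : (0 < max_degree adj < N)%N.
Proof.
apply/andP; split; last first.
  rewrite /max_degree; elim/big_ind: _ => [|m n|i _]; first exact: ltnW.
  - by rewrite gtn_max => -> ->.
  - exact: degree_lt.
pose i0 := Ordinal (ltnW N1); pose i1 := Ordinal N1.
have [j adj0] : exists j, adj i0 j.
  have /connectP[[|j s] /=] := adj_conn i0 i1; first by move=> _ /(congr1 val).
  by move=> /andP[h _] _; exists j.
apply: (@leq_trans (degree adj i0)); last exact: leq_bigmax.
by rewrite degreeE; apply/card_gt0P; exists j.
Qed.

Lemma agents_well_posed (eps : R) : 0 < eps -> (forall i, 0 <= cost i 0) -> 0 <= Om ->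
  0 < tc -> p1_well_posed D eps.
Proof.
move=> eps0 cost0 Om0 tc0; have /andP[m0 mN] := max_degree_bounds.
split=> //=.
- exact: ltnW.
- have -> : ratr N%:R^-1 = N%:R^-1 :> R.
    by rewrite fmorphV /= ratr_nat.
  rewrite invr_gt0 NR /= div1r ltf_pV2 ?posrE ?ltr0n //.
    by rewrite ltr_nat.
  exact: ltnW.
- have E c : map_mx ratr (const_mx c : 'M[rat]_1) = const_mx (ratr c) :> 'M[R]_1.
    by apply/matrixP => i j; rewrite !mxE.
  by rewrite !E !rmorphN /= rmorph1 ratr_nat; exact: controllable_scalar.
- exact: p1_M_hurwitz.
- by move=> i; rewrite mxE ler0q.
- by rewrite ler0q.
- by rewrite ltr0q.
- rewrite (_ : map_mx _ _ = 0); last by apply/matrixP => i j; rewrite !mxE rmorph0.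
  by apply: le_lt_trans (convergence_time0 _ eps0) _; rewrite ltr0q.
Qed.

End Network.

(** * The objective and independent sets *)

Section Indicator.
Variables (R : realType) (N : nat) (adj : 'M[bool]_N) (S : {set 'I_N}).
Hypotheses (N1 : (1 < N)%N) (adj_sym : symmetric adj).
Let mu (i : 'I_N) : R := (i \in S)%:R.

Let muI (f : 'I_N -> R) : \sum_i mu i * f i = \sum_(i in S) f i.
Proof.
rewrite [RHS]big_mkcond; apply: eq_bigr => i _; rewrite /mu.
by case: ifP; rewrite ?mul1r ?mul0r.
Qed.

Let mu2 i : mu i ^+ 2 = mu i.
Proof. by rewrite /mu; case: (i \in S); rewrite ?expr1n ?expr0n. Qed.

Lemma sum_indicator_sqr : \sum_i mu i ^+ 2 = #|S|%:R.
Proof.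
under eq_bigr do rewrite mu2 -[mu _]mulr1.
by rewrite muI sumr_const.
Qed.

(** The squares (mu i - mu j)^2 single out the edges that leave [S], each seen from both ends: twice
    the degrees in [S] less twice the ordered pairs inside. *)
Lemma coupling_indicator :
  \sum_i \sum_j mu i * coupling R adj i j * mu j =
  - 2 * #|S|%:R + N%:R^-1 * (\sum_(i in S) (degree adj i)%:R
     - \sum_(i in S) \sum_(j in S) (adj i j)%:R).
Proof.
rewrite (coupling_form adj_sym mu) sum_indicator_sqr; congr (_ + _).
have -> : \sum_i \sum_j (adj i j)%:R * (mu i - mu j) ^+ 2 =
   \sum_i mu i * (\sum_j (adj i j)%:R) + \sum_i mu i * (\sum_j (adj i j)%:R)
    - 2 * (\sum_i mu i * (\sum_j mu j * (adj i j)%:R)).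
  have E4 : \sum_i mu i * (\sum_j (adj i j)%:R) = \sum_i \sum_j mu j * (adj i j)%:R :> R.
    under eq_bigr do rewrite mulr_sumr.
    by rewrite exchange_big; apply: eq_bigr => i _; apply: eq_bigr => j _; rewrite adj_sym.
  rewrite {2}E4 mulr_sumr -big_split -sumrB; apply: eq_bigr => i _ /=.
  rewrite !mulr_sumr -big_split -sumrB; apply: eq_bigr => j _ /=.
  by have := mu2 i; have := mu2 j; move: (mu i) (mu j) => x y Ey Ex; rewrite -{2}Ex -{2}Ey; ring.
have -> : \sum_i mu i * (\sum_j (adj i j)%:R) = \sum_(i in S) (degree adj i)%:R.
  by rewrite muI; apply: eq_bigr => i _; rewrite deg_sum.
have -> : \sum_i mu i * (\sum_j mu j * (adj i j)%:R) =
    \sum_(i in S) \sum_(j in S) (adj i j)%:R.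
  by rewrite muI; apply: eq_bigr => i _; rewrite muI.
have N0 : N%:R != 0 :> R by rewrite pnatr_eq0 -lt0n ltnW.
by move: (\sum_(i in S) _) (\sum_(i in S) _) (N%:R : R) N0 => x y z z0; field.
Qed.

End Indicator.

Lemma tens_colE (R : realType) n (A : 'cV[R]_n) (B : 'cV[R]_1) (k : 'I_(n * 1)) :
  (A *t B : 'cV[R]_(n * 1)) k 0 = A (mxtens_unindex k).1 0 * B 0 0.
Proof.
transitivity (A (mxtens_unindex k).1 (mxtens_unindex (ord0 : 'I_(1 * 1))).1 *
              B (mxtens_unindex k).2 (mxtens_unindex (ord0 : 'I_(1 * 1))).2).
  exact: mxE.
by rewrite !ord1.
Qed.

Lemma ratr_scale (R : realType) (c n : nat) (x : rat) :
  c%:R * n%:R ^+ 2 * x = 1 -> c%:R * n%:R ^+ 2 * ratr x = 1 :> R.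
Proof.
by move=> /(congr1 (@ratr R)); rewrite rmorph1 2!rmorphM rmorphXn /= !ratr_nat.
Qed.

Lemma scale_gt0 (F : numFieldType) (c n : nat) (x : F) :
  c%:R * n%:R ^+ 2 * x = 1 -> (0 < n)%N -> 0 < x.
Proof.
case: c => [|c]; first by rewrite !mul0r => /esym/eqP; rewrite oner_eq0.
move=> E n0; have h : 0 < c.+1%:R * n%:R ^+ 2 :> F by rewrite mulr_gt0 ?exprn_gt0 ?ltr0n.
by rewrite -(pmulr_rgt0 _ h) E ltr01.
Qed.

Lemma scale_le (F : realFieldType) (n : nat) (x : F) :
  100 * n%:R ^+ 2 * x = 1 -> (1 < n)%N -> x <= 1 / 400.
Proof.
move=> E n1; have x0 := @scale_gt0 F 100 n x E (ltnW n1).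
have n2 : 2 <= n%:R :> F by rewrite (ler_nat _ 2).
move: (n%:R : F) E n2 => N E n2.
have h4 : 4 <= N ^+ 2 by rewrite expr2; nra.
have h : 0 <= (N ^+ 2 - 4) * x by rewrite mulr_ge0 ?subr_ge0 // ltW.
by move: h E; rewrite mulrBl -mulrA; move: (N ^+ 2 * x) => y; lra.
Qed.

Lemma scale_le4 (F : realFieldType) (n : nat) (x : F) :
  100 * n%:R ^+ 2 * x = 1 -> (1 < n)%N -> x <= 4^-1.
Proof. by move=> E n1; have := scale_le E n1; lra. Qed.

(** Divided by t th, the response is a + t/2 F a + r with r of second order. Squaring doubles the
    coefficient t/2, so that the quadratic form of [F] at [a] appears with factor t. *)
Lemma response_sqr (R : realType) (p : nat) (F : 'M[R]_p) (N t th : R) (a : 'I_p -> R)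
    (v : 'cV[R]_p) :
  (forall i, \sum_j `|F i j| <= 2) -> 2 <= N -> 100 * N ^+ 2 * t = 1 ->
  0 < t -> t <= 4^-1 -> 0 < th ->
  (forall k, 0 <= a k <= 1) -> (forall k, (F *m v) k 0 = a k * th) ->
  exists2 g : R, norm2 (expmx (t *: F) *m v - v) ^+ 2 = (t * th) ^+ 2 * g &
    `|g - (\sum_k a k ^+ 2 + t * \sum_k \sum_l a k * F k l * a l)| <= p%:R * (12 * t ^+ 2).
Proof.
move=> rowF N2 tE t0 t4 th0 a01 wE.
pose z k := (expmx (t *: F) *m v - v) k 0.
pose b k := \sum_l F k l * a l.
pose r k := z k / (t * th) - (a k + t / 2 * b k).
have tth : t * th != 0 by rewrite lt0r_neq0 // mulr_gt0.
have a_norm k : `|a k| <= 1 by have /andP[h0 h1] := a01 k; rewrite ger0_norm.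
have Fw k : (F *m (F *m v)) k 0 = th * b k.
  by rewrite mxE mulr_sumr; apply: eq_bigr => l _; rewrite wE mulrA mulrC.
have b2 k : `|b k| <= 2.
  rewrite /b (le_trans (ler_norm_sum _ _ _)) // (le_trans _ (rowF k)) //.
  by apply: ler_sum => l _; rewrite normrM ler_piMr.
have wb j : `|(F *m v) j 0| <= th.
  by rewrite wE normrM (gtr0_norm th0) ler_piMl // ltW.
have rb k : `|r k| <= 2 * t ^+ 2.
  have := expmx_taylor rowF k (introT andP (conj (ltW t0) t4)) wb.
  rewrite Fw wE -/(z k).
  have -> : z k - (t * (a k * th) + t ^+ 2 / 2 * (th * b k)) = (t * th) * r k.
    by rewrite /r; field; rewrite ?(lt0r_neq0 t0) ?(lt0r_neq0 th0).
  rewrite normrM gtr0_norm ?mulr_gt0 //.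
  have -> : 2 * th * t ^+ 3 = (t * th) * (2 * t ^+ 2) by ring.
  by rewrite ler_pM2l // mulr_gt0.
exists (\sum_k (a k + t / 2 * b k + r k) ^+ 2).
  rewrite /norm2 sqr_sqrtr; last by apply: sumr_ge0 => k _; exact: sqr_ge0.
  rewrite mulr_sumr; apply: eq_bigr => k _; rewrite -exprMn -/(z k); congr (_ ^+ 2).
  by rewrite /r addrCA subrr addr0 mulrC divfK.
have -> : \sum_k a k ^+ 2 + t * \sum_k \sum_l a k * F k l * a l =
    \sum_k (a k ^+ 2 + t * (a k * b k)).
  rewrite big_split /= -mulr_sumr; congr (_ + _ * _).
  by apply: eq_bigr => k _; rewrite mulr_sumr; apply: eq_bigr => l _; rewrite mulrA.
rewrite -sumrB (le_trans (ler_norm_sum _ _ _)) //.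
apply: (@le_trans _ _ (\sum_(k < p) 12 * t ^+ 2)).
  by apply: ler_sum => k _; exact: (response_term N2 tE (a01 k) (b2 k) (rb k)).
by rewrite sumr_const card_ord -[leLHS]mulr_natl.
Qed.

Section Objective.
Variables (R : realType) (N : nat) (adj : 'M[bool]_N).
Hypotheses (N1 : (1 < N)%N) (adj_sym : symmetric adj) (adj_irr : irreflexive adj).
Variables (cost : 'cV[rat]_N) (Om ub gb tc : rat) (theta : 'cV[rat]_1).
Let D := real_data R (agents_data adj cost Om ub gb tc).
Let F : 'M[R]_(N * 1) := p1_M D.
Let t : R := ratr tc.
Let th : R := ratr (theta 0 0).
Hypotheses (tcE : 100 * N%:R ^+ 2 * tc = 1) (th_gt0 : 0 < theta 0 0).

Let NR : 2 <= N%:R :> R. Proof. by rewrite (ler_nat _ 2). Qed.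

Let tE : 100 * N%:R ^+ 2 * t = 1.
Proof. exact: ratr_scale. Qed.

Let t0 : 0 < t. Proof. exact: (@scale_gt0 R 100 N t tE (ltnW N1)). Qed.

Let t4 : t <= 4^-1. Proof. exact: scale_le4 tE N1. Qed.

Let th0 : 0 < th. Proof. by rewrite ltr0q. Qed.

Variable S : {set 'I_N}.
Let mu (i : 'I_N) : R := (i \in S)%:R.
Let w : 'cV[R]_(N * 1) := @p1_indicator R D S *t (map_mx ratr theta : 'cV[R]_1).
Let v : 'cV[R]_(N * 1) := invmx F *m w.
Let err : R := @p1_error R D (fun _ => map_mx ratr theta) S.

Let wE k : w k 0 = mu (agent k) * th.
Proof.
transitivity (@p1_indicator R D S (agent k) 0 * (map_mx ratr theta : 'cV[R]_1) 0 0).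
  exact: tens_colE.
by congr (_ * _); exact: mxE.
Qed.

Let Fv : F *m v = w.
Proof. exact: mulKVmx (@p1_M_unit R N adj N1 adj_sym adj_irr cost Om ub gb tc) w. Qed.

Let Fvk k : (F *m v) k 0 = mu (agent k) * th.
Proof. by rewrite Fv wE. Qed.

Let err_norm : err = norm2 (expmx (t *: F) *m v - v).
Proof.
rewrite -(lim_forced_error (@p1_M_row R N adj N1 adj_irr cost Om ub gb tc) (p1_x0 D) v t0).
by rewrite -/F Fv.
Qed.

Lemma error_ge0 : 0 <= err.
Proof. by rewrite err_norm sqrtr_ge0. Qed.

Let edges : R := \sum_(i in S) \sum_(j in S) (adj i j)%:R.

Lemma error_sqr : exists2 g : R, err ^+ 2 = (t * th) ^+ 2 * g &
  `|g - (#|S|%:R + t * (- 2 * #|S|%:R +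
      N%:R^-1 * (\sum_(i in S) (degree adj i)%:R - edges)))| <= 12 * N%:R * t ^+ 2.
Proof.
have mu01 k : 0 <= mu (agent k) <= 1.
  by rewrite /mu; case: (_ \in S); rewrite ?lexx ?ler01.
have [g E1 E2] := response_sqr (@p1_M_row R N adj N1 adj_irr cost Om ub gb tc)
  NR tE t0 t4 th0 mu01 Fvk.
exists g; first by rewrite err_norm.
move: E2; rewrite (sum_agents (fun i => mu i ^+ 2)) sum_indicator_sqr.
have -> : \sum_k \sum_l mu (agent k) * F k l * mu (agent l) =
    \sum_i \sum_j mu i * coupling R adj i j * mu j.
  under eq_bigr => k _ do under eq_bigr => l _ do rewrite (p1_M_agents R adj N1 cost Om ub gb tc).
  under eq_bigr => k _ do
    rewrite (sum_agents (fun j => mu (agent k) * coupling R adj (agent k) j * mu j)).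
  by rewrite (sum_agents (fun i => \sum_j mu i * coupling R adj i j * mu j)).
rewrite (coupling_indicator R S N1 adj_sym) muln1.
by have -> : N%:R * (12 * t ^+ 2) = 12 * N%:R * t ^+ 2 by rewrite mulrA [N%:R * _]mulrC.
Qed.

End Objective.

(** With x = tc and y = theta, the product x y is the attack energy; this is where the value 2 of
    the energy bound comes from. *)
Lemma gain_bounds (F : realFieldType) (x y n k : F) :
  0 < x -> x <= 1 / 400 -> 1 <= n -> 1 <= k ->
  x * y = 1 + 3 / 4 * x + x / (2 * n * k) -> 0 < y /\ x * y <= 2.
Proof.
move=> x0 x4 n1 k1 E.
have nk : 1 <= n * k by rewrite mulr_ege1.
have p : 0 < 2 * n * k by rewrite -mulrA; lra.
have h0 : 0 <= x / (2 * n * k) by rewrite divr_ge0 // ltW.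
have h1 : x / (2 * n * k) <= x by rewrite ler_pdivrMr // -mulrA; nra.
split; last by rewrite E; lra.
by rewrite -(pmulr_rgt0 _ x0) E; lra.
Qed.

(** A single agent that is not good costs N > k, more than the whole budget, and good agents cost 1
    each. *)
Lemma budget (F : realDomainType) (N k : nat) (good : pred 'I_N) (cost : 'I_N -> F)
    (S : {set 'I_N}) :
  (k < N)%N -> (forall i, cost i = if good i then 1 else N%:R) ->
  \sum_(i in S) cost i <= k%:R <-> (forall i, i \in S -> good i) /\ (#|S| <= k)%N.
Proof.
move=> kN costE; split=> [le|[gS Sk]]; last first.
  rewrite (eq_bigr (fun=> 1)) => [|i /gS gi]; last by rewrite costE gi.
  by rewrite sumr_const ler_nat.
have cost0 i : 0 <= cost i by rewrite costE; case: ifP.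
have gS i : i \in S -> good i.
  move=> iS; apply: contraTT le => gi; rewrite -ltNge (bigD1 i) //= costE (negPf gi).
  by rewrite (@lt_le_trans _ _ N%:R) ?ltr_nat // lerDl sumr_ge0.
split=> //; rewrite -(ler_nat F); apply: le_trans le.
rewrite -sumr_const; apply: ler_sum => i /gS gi; by rewrite costE gi.
Qed.

Lemma norm2_scalar (R : realType) (v : 'cV[R]_1) : norm2 v = `|v 0 0|.
Proof. by rewrite /norm2 big_ord1 sqrtr_sqr. Qed.

Lemma integral_cV_const (R : realType) (p : nat) (t : R) (w : 'cV[R]_p) k :
  0 < t -> integral_cV t (fun _ => w) k 0 = t * w k 0.
Proof.
move=> t0; rewrite mxE Rintegral_cst //= lebesgue_measure_itv /= lte_fin t0 /= subr0.
by rewrite mulrC.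
Qed.

Lemma ratr_gain (R : realType) (a b c n k : nat) (x y : rat) :
  x * y = 1 + a%:R / b%:R * x + x / (c%:R * n%:R * k%:R) ->
  ratr x * ratr y = 1 + a%:R / b%:R * ratr x + ratr x / (c%:R * n%:R * k%:R) :> R.
Proof.
move=> E; rewrite -rmorphM E 2!rmorphD rmorph1 /=; congr (_ + _ + _).
  by rewrite 2!rmorphM fmorphV /= !ratr_nat.
by rewrite rmorphM fmorphV /= 2!rmorphM /= !ratr_nat.
Qed.

(** The degrees of s candidates add up to s n / 2, which turns -2 s into -3/2 s. Hence the 3/2 here
    and the 3/4 in the attack. *)
Lemma gain_expand (F : numFieldType) (s t n e : F) : n != 0 ->
  s + t * (- 2 * s + n^-1 * (s * n / 2 - e)) = s * (1 - 3 / 2 * t) - t / n * e.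
Proof. by move=> n0; field. Qed.

(** The analysis bounds the square of the error. Because the required number of vertices is the
    square W W, the threshold on the error itself is the integer W. *)
Lemma natr_le_sqr (F : realDomainType) (m : nat) (x : F) :
  0 <= x -> (m%:R <= x) = ((m * m)%:R <= x ^+ 2).
Proof. by move=> x0; rewrite natrM -expr2 ler_pXn2r ?nnegrE. Qed.

Lemma loss_edge (F : realFieldType) (s t n e : F) :
  0 < t -> 2 <= n -> 2 <= e ->
  s * (1 - 3 / 2 * t) - t / n * e <= s * (1 - 3 / 2 * t) - 2 * t / n.
Proof.
move=> t0 n2 e2; rewrite lerD2l lerN2.
have -> : 2 * t / n = t / n * 2 by rewrite -mulrA mulrC.
rewrite ler_wpM2l //.
by rewrite divr_ge0 ?ltW // (lt_le_trans _ n2).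
Qed.

(** A missing vertex costs 1 - 3/2 t, far more than the 2 t / n of an edge. *)
Lemma loss_small_set (F : realFieldType) (s k t n e : F) :
  0 < t -> t <= 1 / 400 -> 2 <= n -> 0 <= e -> s + 1 <= k ->
  s * (1 - 3 / 2 * t) - t / n * e <= k * (1 - 3 / 2 * t) - 2 * t / n.
Proof.
move=> t0 t4 n2 e0 sk; have n0 : 0 < n by rewrite (lt_le_trans _ n2).
have h : 0 <= t / n * e by rewrite mulr_ge0 // divr_ge0 // ltW.
have h2 : t / n <= t / 2 by rewrite ler_wpM2l ?(ltW t0) // lef_pV2 ?posrE.
have h3 : 0 <= (k - s - 1) * (1 - 3 / 2 * t) by rewrite mulr_ge0; lra.
have -> : 2 * t / n = 2 * (t / n) by rewrite mulrA.
by move: (t / n) (t / n * e) h h2 => x y h h2; nra.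
Qed.

(** The edge is counted once in the row of [i] and once in that of [j]. *)
Lemma sum_edges_ge2 (R : numDomainType) (N : nat) (adj : 'M[bool]_N) (S : {set 'I_N}) i j :
  symmetric adj -> irreflexive adj -> i \in S -> j \in S -> adj i j ->
  2 <= \sum_(l in S) \sum_(m in S) (adj l m)%:R :> R.
Proof.
move=> adj_sym adj_irr iS jS ij.
have ji : j != i by apply: contraTneq ij => ->; rewrite adj_irr.
pose f l : R := \sum_(m in S) (adj l m)%:R.
have f0 l : 0 <= f l by apply: sumr_ge0.
have h1 : 1 <= f i by rewrite /f (bigD1 j) //= ij lerDl sumr_ge0.
have h2 : 1 <= f j by rewrite /f (bigD1 i) //= adj_sym ij lerDl sumr_ge0.
rewrite -[leRHS]/(\sum_(l in S) f l); move: f f0 h1 h2 => f f0 h1 h2.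
rewrite (bigD1 i) //= (bigD1 j) ?jS //= addrA.
by rewrite -[2]addr0 lerD ?sumr_ge0 // (_ : 2 = 1 + 1) // lerD.
Qed.

(** * The decision problem on a network expresses independent sets *)

Section Decision.
Variables (R : realType) (eps : R) (N : nat) (adj : 'M[bool]_N).
Hypotheses (adj_sym : symmetric adj) (adj_irr : irreflexive adj).
Variables (good : pred 'I_N) (W : nat) (cost : 'cV[rat]_N) (ub tc : rat) (theta : 'cV[rat]_1).
Let k : nat := (W * W)%N.
Hypotheses (W0 : (0 < W)%N) (kN : (k < N)%N).
Hypotheses (deg_good : forall i, good i -> (degree adj i * 2)%N = N).
Hypotheses (costE : forall i, cost i 0 = if good i then 1 else N%:R).
Hypotheses (tcE : 100 * N%:R ^+ 2 * tc = 1).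
Hypotheses (thE : tc * theta 0 0 = 1 + 3 / 4 * tc + tc / (2 * N%:R * k%:R)).
Hypotheses (ubE : theta 0 0 <= ub).
Let inst : p1_data rat := agents_data adj cost k%:R ub 2 tc.

Let N1 : (1 < N)%N.
Proof. by apply: leq_ltn_trans kN; rewrite muln_gt0 W0. Qed.

Let tc0 : 0 < tc. Proof. exact: (@scale_gt0 rat 100 N tc tcE (ltnW N1)). Qed.

Let tc_le : tc <= 1 / 400. Proof. exact: scale_le tcE N1. Qed.

Let k0 : (0 < k)%N. Proof. by rewrite muln_gt0 W0. Qed.

Let gain_bounds' : 0 < theta 0 0 /\ tc * theta 0 0 <= 2.
Proof.
by apply: (gain_bounds tc0 tc_le _ _ thE); rewrite ler1n ?(ltnW N1).
Qed.

Let th_gt0 : 0 < theta 0 0. Proof. exact: gain_bounds'.1. Qed.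
Let gain_le2 : tc * theta 0 0 <= 2. Proof. exact: gain_bounds'.2. Qed.

(** The bounds on the false data and on the energy hold for every [S], so feasibility is the cost
    budget. *)
Lemma agents_admissible (S : {set 'I_N}) :
  @p1_admissible R (real_data R inst) (fun _ => map_mx ratr theta) S <->
  (forall i, i \in S -> good i) /\ (#|S| <= k)%N.
Proof.
have budgetE : (\sum_(i in S) p1_cost (real_data R inst) i 0 <= p1_Omega (real_data R inst)) =
    (\sum_(i in S) cost i 0 <= k%:R).
  rewrite -(ler_rat R) rmorph_sum /=; congr (_ <= _).
  by apply: eq_bigr => i _; rewrite mxE.
split=> [[_ + _]|/(budget S kN costE) le].
  by rewrite budgetE => /(budget S kN costE).
split; last first.
- move=> j.
  have tcR : 0 < ratr tc :> R by rewrite ltr0q; exact: tc0.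
  have -> : p1_gbar (real_data R inst) j 0 = ratr 2.
    by rewrite mxE; congr (ratr _); exact: mxE.
  rewrite (integral_cV_const _ _ tcR) mxE (ord1 j) -rmorphM ler_rat.
  exact: gain_le2.
- by rewrite budgetE.
- move=> i s _; rewrite norm2_scalar /p1_false_data; case: ifP => _; rewrite mxE.
    rewrite ger0_norm ?ler0q ?ler_rat; [exact: ubE | exact: ltW th_gt0].
  rewrite normr0 ler0q; exact: le_trans (ltW th_gt0) ubE.
Qed.

Lemma agents_decision :
  @decision R (P1_time_invariant eps) (@P1Instance inst theta, W%:R) <->
  exists S : {set 'I_N}, [/\ forall i, i \in S -> good i, #|S| = k &
    {in S &, forall i j, ~~ adj i j}].
Proof.
have thE' : ratr tc * ratr (theta 0 0) = 1 + 3 / 4 * ratr tc + ratr tc / (2 * N%:R * k%:R) :> R by exact: ratr_gain thE.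
have N2 : 2 <= N%:R :> R by rewrite (ler_nat _ 2).
have k1 : 1 <= k%:R :> R by rewrite ler1n.
have kN' : k%:R <= N%:R :> R by rewrite ler_nat ltnW.
have tE' : 100 * N%:R ^+ 2 * ratr tc = 1 :> R by exact: ratr_scale.
have t_gt0 : 0 < ratr tc :> R by exact: (@scale_gt0 R 100 N _ tE' (ltnW N1)).
have t_le := scale_le tE' N1.
have N0 : N%:R != 0 :> R by rewrite pnatr_eq0 -lt0n ltnW.
pose err S := @p1_error R (real_data R inst) (fun _ => map_mx ratr theta) S.
pose edges (S : {set 'I_N}) : R := \sum_(i in S) \sum_(j in S) (adj i j)%:R.
have errE (S : {set 'I_N}) : (forall i, i \in S -> good i) -> exists2 g : R,
    err S ^+ 2 = (1 + 3 / 4 * ratr tc + ratr tc / (2 * N%:R * k%:R)) ^+ 2 * g &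
    `|g - (#|S|%:R * (1 - 3 / 2 * ratr tc) - ratr tc / N%:R * edges S)|
      <= 12 * N%:R * ratr tc ^+ 2.
  move=> gS; have [g E1 E2] := @error_sqr R N adj N1 adj_sym adj_irr cost k%:R ub 2 tc theta
    tcE th_gt0 S.
  exists g; first by rewrite -thE'.
  move: E2; rewrite -/(edges S).
  have -> : \sum_(i in S) (degree adj i)%:R = #|S|%:R * N%:R / 2 :> R.
    rewrite -sumr_const !mulr_suml; apply: eq_bigr => i /gS gi.
    by rewrite mul1r -[in RHS](deg_good gi) natrM mulfK.
  move: (ratr tc : R) => t.
  by rewrite (gain_expand _ _ _ N0).
move: (ratr tc : R) tE' t_gt0 t_le errE {thE'} => t tE' t_gt0 t_le errE.
split=> [[S [adm Kle]]|[S [gS Sk indep]]]; last first.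
  exists S; split; first exact: ((agents_admissible S).2 (conj gS (eq_leq Sk))).
  change (is_true (ratr W%:R <= err S)); rewrite ratr_nat.
  have [g E1 E2] := errE S gS.
  have err0 : 0 <= err S by exact: (@error_ge0 R N adj N1 adj_sym adj_irr cost k%:R ub 2 tc theta tcE).
  rewrite (natr_le_sqr _ err0) -/k E1; apply: (threshold_yes k1 kN' N2 tE').
  have e0 : edges S = 0.
    by apply: big1 => i iS; apply: big1 => j jS; rewrite (negPf (indep i j iS jS)).
  move: E2; rewrite Sk e0 mulr0 subr0 ler_norml => /andP[+ _].
  by rewrite lerBrDr addrC.
have [gS Sk] := (agents_admissible S).1 adm.
exists S; have [g E1 E2] := errE S gS.
have {}Kle : W%:R <= err S by rewrite -(ratr_nat R W); exact: Kle.
have err0 : 0 <= err S by exact: le_trans (ler0n R W) Kle.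
have kle : k%:R <= err S ^+ 2 by move: Kle; rewrite (natr_le_sqr W err0).
move: (err S) E1 kle {Kle err0} => errS E1 kle.
have edges_ge0 : 0 <= edges S by apply: sumr_ge0 => i _; apply: sumr_ge0.
(* Too few vertices or an edge inside would each lower the main term by at least 2 t / N, and
   [threshold_no] would refute the threshold. Both remaining claims are proved from this. *)
have no : ~~ (#|S|%:R * (1 - 3 / 2 * t) - t / N%:R * edges S <=
              k%:R * (1 - 3 / 2 * t) - 2 * t / N%:R).
  apply/negP => h; move: kle; rewrite E1 leNgt => /negP; apply.
  apply: (threshold_no k1 kN' N2 tE').
  move: E2; rewrite ler_norml => /andP[_ E2]; rewrite -lerBlDr.
  by apply: le_trans h; rewrite lerBlDr addrC -lerBlDr.
have Sk' : #|S| = k.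
  apply/eqP; rewrite eqn_leq Sk leqNgt /=; apply: contra no => lt.
  by apply: (loss_small_set t_gt0 t_le N2 edges_ge0); rewrite natr1 ler_nat.
split; [exact: gS | exact: Sk' |].
move=> i j iS jS; apply: contra no => ij; rewrite Sk'.
apply: (loss_edge _ t_gt0 N2).
exact: (sum_edges_ge2 R adj_sym adj_irr iS jS ij).
Qed.

End Decision.

(** * Programs for multi-tape machines *)

Definition tape_at (t : tape) (z : int) : cell :=
  match z with
  | Posz 0 => tape_head t
  | Posz k.+1 => nth None (tape_right t) k
  | Negz k => nth None (tape_left t) k
  end.

Definition shift (d : direction) : int :=
  match d with MoveLeft => -1 | Stay => 0 | MoveRight => 1 end.

Lemma tape_at_write c t z :
  tape_at (write_tape c t) z = if z == 0 then c else tape_at t z.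
Proof. by case: z => [[|k]|k]. Qed.

Lemma tape_at_move d t z : tape_at (move_tape d t) z = tape_at t (z + shift d).
Proof.
case: t => l c r; case: d => /=; rewrite ?addr0 //.
- case: z => [[|k]|k]; [by case: l| |].
  + have -> : k.+1%:Z + -1 = Posz k by lia.
    by case: k.
  + have -> : Negz k + -1 = Negz k.+1 by lia.
    by case: l => //=; rewrite nth_nil.
- case: z => [k|[|k]]; [|by case: r|].
  + have -> : k%:Z + 1 = Posz k.+1 by lia.
    by case: k => [|k]; case: r => //=; rewrite nth_nil.
  + by have -> : Negz k.+1 + 1 = Negz k by lia.
Qed.

(** Tapes are addressed absolutely, unlike those of a machine, and there is one for every natural
    number: programs are then independent of the number of tapes, which [within] bounds
    separately. *)
Record state := State { pos : nat -> int; con : nat -> int -> cell }.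

Definition look (st : state) (i : nat) : cell := con st i (pos st i).

Definition move (i : nat) (d : direction) (st : state) : state :=
  State (fun j => if j == i then pos st j + shift d else pos st j) (con st).

Definition write (i : nat) (c : cell) (st : state) : state :=
  State (pos st) (fun j z => if (j == i) && (z == pos st i) then c else con st j z).

Inductive instr (Q : Type) :=
  | Halt
  | MoveI of nat & direction & Q
  | WriteI of nat & cell & Q
  | Branch of nat & (cell -> Q).
Arguments Halt {Q}.

Definition instr_map (Q Q' : Type) (g : Q -> Q') (I : instr Q) : instr Q' :=
  match I with
  | Halt => Halt
  | MoveI i d q => MoveI i d (g q)
  | WriteI i c q => WriteI i c (g q)
  | Branch i f => Branch i (g \o f)
  end.

Definition halts (Q : Type) (I : instr Q) : bool := if I is Halt then true else false.

Definition instr_step (Q : Type) (I : instr Q) (st : state) : option (Q * state) :=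
  match I with
  | Halt => None
  | MoveI i d q => Some (q, move i d st)
  | WriteI i c q => Some (q, write i c st)
  | Branch i f => Some (f (look st i), st)
  end.

Definition instr_within (k : nat) (Q : Type) (I : instr Q) : bool :=
  match I with
  | Halt => true
  | MoveI i _ _ | WriteI i _ _ | Branch i _ => (i <= k)%N
  end.

Record frag := Frag { fQ : finType; fstart : fQ; fcode : fQ -> instr fQ }.

Fixpoint runs (Q : Type) (code : Q -> instr Q) (n : nat) (q : Q) (st : state)
    (q' : Q) (st' : state) : Prop :=
  if n is m.+1 then
    if instr_step (code q) st is Some (q1, st1) then runs code m q1 st1 q' st'
    else False
  else q = q' /\ st = st'.

Lemma runs_trans (Q : Type) (code : Q -> instr Q) m n q st q1 st1 q2 st2 :
  runs code m q st q1 st1 -> runs code n q1 st1 q2 st2 ->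
  runs code (m + n) q st q2 st2.
Proof.
elim: m q st => [|m IH] q st /=; first by case=> -> ->.
by case: instr_step => [[q3 st3]|//]; exact: IH.
Qed.

Lemma runs_map (Q Q' : Type) (code : Q -> instr Q) (code' : Q' -> instr Q')
    (g : Q -> Q') n q st q1 st1 :
  (forall q, ~~ halts (code q) -> code' (g q) = instr_map g (code q)) ->
  runs code n q st q1 st1 -> runs code' n (g q) st (g q1) st1.
Proof.
move=> gE; elim: n q st => [|n IH] q st /=; first by case=> -> ->.
have := gE q; case: (code q) => //= [i d q3|i c q3|i f] -> //=; exact: IH.
Qed.

Inductive cmd :=
  | Skip
  | Mv of nat & direction
  | Wr of nat & cell
  | Sq of cmd & cmd
  | Br of nat & (cell -> cmd)
  | Wh of nat & (cell -> bool) & cmd.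

Fixpoint within (k : nat) (c : cmd) : bool :=
  match c with
  | Skip => true
  | Mv i _ | Wr i _ => (i <= k)%N
  | Sq c1 c2 => within k c1 && within k c2
  | Br i f => [&& (i <= k)%N, within k (f None), within k (f (Some true)) &
                  within k (f (Some false))]
  | Wh i _ c => (i <= k)%N && within k c
  end.

(** A branch whose target ignores the symbol is a jump; the halting states of the first fragment
    become jumps to the second. *)
Definition seq_code (F1 F2 : frag) (q : fQ F1 + fQ F2) : instr (fQ F1 + fQ F2)%type :=
  match q with
  | inl q => if halts (fcode q) then Branch 0 (fun _ => inr (fstart F2))
             else instr_map inl (fcode q)
  | inr q => instr_map inr (fcode q)
  end.

Definition br_code (i : nat) (F : cell -> frag) (q : option {c : cell & fQ (F c)}) :
    instr (option {c : cell & fQ (F c)}) :=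
  match q with
  | None => Branch i (fun c => Some (Tagged (fun c => fQ (F c)) (fstart (F c))))
  | Some (existT c q) =>
      instr_map (fun q => Some (Tagged (fun c => fQ (F c)) q)) (fcode q)
  end.

(** [None] is the exit, [Some None] the test, and the other states are those of the body, whose
    halting states jump back to the test. *)
Definition wh_code (i : nat) (P : cell -> bool) (F : frag) (q : option (option (fQ F))) :
    instr (option (option (fQ F))) :=
  match q with
  | None => Halt
  | Some None => Branch i (fun c => if P c then Some (Some (fstart F)) else None)
  | Some (Some q) => if halts (fcode q) then Branch 0 (fun _ => Some None)
                     else instr_map (fun q => Some (Some q)) (fcode q)
  end.

Fixpoint compile (c : cmd) : frag :=
  match c with
  | Skip => Frag tt (fun _ => Halt)
  | Mv i d => Frag false (fun b => if b then Halt else MoveI i d true)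
  | Wr i c => Frag false (fun b => if b then Halt else WriteI i c true)
  | Sq c1 c2 =>
      let F1 := compile c1 in let F2 := compile c2 in
      Frag (inl (fstart F1)) (@seq_code F1 F2)
  | Br i f =>
      Frag (None : option {c : cell & fQ (compile (f c))})
           (@br_code i (fun c => compile (f c)))
  | Wh i P c =>
      Frag (Some None : option (option (fQ (compile c)))) (@wh_code i P (compile c))
  end.

Lemma instr_within_map k (Q Q' : Type) (g : Q -> Q') (I : instr Q) :
  instr_within k (instr_map g I) = instr_within k I.
Proof. by case: I. Qed.

Lemma compile_within k c (q : fQ (compile c)) :
  within k c -> instr_within k (fcode q).
Proof.
elim: c q => [|i d|i c|c1 IH1 c2 IH2|i f IH|i P c IH] /=.
- by [].
- by case.
- by case.
- case=> q /andP[w1 w2] /=; last by rewrite instr_within_map; exact: IH2.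
  by case: ifP => // _; rewrite instr_within_map; exact: IH1.
- case=> [[c q]|] /and4P[wi w1 w2 w3] //=.
  by rewrite instr_within_map; apply: IH; case: c {q} => [[]|].
- case=> [[q|]|] /andP[wi w] //=.
  by case: ifP => // _; rewrite instr_within_map; exact: IH.
Qed.

(** The number [n] is only an upper bound on the steps, so time bounds can be rounded up freely. *)
Definition does (c : cmd) (st : state) (n : nat) (st' : state) : Prop :=
  exists (m : nat) (q : fQ (compile c)),
    [/\ (m <= n)%N, runs (@fcode _) m (fstart (compile c)) st q st' & halts (fcode q)].

Lemma does_leq c st n n' st' : (n <= n')%N -> does c st n st' -> does c st n' st'.
Proof. by move=> le [m [q [mn r h]]]; exists m, q; split=> //; exact: leq_trans le. Qed.

Lemma does_skip st : does Skip st 0 st.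
Proof. by exists 0%N, tt. Qed.

Lemma does_mv i d st : does (Mv i d) st 1 (move i d st).
Proof. by exists 1%N, true. Qed.

Lemma does_wr i c st : does (Wr i c) st 1 (write i c st).
Proof. by exists 1%N, true. Qed.

Lemma does_sq c1 c2 st n1 st1 n2 st2 :
  does c1 st n1 st1 -> does c2 st1 n2 st2 -> does (Sq c1 c2) st (n1 + n2).+1 st2.
Proof.
move=> [m1 [q1 [le1 r1 h1]]] [m2 [q2 [le2 r2 h2]]].
exists (m1 + m2.+1)%N, (inr q2); split; first by lia.
  apply: (@runs_trans _ _ _ _ _ _ (inl q1) st1).
    by apply: runs_map r1 => q /= /negPf ->.
  rewrite /= h1 /=; by apply: runs_map r2.
by move: h2 => /=; case: (fcode q2).
Qed.

Lemma does_br i f st n st' :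
  does (f (look st i)) st n st' -> does (Br i f) st n.+1 st'.
Proof.
move=> [m [q [le r h]]].
exists m.+1, (Some (Tagged (fun c => fQ (compile (f c))) q)); split=> //.
  apply: (runs_map (g := fun q => Some (Tagged (fun c => fQ (compile (f c))) q))) r.
  by [].
by move: h => /=; case: (fcode q).
Qed.

Lemma does_wh_end i (P : cell -> bool) c st : ~~ P (look st i) -> does (Wh i P c) st 1 st.
Proof. by move=> /negPf h; exists 1%N, None; rewrite /= h. Qed.

Lemma does_wh_step i (P : cell -> bool) c st n st1 n' st2 :
  P (look st i) -> does c st n st1 -> does (Wh i P c) st1 n' st2 ->
  does (Wh i P c) st (n + n').+2 st2.
Proof.
move=> h [m1 [q1 [le1 r1 h1]]] [m2 [q2 [le2 r2 h2]]].
exists (m1 + m2.+1).+1, q2; split => //; first by lia.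
rewrite /= h; apply: (@runs_trans _ _ _ _ _ _ (Some (Some q1)) st1).
  by apply: (runs_map (g := fun q => Some (Some q))) r1 => q /= /negPf ->.
by rewrite /= h1.
Qed.

(** Besides the body, every round takes one step for the test and one for the jump back; the last
    test is the additional step. *)
Lemma does_wh i (P : cell -> bool) c (S : nat -> state) (n B : nat) :
  (forall j, (j < n)%N -> P (look (S j) i) /\ does c (S j) B (S j.+1)) ->
  ~~ P (look (S n) i) -> does (Wh i P c) (S 0) (n * B.+2).+1 (S n).
Proof.
elim: n S => [|n IH] S Hstep Hend; first exact: does_wh_end.
have [h d] := Hstep 0%N isT.
apply: does_leq (does_wh_step h d (IH (fun j => S j.+1) _ _)) => //.
- by rewrite mulSn; lia.
- by move=> j jn; apply: Hstep.
Qed.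

(** * Execution of programs by Turing machines *)

Definition machine (k : nat) (c : cmd) : turing_machine :=
  let F := compile c in
  @TuringMachine k (fQ F) (fstart F) (fun q => halts (fcode q))
    (fun q h => match fcode q with
      | Halt => (q, fun i => (h i, Stay))
      | MoveI j d q' => (q', fun i => (h i, if val i == j then d else Stay))
      | WriteI j c q' => (q', fun i => (if val i == j then c else h i, Stay))
      | Branch j f => (f (h (inord j)), fun i => (h i, Stay))
      end).

Definition agrees (k : nat) (ts : 'I_k.+1 -> tape) (st : state) : Prop :=
  forall i z, tape_at (ts i) z = con st i (pos st i + z).

Lemma agrees_head k (ts : 'I_k.+1 -> tape) st i :
  agrees ts st -> tape_head (ts i) = look st i.
Proof. by move=> /(_ i 0); rewrite addr0. Qed.

Lemma tape_at_rewrite (t : tape) c d z : c = tape_head t ->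
  tape_at (move_tape d (write_tape c t)) z = tape_at t (z + shift d).
Proof. by move=> ->; rewrite tape_at_move tape_at_write; case: eqP => [->|]. Qed.

Lemma machine_step k c q ts st q1 st1 :
  within k c -> agrees ts st -> instr_step (fcode q) st = Some (q1, st1) ->
  exists2 ts1, @tm_step (machine k c) (q, ts) = (q1, ts1) & agrees ts1 st1.
Proof.
move=> wc ag; rewrite /tm_step /=; have := compile_within q wc.
case: (fcode q) => [|i d q'|i x q'|i f] //= ik [<- <-].
- eexists; first reflexivity.
  move=> j z; rewrite tape_at_rewrite ?ffunE // ag /= eqnE.
  case: eqP => _ /=; last by rewrite addr0.
  by rewrite addrAC addrA.
- eexists; first reflexivity.
  move=> j z; rewrite tape_at_write ffunE ag (agrees_head _ ag) /=.
  have [->|z0] := eqVneq z 0; rewrite ?addr0.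
    by case: eqVneq => [->|]; rewrite ?eqxx.
  case: eqVneq => [->|//]; rewrite -subr_eq0 addrAC subrr add0r (negPf z0).
  by [].
- exists ts; last by [].
  congr pair; first by rewrite ffunE (agrees_head _ ag) inordK.
  by apply/funext => j; rewrite ffunE; case: (ts j).
Qed.

Lemma machine_runs k c n q ts st q1 st1 :
  within k c -> agrees ts st -> runs (@fcode _) n q st q1 st1 ->
  exists2 ts1, iter n (@tm_step (machine k c)) (q, ts) = (q1, ts1) & agrees ts1 st1.
Proof.
move=> wc; elim: n q ts st => [|n IH] q ts st ag /=.
  by case=> <- <-; exists ts.
case E: instr_step => [[q2 st2]|//] r.
have [ts2 E2 ag2] := machine_step wc ag E.
have [ts1 E1 ag1] := IH _ _ _ ag2 r.
by exists ts1 => //; rewrite -iterS iterSr E2.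
Qed.

Lemma tm_step_halting (M : turing_machine) n (c : tm_config M) :
  tm_halting c.1 -> iter n (@tm_step M) c = c.
Proof. by move=> h; elim: n => //= n ->; rewrite /tm_step h. Qed.

Lemma tape_at_of_bits (w : bits) (z : int) :
  tape_at (tape_of_bits w) z = if z is Posz j then nth None [seq Some b | b <- w] j else None.
Proof.
case: z => [[|j]|j] /=; first by case: w.
  by rewrite nth_behead.
by rewrite nth_nil.
Qed.

Lemma bits_of_tapeP (t : tape) (w : bits) :
  (forall j, (j < size w)%N -> tape_at t j%:Z = Some (nth false w j)) ->
  tape_at t (size w)%:Z = None -> bits_of_tape t = w.
Proof.
case: t => l h r; rewrite /bits_of_tape [tape_head _]/= [tape_right _]/=.
have E j : tape_at (Tape l h r) j%:Z = nth None (h :: r) j by case: j.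
move=> Hw; rewrite E; have {E} : forall j, (j < size w)%N ->
    nth None (h :: r) j = Some (nth false w j) by move=> j /Hw; rewrite E.
move: (h :: r) => s; elim: w s {Hw} => [|b w IH] [|c s] //= Hw Hn.
- by rewrite Hn.
- by have := Hw 0%N isT.
- by have /= -> := Hw 0%N isT; rewrite (IH s) // => j jw; exact: (Hw j.+1).
Qed.

Definition input_state (x : bits) : state :=
  State (fun _ => 0) (fun i z => tape_at (tape_of_bits (nth [::] [:: x] i)) z).

Lemma does_computes k c x n st w :
  within k c -> does c (input_state x) n st ->
  (forall j, (j < size w)%N -> con st 0%N (pos st 0%N + j%:Z) = Some (nth false w j)) ->
  con st 0%N (pos st 0%N + (size w)%:Z) = None ->
  tm_computes (machine k c) n [:: x] w.
Proof.
move=> wc [m [q [mn r h]]] Hw He.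
have ag0 : agrees (fun i : 'I_k.+1 => tape_of_bits (nth [::] [:: x] i)) (input_state x).
  by move=> i z; rewrite /= add0r.
have [ts E ag] := machine_runs wc ag0 r.
have En : iter n (@tm_step (machine k c)) (tm_init (machine k c) [:: x]) = (q, ts).
  by rewrite -(subnK mn) iterD E tm_step_halting.
rewrite /tm_computes En; split=> //=.
apply: bits_of_tapeP => [j jw|]; by rewrite ag ?He ?Hw.
Qed.

(** * Head displacements and loops over unary rulers *)

Lemma state_ext (st st' : state) :
  (forall i, pos st i = pos st' i) -> (forall i z, con st i z = con st' i z) -> st = st'.
Proof.
case: st st' => [p c] [p' c'] /= Hp Hc; congr State; first exact/funext.
by apply/funext => i; apply/funext => z.
Qed.

(** Loops displace heads and restore them at the end, so their bodies are specified at displaced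
    states. *)
Definition off (u : nat -> int) (st : state) : state :=
  State (fun i => pos st i + u i) (con st).

Lemma off_eq u u' st : u =1 u' -> off u st = off u' st.
Proof. by move=> uu; apply: state_ext => //= i; rewrite uu. Qed.

Lemma off0 u st : (forall i, u i = 0) -> off u st = st.
Proof. by move=> u0; apply: state_ext => //= i; rewrite u0 addr0. Qed.

Lemma offD u u' st : off u (off u' st) = off (fun i => u' i + u i) st.
Proof. by apply: state_ext => //= i; rewrite addrA. Qed.

Definition opposite (d : direction) : direction :=
  match d with MoveLeft => MoveRight | Stay => Stay | MoveRight => MoveLeft end.

Definition moves := seq (nat * direction).

Definition back (l : moves) : moves := [seq (a.1, opposite a.2) | a <- l].

Definition mvs (l : moves) : cmd := foldr (fun a c => Sq (Mv a.1 a.2) c) Skip l.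

Definition disp (l : moves) (i : nat) : int :=
  foldr (fun a s => if i == a.1 then shift a.2 + s else s) 0 l.

Lemma disp_back l i : disp (back l) i = - disp l i.
Proof.
elim: l => [|[j d] l IH] /=; first by rewrite oppr0.
by rewrite IH; case: ifP => // _; rewrite opprD; case: d.
Qed.

Lemma does_mvs l st : does (mvs l) st (2 * size l) (off (disp l) st).
Proof.
elim: l st => [|[i d] l IH] st /=.
  by rewrite off0 //; exact: does_skip.
rewrite mulnS addnC addn2 -addn1.
have := does_sq (does_mv i d st) (IH (move i d st)).
rewrite add1n addn1; congr (does _ _ _ _).
apply: state_ext => //= j.
by case: eqP => _; rewrite ?addrA.
Qed.

(** A number in unary that controls a loop. The blanks on both sides let the head detect the end of
    the loop and, on the way back, its start. *)
Definition ruler (st : state) (r n : nat) : Prop :=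
  forall z, isSome (con st r (pos st r + z)) = (0 <= z < n%:Z).

(** After the rounds the head of tape [r] is just beyond the ruler. One move back, moves back until
    the blank on the left, and one move forward return every head to its place, however far each was
    carried. *)
Definition For (r : nat) (l : moves) (body : cmd) : cmd :=
  Sq (Wh r isSome (Sq body (mvs l)))
     (Sq (mvs (back l)) (Sq (Wh r isSome (mvs (back l))) (mvs l))).

Definition for_time (n s B : nat) : nat := (n * (B + 4 * s + 6) + 4 * s + 6)%N.

(* The state during iteration [j] is [A j] up to the displacement of the heads. *)
Lemma does_for r l body (A : nat -> state) n B :
  disp l r = 1 -> (forall j, (j <= n)%N -> ruler (A j) r n) ->
  (forall j, (j < n)%N ->
    does body (off (fun i => disp l i * j%:Z) (A j)) B
              (off (fun i => disp l i * j%:Z) (A j.+1))) ->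
  does (For r l body) (A 0%N) (for_time n (size l) B) (A n).
Proof.
move=> vr rul Hb; set v := disp l in vr Hb *.
pose S j := off (fun i => v i * j%:Z) (A j).
have H1 : does (Wh r isSome (Sq body (mvs l))) (S 0%N) (n * (B + 2 * size l).+3).+1 (S n).
  apply: does_wh => [j jn|].
    split; first by rewrite /look /= vr mul1r (rul j (ltnW jn)); lia.
    have := does_sq (Hb j jn) (does_mvs l _); congr (does _ _ _ _).
    rewrite offD; apply: off_eq => i; rewrite -/v.
    by rewrite (_ : j.+1%:Z = j%:Z + 1) ?mulrDr ?mulr1 //; lia.
  by rewrite /look /= vr mul1r rul //; lia.
(* The offset runs from n - 1, the last cell of the ruler, down to -1, the blank before it. *)
pose S' j := off (fun i => v i * (n%:Z - 1 - j%:Z)) (A n).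
have size_back : size (back l) = size l by rewrite size_map.
have H2 : does (mvs (back l)) (S n) (2 * size l) (S' 0%N).
  have := does_mvs (back l) (S n); rewrite size_back; congr (does _ _ _ _).
  rewrite offD; apply: off_eq => i; rewrite disp_back -/v.
  by rewrite subr0 mulrBr mulr1.
have H3 : does (Wh r isSome (mvs (back l))) (S' 0%N) (n * (2 * size l).+2).+1 (S' n).
  apply: does_wh => [j jn|].
    split; first by rewrite /look /= vr mul1r rul //; lia.
    have := does_mvs (back l) (S' j); rewrite size_back; congr (does _ _ _ _).
    rewrite offD; apply: off_eq => i; rewrite disp_back -/v.
    by rewrite (_ : j.+1%:Z = j%:Z + 1) ?opprD ?addrA ?(mulrDr _ _ (-1)) ?mulrN1 //; lia.
  by rewrite /look /= vr mul1r rul //; lia.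
have H4 : does (mvs l) (S' n) (2 * size l) (A n).
  have := does_mvs l (S' n); congr (does _ _ _ _).
  rewrite offD; apply: off0 => i; rewrite -/v.
  by rewrite addrAC subrr add0r mulrN1 addrC subrr.
have E0 : S 0%N = A 0%N by apply: off0 => i; rewrite mulr0.
have := does_sq H1 (does_sq H2 (does_sq H3 H4)); rewrite E0.
by apply: does_leq; rewrite /for_time; lia.
Qed.

Definition nest (l : seq nat) (body : cmd) : cmd :=
  foldr (fun r c => For r [:: (r, MoveRight)] c) body l.

Definition nest_time (n k B : nat) : nat := iter k (for_time n 1) B.

(** [A] is indexed by the total number of iterations. The body has to work for every displacement
    [u] of the loop heads, since it must not depend on where they are. *)
Lemma does_nest l body (A : nat -> state) n B :
  uniq l -> (forall j r, r \in l -> ruler (A j) r n) ->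
  (forall j u, (j < n ^ size l)%N -> (forall i, i \notin l -> u i = 0) ->
    does body (off u (A j)) B (off u (A j.+1))) ->
  does (nest l body) (A 0%N) (nest_time n (size l) B) (A (n ^ size l)%N).
Proof.
elim: l A => [|r l IH] A /=.
  move=> _ _ /(_ 0%N (fun _ => 0) isT (fun _ _ => erefl)).
  by rewrite !off0.
move=> /andP[rl ul] rul Hb.
(* A round of the outer loop covers a block of n ^ size l iterations of the body. *)
pose A' j := A (j * n ^ size l)%N.
have -> : A (n ^ (size l).+1)%N = A' n by rewrite expnS.
rewrite (_ : A 0%N = A' 0%N); last by rewrite /A' mul0n.
have vr : disp [:: (r, MoveRight)] r = 1 by rewrite /= eqxx.
apply: (does_for vr) => [j _|j jn]; first by apply: rul; rewrite mem_head.
set v := fun i => _.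
have v0 i : i != r -> v i = 0 by move=> /negPf ir; rewrite /v /= ir mul0r.
have := IH (fun m => off v (A (j * n ^ size l + m)%N)) ul _ _.
rewrite addn0 (_ : A' j.+1 = A (j * n ^ size l + n ^ size l)%N) ?/A' ?mulSnr //.
apply=> [m r' r'l z|m u mn Hu].
  have r'r : r' != r by apply: contraNneq rl => <-.
  rewrite /= v0 // addr0; apply: rul; by rewrite inE r'l orbT.
rewrite !offD addnS; apply: Hb.
  rewrite expnS; apply: (@leq_trans (j.+1 * n ^ size l)%N).
    by rewrite mulSn addnC ltn_add2r.
  by rewrite leq_mul2r jn orbT.
move=> i; rewrite inE negb_or => /andP[ir il].
by rewrite v0 // Hu // addr0.
Qed.

Definition rep (k : nat) (c : cmd) : cmd := iter k (Sq c) Skip.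

Lemma does_rep k c (A : nat -> state) B :
  (forall j, (j < k)%N -> does c (A j) B (A j.+1)) -> does (rep k c) (A 0%N) (k * B.+1) (A k).
Proof.
elim: k A => [|k IH] A H; first exact: does_skip.
have := does_sq (H 0%N isT) (IH (fun j => A j.+1) (fun j jk => H j.+1 jk)).
by apply: does_leq; rewrite mulSn; lia.
Qed.

(** * Output *)

Definition put (b : bool) (st : state) : state :=
  move 0 MoveRight (write 0 (Some b) st).

Definition out (w : bits) (st : state) : state := foldl (fun st b => put b st) st w.

Lemma out_cat w w' st : out (w ++ w') st = out w' (out w st).
Proof. exact: foldl_cat. Qed.

Lemma pos_out w st i :
  pos (out w st) i = if i == 0%N then pos st 0%N + (size w)%:Z else pos st i.
Proof.
elim: w st => [|b w IH] st /=; first by case: eqP => [->|]; rewrite ?addr0.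
rewrite IH /=; case: ifP => [_|->//].
by rewrite -addrA.
Qed.

Lemma con_out w st i z :
  con (out w st) i z =
  if (i == 0%N) && (pos st 0%N <= z < pos st 0%N + (size w)%:Z)
  then Some (nth false w `|z - pos st 0%N|%N) else con st i z.
Proof.
elim: w st => [|b w IH] st /=.
  by rewrite addr0; case: ifP => // /andP[_]; lia.
rewrite IH /=; case: (i =P 0%N) => //= ->.
have [->|zp] := eqVneq z (pos st 0%N).
  rewrite subrr /=; case: ifP; first by lia.
  by rewrite lexx ltrDl.
case: ifP => h1; case: ifP => h2; try lia; last by [].
congr Some; rewrite (_ : `|z - pos st 0%N|%N = `|(z - (pos st 0%N + 1))%R|.+1) //.
by lia.
Qed.

Lemma out_off u w st : u 0%N = 0 -> out w (off u st) = off u (out w st).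
Proof.
move=> u0; apply: state_ext => [i|i z].
  by rewrite /= !pos_out /=; case: eqP => [->|//]; rewrite u0 !addr0.
by rewrite /= !con_out /= u0 addr0.
Qed.

Lemma look_out w st i : i != 0%N -> look (out w st) i = look st i.
Proof. by move=> /negPf i0; rewrite /look pos_out con_out i0. Qed.

Lemma ruler_out w st r n : r != 0%N -> ruler st r n -> ruler (out w st) r n.
Proof. by move=> /negPf r0 rul z; rewrite pos_out con_out r0 rul. Qed.

(** The quantification over the earlier output [w0] makes such specifications compose by
    concatenation; everything but the output is restored. *)
Definition prints (c : cmd) (st : state) (B : nat) (w : bits) : Prop :=
  forall w0, does c (out w0 st) B (out (w0 ++ w) st).

Lemma prints_leq c st B B' w : (B <= B')%N -> prints c st B w -> prints c st B' w.
Proof. by move=> le H w0; exact: does_leq le (H w0). Qed.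

Lemma prints_skip st : prints Skip st 0 [::].
Proof. by move=> w0; rewrite cats0; exact: does_skip. Qed.

Lemma prints_sq c1 c2 st B1 B2 w1 w2 :
  prints c1 st B1 w1 -> prints c2 st B2 w2 -> prints (Sq c1 c2) st (B1 + B2).+1 (w1 ++ w2).
Proof. by move=> H1 H2 w0; rewrite catA; exact: does_sq (H1 w0) (H2 _). Qed.

Lemma prints_br i f st B w :
  i != 0%N -> prints (f (look st i)) st B w -> prints (Br i f) st B.+1 w.
Proof. by move=> i0 H w0; apply: does_br; rewrite look_out. Qed.

Definition emit (w : bits) : cmd :=
  foldr (fun b c => Sq (Wr 0 (Some b)) (Sq (Mv 0 MoveRight) c)) Skip w.

Lemma prints_emit w st : prints (emit w) st (4 * size w) w.
Proof.
move=> w0; rewrite out_cat; elim: w (out w0 st) => [|b w IH] st' /=; first exact: does_skip.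
have := does_sq (does_wr 0 (Some b) st') (does_sq (does_mv 0 MoveRight _) (IH _)).
by apply: does_leq; lia.
Qed.

Definition seqs (cs : seq cmd) : cmd := foldr Sq Skip cs.

Lemma prints_seqs (T : Type) (s : seq T) (c : T -> cmd) (w : T -> bits) st B :
  (forall x, prints (c x) st B (w x)) ->
  prints (seqs [seq c x | x <- s]) st (size s * B.+1) (flatten [seq w x | x <- s]).
Proof.
move=> H; elim: s => [|x s IH] /=; first exact: prints_skip.
by apply: prints_leq (prints_sq (H x) IH); rewrite mulSn; lia.
Qed.

Lemma prints_for r l body st n B (w : nat -> bits) :
  disp l r = 1 -> disp l 0 = 0 -> r != 0%N -> ruler st r n ->
  (forall j, (j < n)%N -> prints body (off (fun i => disp l i * j%:Z) st) B (w j)) ->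
  prints (For r l body) st (for_time n (size l) B) (flatten [seq w j | j <- iota 0 n]).
Proof.
move=> vr v0 r0 rul H w0.
pose A j := out (w0 ++ flatten [seq w j | j <- iota 0 j]) st.
rewrite -/(A n) (_ : out w0 st = A 0%N); last by rewrite /A /= cats0.
apply: (does_for vr) => [j _|j jn]; first exact: ruler_out.
have E k : off (fun i => disp l i * j%:Z) (A k) = out (w0 ++ flatten [seq w j | j <- iota 0 k])
   (off (fun i => disp l i * j%:Z) st) by rewrite out_off // v0 mul0r.
rewrite !E -addn1 iotaD map_cat flatten_cat /= cats0 catA.
exact: H.
Qed.

(** * A binary counter *)

Fixpoint incr (s : bits) : bits :=
  match s with
  | [::] => [:: true]
  | false :: s => true :: s
  | true :: s => false :: incr s
  end.

Definition bin (m : nat) : bits := iter m incr [::].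

Lemma nat_digits_fuel f n : (n <= f)%N -> nat_digits f n = nat_digits n n.
Proof.
elim/ltn_ind: n f => -[|n] IH [|f] //= nf.
have h : (uphalf n <= n)%N by lia.
by rewrite (IH (uphalf n)) ?(IH (uphalf n) _ n) //; lia.
Qed.

(** The code of a number is defined by halving, whereas the machine only counts upwards. *)
Lemma nat_digits_bin n : nat_digits n n = bin n.
Proof.
have [d Ed] : exists d, forall m, d m = nat_digits m m by exists (fun m => nat_digits m m).
have digitsE m : d m.+1 = odd m.+1 :: d m.+1./2.
  by rewrite !Ed /= nat_digits_fuel //; lia.
have d0 : d 0%N = [::] by rewrite Ed.
rewrite -Ed; move: d digitsE d0 {Ed} => d digitsE d0.
suff H m : incr (d m) = d m.+1 by elim: n => // n IH; rewrite -H IH.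
elim/ltn_ind: m => -[|m] IH; first by rewrite digitsE d0.
rewrite [in LHS]digitsE [RHS]digitsE [odd m.+2]/= [odd m.+1]/=.
case o: (odd m) => /=; first by congr (_ :: d _); lia.
by rewrite IH; [congr (_ :: d _) | ]; lia.
Qed.

Lemma size_incr s : (size (incr s) <= (size s).+1)%N.
Proof. by elim: s => [|[] s IH]. Qed.

(** Crude but sufficient, because all the numbers counted are polynomial in the length of the
    input. *)
Lemma size_bin m : (size (bin m) <= m)%N.
Proof. by elim: m => //= m IH; exact: leq_trans (size_incr _) _. Qed.

(** [head false t] and [behead t] treat alike the two ways in which a carry stops, at a digit 0 and
    at the end of the word. *)
Lemma incr_split s : exists k t,
  [/\ s = nseq k true ++ t, head false t = false & incr s = nseq k false ++ true :: behead t].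
Proof.
elim: s => [|[] s [k [t [es ht ei]]]].
- by exists 0%N, [::].
- by exists k.+1, t; rewrite /= ei -es.
- by exists 0%N, (false :: s).
Qed.

Lemma set_nth_nseq_cat (T : Type) (x y a : T) j v :
  set_nth x (nseq j a ++ v) j y = nseq j a ++ y :: behead v.
Proof. by elim: j => [|j IH] /=; [case: v | rewrite IH]. Qed.

(** Tape 0 carries the input and later the output, tapes 1 to 8 are rulers, 9 to 18 serve to
    recognize positions, and the tapes from 20 on are copies of the input length. *)
Definition counter : nat := 19.

Definition word_at (s : bits) (z : int) : cell :=
  if (0 <= z < (size s)%:Z) then Some (nth false s `|z|%N) else None.

(* The counter tape holds [s] from its home position; its head is [h] cells
   further. *)
Definition ctr (s : bits) (h : int) (st : state) : state :=
  State (fun i => if i == counter then pos st counter + h else pos st i)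
        (fun i z => if i == counter then word_at s (z - pos st counter) else con st i z).

Lemma look_ctr s h st : look (ctr s h st) counter = word_at s h.
Proof. by rewrite /look /= addrAC subrr add0r. Qed.

Lemma move_ctr s h st d : move counter d (ctr s h st) = ctr s (h + shift d) st.
Proof. by apply: state_ext => //= i; case: eqP; rewrite ?addrA. Qed.

Lemma write_ctr s h st b : (h <= size s)%N ->
  write counter (Some b) (ctr s h%:Z st) = ctr (set_nth false s h b) h%:Z st.
Proof.
move=> hs; apply: state_ext => //= i z.
case: (eqVneq i counter) => [_|_] //=.
rewrite /word_at nth_set_nth size_set_nth /=.
have -> : (z == pos st counter + h) = (z - pos st counter == h).
  by rewrite subr_eq addrC.
case: (z - pos st counter) => [j|j] //=.
rewrite (_ : (Posz j == h) = (j == h)) //.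
have [->|jh] := eqVneq j h; first by case: ifP => //; lia.
by congr (if _ then _ else _); lia.
Qed.

Lemma erase_ctr s h st : size s = h.+1 ->
  write counter None (ctr s h%:Z st) = ctr (take h s) h%:Z st.
Proof.
move=> hs; apply: state_ext => //= i z.
case: (eqVneq i counter) => [_|_] //=.
rewrite /word_at size_take hs ltnSn.
have -> : (z == pos st counter + h) = (z - pos st counter == h).
  by rewrite subr_eq addrC.
case: (z - pos st counter) => [j|j] //=.
rewrite (_ : (Posz j == h) = (j == h)) //.
have [->|jh] := eqVneq j h; first by case: ifP => //; lia.
case: ifP => h1; case: ifP => h2 //; try lia.
by rewrite nth_take //; lia.
Qed.

Lemma off_ctr u s h st : u counter = 0 -> off u (ctr s h st) = ctr s h (off u st).
Proof.
move=> u0; apply: state_ext => [i|i z] /=; last by rewrite u0 addr0.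
by case: eqP => [->|//]; rewrite u0 !addr0.
Qed.

Lemma ctr_nil st : (forall z, con st counter z = None) -> ctr [::] 0 st = st.
Proof.
move=> b; apply: state_ext => [i|i z] /=; first by case: eqP => [->|//]; rewrite addr0.
by case: eqP => [->|//]; rewrite b /word_at; case: ifP => //=; lia.
Qed.

Lemma ruler_ctr s h st r n : r != counter -> ruler st r n -> ruler (ctr s h st) r n.
Proof. by move=> /negPf r0 rul z; rewrite /= r0 rul. Qed.

Lemma out_ctr w s h st : out w (ctr s h st) = ctr s h (out w st).
Proof.
apply: state_ext => [i|i z]; rewrite /= ?con_out !pos_out /=;
  by case: (i =P counter) => [->|].
Qed.

Definition counter_incr : cmd :=
  Sq (Wh counter (pred1 (Some true)) (Sq (Wr counter (Some false)) (Mv counter MoveRight)))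
     (Sq (Wr counter (Some true))
         (Sq (Wh counter isSome (Mv counter MoveLeft)) (Mv counter MoveRight))).

Lemma does_counter_incr s st :
  does counter_incr (ctr s 0 st) (8 * size s + 20) (ctr (incr s) 0 st).
Proof.
have [k [t [es ht ei]]] := incr_split s.
pose S j := ctr (nseq j false ++ nseq (k - j) true ++ t) j%:Z st.
have ks : (k <= size s)%N by rewrite es size_cat size_nseq leq_addr.
have H1 : does (Wh counter (pred1 (Some true))
    (Sq (Wr counter (Some false)) (Mv counter MoveRight))) (S 0%N) (k * 5).+1 (S k).
  apply: does_wh => [j jk|].
    split.
      rewrite look_ctr /word_at /= !size_cat !size_nseq nth_cat size_nseq ltnn subnn.
      by rewrite nth_cat size_nseq subn_gt0 jk nth_nseq subn_gt0 jk; case: ifP => //; lia.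
    have := does_sq (does_wr counter (Some false) (S j)) (does_mv counter MoveRight _).
    congr (does _ _ _ _); rewrite write_ctr ?move_ctr; last by rewrite size_cat size_nseq leq_addr.
    rewrite /S (_ : j%:Z + shift MoveRight = j.+1%:Z); last by rewrite /=; lia.
    congr ctr; rewrite set_nth_nseq_cat.
    by rewrite -(subnSK jk) [behead _]/= -[j.+1 in RHS]addn1 nseqD -catA !addn1.
  rewrite /S look_ctr /word_at /= !size_cat !size_nseq nth_cat size_nseq ltnn subnn.
  by case: ifP => //; move: ht; case: (t) => [|b t'] //= ->.
have S0 : S 0%N = ctr s 0 st by rewrite /S subn0 /= -es.
have H2 : does (Wr counter (Some true)) (S k) 1 (ctr (incr s) k%:Z st).
  have := does_wr counter (Some true) (S k); congr (does _ _ _ _).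
  rewrite write_ctr; last by rewrite size_cat size_nseq leq_addr.
  by rewrite subnn /= ei set_nth_nseq_cat.
pose S' j := ctr (incr s) (k%:Z - j%:Z) st.
have H3 : does (Wh counter isSome (Mv counter MoveLeft)) (S' 0%N) (k.+1 * 3).+1 (S' k.+1).
  apply: does_wh => [j jk|].
    split.
      rewrite look_ctr /word_at ei size_cat size_nseq /=; case: ifP => //; lia.
    have := does_mv counter MoveLeft (S' j); congr (does _ _ _ _).
    by rewrite move_ctr /S'; congr ctr; rewrite /=; lia.
  by rewrite look_ctr /word_at; case: ifP => //; lia.
have H4 : does (Mv counter MoveRight) (S' k.+1) 1 (ctr (incr s) 0 st).
  have := does_mv counter MoveRight (S' k.+1); congr (does _ _ _ _).
  by rewrite move_ctr /S'; congr ctr; rewrite /=; lia.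
have E : S' 0%N = ctr (incr s) k%:Z st by rewrite /S' subr0.
rewrite E in H3; have := does_sq H1 (does_sq H2 (does_sq H3 H4)); rewrite S0.
by apply: does_leq; lia.
Qed.

Lemma does_conv c st n n' st1 st2 :
  (n <= n')%N -> st1 = st2 -> does c st n st1 -> does c st n' st2.
Proof. by move=> le <-; exact: does_leq. Qed.

Definition digit_code (s : bits) : bits := flatten [seq [:: true; b] | b <- s].

(** The counter is erased while its head returns, and so is blank for the next number. *)
Definition counter_print : cmd :=
  Sq (Wh counter isSome
       (Sq (emit [:: true])
           (Sq (Br counter (fun c => emit [:: c == Some true])) (Mv counter MoveRight))))
  (Sq (emit [:: false])
  (Sq (Mv counter MoveLeft)
  (Sq (Wh counter isSome (Sq (Wr counter None) (Mv counter MoveLeft)))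
      (Mv counter MoveRight)))).

Lemma does_counter_print s st :
  does counter_print (ctr s 0 st) (30 * size s + 30)
    (ctr [::] 0 (out (digit_code s ++ [:: false]) st)).
Proof.
set k := size s.
pose S j := ctr s j%:Z (out (digit_code (take j s)) st).
have H1 : does (Wh counter isSome
       (Sq (emit [:: true])
           (Sq (Br counter (fun c => emit [:: c == Some true])) (Mv counter MoveRight))))
    (S 0%N) (k * 16).+1 (S k).
  apply: does_wh => [j jk|].
    have lj : word_at s j = Some (nth false s j) by rewrite /word_at /=; case: ifP => //; lia.
    split; first by rewrite look_ctr lj.
    have E1 := prints_emit [:: true] (S j) [::].
    have E2 := prints_emit [:: nth false s j] (S j) [:: true].
    have E3 : does (Br counter (fun c => emit [:: c == Some true])) (out [:: true] (S j))
       5 (out [:: true; nth false s j] (S j)).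
      apply: does_br; rewrite look_out // look_ctr lj.
      by case: nth E2.
    have := does_sq E1 (does_sq E3 (does_mv counter MoveRight _)).
    apply: does_conv => //.
    rewrite -[out [:: true; _] _]/(out [:: true; nth false s j] (S j)) /S out_ctr move_ctr.
    rewrite -out_cat (take_nth false jk) /digit_code map_rcons flatten_rcons.
    by congr ctr; rewrite /=; lia.
  by rewrite look_ctr /word_at; case: ifP => //; lia.
set st1 := out (digit_code s ++ [:: false]) st.
have H2 : does (emit [:: false]) (S k) 4 (ctr s k%:Z st1).
  have := prints_emit [:: false] (S k) [::]; congr (does _ _ _ _).
  by rewrite /S out_ctr take_size -out_cat.
pose S' j := ctr (take (k - j) s) (k%:Z - 1 - j%:Z) st1.
have H3 : does (Mv counter MoveLeft) (ctr s k%:Z st1) 1 (S' 0%N).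
  have := does_mv counter MoveLeft (ctr s k%:Z st1); congr (does _ _ _ _).
  by rewrite move_ctr /S' !subr0 subn0 take_size.
have H4 : does (Wh counter isSome (Sq (Wr counter None) (Mv counter MoveLeft)))
    (S' 0%N) (k * 5).+1 (S' k).
  apply: does_wh => [j jk|]; last first.
    by rewrite look_ctr subnn take0 /word_at /=; case: ifP => //; lia.
  have e : k%:Z - 1 - j%:Z = (k - j).-1%:Z by lia.
  have sz : size (take (k - j) s) = (k - j).-1.+1 by rewrite size_takel; lia.
  split; first by rewrite look_ctr e /word_at sz; case: ifP => //; lia.
  have := does_sq (does_wr counter None (S' j)) (does_mv counter MoveLeft _).
  congr (does _ _ _ _); rewrite /S' e erase_ctr // move_ctr take_takel ?leq_pred //.
  by congr (ctr (take _ _)); rewrite /=; lia.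
have H5 : does (Mv counter MoveRight) (S' k) 1 (ctr [::] 0 st1).
  have := does_mv counter MoveRight (S' k); congr (does _ _ _ _).
  by rewrite move_ctr /S' subnn take0; congr ctr; rewrite /=; lia.
have S0 : S 0%N = ctr s 0 st by rewrite /S take0.
have := does_sq H1 (does_sq H2 (does_sq H3 (does_sq H4 H5))); rewrite S0.
by apply: does_leq; lia.
Qed.

(* The entries of [l] are the rulers of nested loops, so that [(c, l)] stands
   for the monomial [c * n ^ size l]. *)
Definition eval (ms : seq (nat * seq nat)) (n : nat) : nat :=
  \sum_(m <- ms) (m.1 * n ^ size m.2)%N.

(** Polynomials are evaluated by counting: each monomial is a nest of loops around as many
    increments as its coefficient. *)
Definition num (ms : seq (nat * seq nat)) : cmd :=
  Sq (seqs [seq nest m.2 (rep m.1 counter_incr) | m <- ms]) counter_print.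

Definition num_time (ms : seq (nat * seq nat)) (n : nat) : nat :=
  (\sum_(m <- ms) (nest_time n (size m.2) (m.1 * (8 * eval ms n + 21))).+1 +
   30 * eval ms n + 31)%N.

Definition usable (st : state) (n : nat) (l : seq nat) : Prop :=
  uniq l /\ forall r, r \in l -> [/\ r != 0%N, r != counter & ruler st r n].

Lemma prints_num ms st n :
  (forall z, con st counter z = None) ->
  (forall m, m \in ms -> usable st n m.2) ->
  prints (num ms) st (num_time ms n) (nat_code (eval ms n)).
Proof.
move=> bl us w0.
set V := eval ms n; pose A v := ctr (bin v) 0 (out w0 st).
(* The monomials are added one after another; no intermediate value exceeds [V], so one time bound
   serves for all increments. *)
suff H v ms' : {subset ms' <= ms} -> (v + eval ms' n <= V)%N ->
    does (seqs [seq nest m.2 (rep m.1 counter_incr) | m <- ms']) (A v)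
      (\sum_(m <- ms') (nest_time n (size m.2) (m.1 * (8 * V + 21))).+1)
      (A (v + eval ms' n)%N).
  have bl' w z : con (out w st) counter z = None by rewrite con_out bl.
  have := does_sq (H 0%N ms (fun _ => id) (leqnn _)) (does_counter_print _ _).
  rewrite {1}/A (ctr_nil (bl' w0)); apply: does_conv.
    rewrite /num_time -/V add0n -addnS -[leqRHS]addnA leq_add2l.
    by have := size_bin V; lia.
  rewrite add0n -/V /nat_code nat_digits_bin -/(digit_code _) [RHS]out_cat ctr_nil // => z.
  by rewrite -out_cat bl'.
elim: ms' v => [|m ms' IH] v sub le.
  by rewrite /eval !big_nil addn0; exact: does_skip.
move: le; rewrite /eval !big_cons -/(eval ms' n) addnA => le.
have [um rm] := us m (sub m (mem_head _ _)).
have E : (v + m.1 * n ^ size m.2)%N = (v + m.1 * n ^ size m.2)%N by [].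
have sub' : {subset ms' <= ms} by move=> x xm; apply: sub; rewrite inE xm orbT.
rewrite addSn; apply: (does_sq _ (IH _ sub' le)) => {IH}.
have := @does_nest m.2 (rep m.1 counter_incr) (fun j => A (v + m.1 * j)%N) n
  (m.1 * (8 * V + 21)) um.
rewrite muln0 addn0; apply=> [j r rl|j u jn Hu].
  by have [r0 rc rul] := rm r rl; apply: ruler_ctr => //; exact: ruler_out.
have uc : u counter = 0 by apply: Hu; apply/negP => /rm[]; rewrite eqxx.
have := @does_rep m.1 counter_incr (fun i => off u (A (v + m.1 * j + i)%N)) (8 * V + 20).
rewrite addn0 (_ : v + m.1 * j.+1 = v + m.1 * j + m.1)%N; last by rewrite mulnS; lia.
rewrite -addnS; apply=> i im; rewrite /A !off_ctr // (addnS _ i).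
apply: does_leq (does_counter_incr _ _).
have := size_bin (v + m.1 * j + i); suff : (v + m.1 * j + i <= V)%N by lia.
have : (m.1 * j.+1 <= m.1 * n ^ size m.2)%N by rewrite leq_mul2l jn orbT.
move=> h; apply: leq_trans (leq_trans (leq_addr (eval ms' n) _) le).
rewrite -addnA leq_add2l; apply: leq_trans h.
by rewrite mulnS addnC leq_add2r ltnW.
Qed.

(** * The tableau of a computation *)

Lemma isSome_bits (w : bits) j : isSome (nth None [seq Some b | b <- w] j) = (j < size w)%N.
Proof. by elim: w j => [|b w IH] [|j] //=; rewrite IH. Qed.

Section Tableau.
Variable M : turing_machine.
Notation I := 'I_(tm_tapes M).+1.

(* A square of the tableau records the control state and the scanned symbols of
   its whole row, for each tape whether the head is here and which symbol is
   here, a symbol of the certificate, and whether this is the home column. *)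
Definition square : finType :=
  (tm_state M * {ffun I -> cell} * {ffun I -> bool} * {ffun I -> cell} * cell * bool)%type.

Definition sq_state (g : square) : tm_state M := g.1.1.1.1.1.
Definition sq_scan (g : square) : {ffun I -> cell} := g.1.1.1.1.2.
Definition sq_head (g : square) : {ffun I -> bool} := g.1.1.1.2.
Definition sq_sym (g : square) : {ffun I -> cell} := g.1.1.2.
Definition sq_cert (g : square) : cell := g.1.2.
Definition sq_home (g : square) : bool := g.2.

(** A halted configuration is repeated, so that the rows after halting obey the same rules. *)
Definition next (q : tm_state M) (s : {ffun I -> cell}) : tm_state M * (I -> cell * direction) :=
  if tm_halting q then (q, fun i => (s i, Stay)) else tm_trans q s.

Definition sq_next (g : square) := next (sq_state g) (sq_scan g).

(* The flags say whether the second square is in the same row as the first, in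
   the next row, in the same column, in the next column, in the previous one. *)
Definition pair_ok (et st ep sp pp : bool) (g g' : square) : bool :=
  [&& (et && ep) ==> (g == g'),
      et ==> (sq_state g == sq_state g') && (sq_scan g == sq_scan g'),
      (et && ~~ ep) ==> [forall i, ~~ (sq_head g i && sq_head g' i)],
      (et && sp) ==> isSome (sq_cert g') ==> (isSome (sq_cert g) || sq_home g'),
      st ==> (sq_state g' == (sq_next g).1),
      (st && ep) ==> [forall i, sq_sym g' i ==
         (if sq_head g i then ((sq_next g).2 i).1 else sq_sym g i)] &
      st ==> [forall i, (sq_head g i &&
         match ((sq_next g).2 i).2 with MoveLeft => pp | Stay => ep | MoveRight => sp end)
           ==> sq_head g' i]].

(** The arguments describe the position: first row, input symbol, room for the certificate, home
    column. Acceptance is imposed on every row with a halting state, which must scan [true] on the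
    output tape. *)
Definition square_ok (z : bool) (xc : cell) (yc oc : bool) (g : square) : bool :=
  [&& [forall i, sq_head g i ==> (sq_sym g i == sq_scan g i)],
      tm_halting (sq_state g) ==> (sq_scan g ord0 == Some true),
      sq_home g == oc,
      isSome (sq_cert g) ==> yc &
      z ==> [&& sq_state g == tm_start M, [forall i, sq_head g i == oc] &
        [forall i : I, sq_sym g i ==
           (if val i == 0%N then xc else if val i == 1%N then sq_cert g else None)]]].

Variables x y : bits.

(** Configurations with absolute positions, because the columns of the tableau stay fixed while the
    tapes of [tm_config] move with the heads. *)
Fixpoint run (t : nat) : tm_state M * (I -> int) * (I -> int -> cell) :=
  if t is t.+1 then
    let: (q, p, c) := run t in
    let: (q', act) := next q [ffun i => c i (p i)] in
    (q', fun i => p i + shift (act i).2, fun i z => if z == p i then (act i).1 else c i z)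
  else (tm_start M, fun _ => 0, fun i : I => tape_at (tape_of_bits (nth [::] [:: x; y] i))).

Definition run_state t := (run t).1.1.
Definition run_pos t := (run t).1.2.
Definition run_con t := (run t).2.
Definition run_scan t : {ffun I -> cell} := [ffun i => run_con t i (run_pos t i)].
Definition run_next t := next (run_state t) (run_scan t).

Lemma run_stateS t : run_state t.+1 = (run_next t).1.
Proof.
rewrite /run_next /run_scan /run_state /run_con /run_pos /=.
by case: (run t) => [[q p] c] /=; case: next.
Qed.

Lemma run_posS t i : run_pos t.+1 i = run_pos t i + shift ((run_next t).2 i).2.
Proof.
rewrite /run_next /run_scan /run_state /run_con /run_pos /=.
by case: (run t) => [[q p] c] /=; case: next.
Qed.

Lemma run_conS t i z :
  run_con t.+1 i z = if z == run_pos t i then ((run_next t).2 i).1 else run_con t i z.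
Proof.
rewrite /run_next /run_scan /run_state /run_con /run_pos /=.
by case: (run t) => [[q p] c] /=; case: next.
Qed.

Lemma run_pos_bound t i : `|run_pos t i| <= t%:Z.
Proof.
elim: t => [|t IH]; first by rewrite /run_pos /= normr0.
rewrite run_posS; case: (_.2 i).2 => /=; lia.
Qed.

Definition conf t := iter t (@tm_step M) (tm_init M [:: x; y]).

Lemma conf_run t : (conf t).1 = run_state t /\
  forall i z, tape_at ((conf t).2 i) z = run_con t i (run_pos t i + z).
Proof.
elim: t => [|t [E1 E2]]; first by split=> // i z; rewrite /= add0r.
have Es : [ffun i => tape_head ((conf t).2 i)] = run_scan t.
  by apply/ffunP => i; rewrite !ffunE; have := E2 i 0; rewrite addr0.
have EN : conf t.+1 = ((run_next t).1,
    fun i => move_tape ((run_next t).2 i).2 (write_tape ((run_next t).2 i).1 ((conf t).2 i))).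
  rewrite /conf iterS -/(conf t) /tm_step /run_next /next -Es E1.
  case: ifP => h; last by case: tm_trans.
  rewrite -E1; case: (conf t) => q ts /=; congr pair.
  by apply/funext => i; rewrite ffunE; case: (ts i).
rewrite EN run_stateS; split=> // i z.
rewrite tape_at_move tape_at_write E2 run_conS run_posS.
rewrite -addrA [shift _ + z]addrC.
by rewrite -[in RHS]subr_eq0 [_ - run_pos t i]addrAC subrr add0r.
Qed.

Lemma scan_conf t : run_scan t ord0 = tape_head ((conf t).2 ord0).
Proof. by rewrite ffunE; have [_ /(_ ord0 0)] := conf_run t; rewrite addr0. Qed.

Lemma output_scan t b : bits_of_tape ((conf t).2 ord0) = [:: b] -> run_scan t ord0 = Some b.
Proof. by rewrite scan_conf /bits_of_tape /=; case: tape_head => //= c [->]. Qed.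

Lemma output_unique t t' b : tm_halting (conf t).1 ->
  tm_halting (conf t').1 -> bits_of_tape ((conf t').2 ord0) = [:: b] ->
  run_scan t ord0 = Some b.
Proof.
move=> h h' ob; apply: output_scan.
have [le|le] := leqP t t'.
  by move: ob; rewrite /conf -(subnK le) iterD tm_step_halting.
by rewrite /conf -(subnK (ltnW le)) iterD tm_step_halting.
Qed.

Variable H : nat.
Notation W := (H + H)%N.

Definition run_square (t p : nat) : square :=
  (run_state t, run_scan t, [ffun i => run_pos t i == p%:Z - H%:Z],
   [ffun i => run_con t i (p%:Z - H%:Z)], tape_at (tape_of_bits y) (p%:Z - H%:Z), p == H).

Lemma run_pair_ok t p t' p' :
  pair_ok (t == t') (t' == t.+1) (p == p') (p' == p.+1) (p == p'.+1)
    (run_square t p) (run_square t' p').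
Proof.
apply/and5P; split; [| | | | apply/and3P; split]; apply/implyP.
- by move=> /andP[/eqP <- /eqP <-].
- by move=> /eqP <-; rewrite !eqxx.
- move=> /andP[/eqP <- pp]; apply/forallP => i; rewrite !ffunE.
  by apply: contraNN pp => /andP[/eqP -> /eqP]; lia.
- move=> /andP[_ /eqP ->]; rewrite /sq_cert /sq_home /=; apply/implyP.
  rewrite !tape_at_of_bits; have [->|pH] /= := eqVneq p.+1 H; first by rewrite orbT.
  rewrite orbF; case E: (p.+1%:Z - H%:Z) => [j|//] h.
  have [k kE] : exists k, j = k.+1 by exists j.-1; lia.
  rewrite (_ : p%:Z - H%:Z = Posz k); last by lia.
  by move: h; rewrite kE !isSome_bits => /ltnW.
- by move=> /eqP ->; rewrite /sq_state /= run_stateS.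
- move=> /andP[/eqP -> /eqP <-]; apply/forallP => i.
  by rewrite !ffunE run_conS [run_pos t i == _]eq_sym.
- move=> /eqP ->; apply/forallP => i; rewrite !ffunE run_posS.
  apply/implyP => /andP[/eqP -> ]; rewrite -/(run_next t).
  by case: (_.2 i).2 => /= /eqP; lia.
Qed.

Definition column_input (p : nat) : cell := tape_at (tape_of_bits x) (p%:Z - H%:Z).
Definition column_cert (B p : nat) : bool := 0 <= p%:Z - H%:Z < B%:Z.

Lemma run_square_ok B T t p : (size y <= B)%N ->
  tm_halting (conf T).1 -> bits_of_tape ((conf T).2 ord0) = [:: true] ->
  square_ok (t == 0)%N (column_input p) (column_cert B p) (p == H) (run_square t p).
Proof.
move=> yB hT oT; apply/and5P; split.
- by apply/forallP => i; rewrite !ffunE; apply/implyP => /eqP ->.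
- apply/implyP => h; apply/eqP; apply: (output_unique _ hT oT).
  by have [-> _] := conf_run t.
- by [].
- apply/implyP; rewrite /sq_cert /= tape_at_of_bits /column_cert.
  case: (_ - _) => [j|//] h /=.
  by move: h; rewrite isSome_bits; lia.
- apply/implyP => /eqP ->; apply/and3P; split=> //.
    by apply/forallP => i; rewrite ffunE /run_pos /=; lia.
  apply/forallP => i; rewrite ffunE /run_con /=.
  case: i => -[|[|i]] //= _; rewrite nth_nil tape_at_of_bits.
  by case: (_ - _) => // j; rewrite nth_nil.
Qed.

End Tableau.

Lemma leading_bits_nth s :
  (forall j, isSome (nth None s j.+1) -> isSome (nth None s j)) ->
  forall j, nth None [seq Some b | b <- leading_bits s] j = nth None s j.
Proof.
elim: s => [|[b|] s IH] Hs j //=.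
  by case: j => [|j] //=; apply: IH => k; exact: (Hs k.+1).
rewrite nth_nil; case: j => [|j] //=.
have : forall k, ~~ isSome (nth None s k).
  elim=> [|k IHk]; first by apply/negP => /(Hs 0%N).
  by apply: contraNN IHk => /(Hs k.+1).
by move=> /(_ j); case: nth.
Qed.

(** The first row determines a certificate [y], and the local conditions force each row t < H to be
    the configuration on [y] after t steps. Within that time no head leaves the 2 H columns. *)
Lemma tableau_sound (M : turing_machine) (x : bits) (V : bits -> bool) (H B T : nat)
    (F : nat -> nat -> square M) :
  (T < H)%N ->
  (forall y, (size y <= B)%N ->
     tm_halting (conf M x y T).1 /\ bits_of_tape ((conf M x y T).2 ord0) = [:: V y]) ->
  (forall t p, (t < H + H)%N -> (p < H + H)%N ->
     square_ok (t == 0)%N (column_input x H p) (column_cert H B p) (p == H) (F t p)) ->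
  (forall t p t' p', (t < H + H)%N -> (p < H + H)%N -> (t' < H + H)%N -> (p' < H + H)%N ->
     pair_ok (t == t') (t' == t.+1) (p == p') (p' == p.+1) (p == p'.+1) (F t p) (F t' p')) ->
  exists y, (size y <= B)%N /\ V y.
Proof.
move=> TH HV sqok prok.
(* The certificate is read from the home column to the right. *)
pose s := [seq sq_cert (F 0%N (H + j)%N) | j <- iota 0 H].
have s_nth j : (j < H)%N -> nth None s j = sq_cert (F 0%N (H + j)%N).
  by move=> jH; rewrite (nth_map 0%N) ?size_iota // nth_iota.
have s_some j : isSome (nth None s j) -> (j < H)%N.
  by rewrite ltnNge; apply: contraTN => h; rewrite nth_default // size_map size_iota.
pose y := leading_bits s.
(* In the first row only the home column may carry a certificate symbol to the right of a blank, so
   there are no gaps and [leading_bits] loses nothing. *)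
have yE : forall j, nth None [seq Some b | b <- y] j = nth None s j.
  apply: leading_bits_nth => j h; have jH := s_some _ h.
  move: h; rewrite !s_nth //; last by lia.
  have /and5P[_ _ _ + _] := prok 0%N (H + j)%N 0%N (H + j.+1)%N
    ltac:(lia) ltac:(lia) ltac:(lia) ltac:(lia).
  rewrite !eqxx addnS eqxx /= => /implyP h /h /orP[//|].
  have /and5P[_ _ /eqP -> _ _] := sqok 0%N (H + j).+1 ltac:(lia) ltac:(lia).
  by move=> /eqP; lia.
have certE p : (p < H + H)%N -> isSome (sq_cert (F 0%N p)) -> 0 <= p%:Z - H%:Z < B%:Z.
  by move=> pW h; have /and5P[_ _ _ /implyP/(_ h)] := sqok 0%N p ltac:(lia) pW.
have yB : (size y <= B)%N.
  rewrite leqNgt; apply/negP => By.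
  have : isSome (nth None s B) by rewrite -yE isSome_bits.
  move=> h; have BH := s_some _ h; move: h; rewrite s_nth // => /certE.
  by lia.
exists y; split=> //; have [hT oT] := HV y yB.
have cert0 p : (p < H + H)%N -> sq_cert (F 0%N p) = tape_at (tape_of_bits y) (p%:Z - H%:Z).
  move=> pW; rewrite tape_at_of_bits; have [Hp|pH] := leqP H p.
    have [j pE] : exists j, p = (H + j)%N by exists (p - H)%N; lia.
    rewrite (_ : p%:Z - H%:Z = j%:Z); last by lia.
    by rewrite yE s_nth; [rewrite pE | lia].
  have /negPf : ~~ isSome (sq_cert (F 0%N p)).
    by apply/negP => /(certE p pW); lia.
  case E : (p%:Z - H%:Z) => [j|j]; first by lia.
  by case: sq_cert.
pose row t := forall p, (p < H + H)%N ->
  [/\ sq_state (F t p) = run_state M x y t,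
      forall i, sq_head (F t p) i = (run_pos x y t i == p%:Z - H%:Z) &
      forall i, sq_sym (F t p) i = run_con x y t i (p%:Z - H%:Z)].
have home t (i : 'I_(tm_tapes M).+1) : (t < H)%N -> exists2 p, (p < H + H)%N & p%:Z - H%:Z = run_pos x y t i.
  move=> tH; have := @run_pos_bound M x y t i.
  by exists (absz (run_pos x y t i + H%:Z)); lia.
(* The square under a head knows the scanned symbol, and all squares of a row record the same
   scan. *)
have scanE t p : (t < H)%N -> (p < H + H)%N -> row t -> sq_scan (F t p) = run_scan M x y t.
  move=> tH pW rt; apply/ffunP => i; rewrite ffunE.
  have [p' p'W p'E] := home t i tH.
  have [_ hd sy] := rt p' p'W.
  have /and5P[/forallP/(_ i) + _ _ _ _] := sqok t p' ltac:(lia) p'W.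
  rewrite hd p'E eqxx sy p'E /= => /eqP ->.
  have /and5P[_ + _ _ _] := prok t p t p' ltac:(lia) pW ltac:(lia) p'W.
  by rewrite eqxx /= => /andP[_ /eqP ->].
have rows t : (t < H)%N -> row t.
  elim: t => [|t IH] tH p pW.
    have /and5P[_ _ _ _] := sqok 0%N p ltac:(lia) pW.
    rewrite eqxx /= => /and3P[/eqP -> /forallP hd /forallP sy].
    split=> // i; first by rewrite (eqP (hd i)) /run_pos /=; lia.
    rewrite (eqP (sy i)) /run_con /= cert0 //.
    case: i => -[|[|i]] //= _; rewrite nth_nil tape_at_of_bits.
    by case: (_ - _) => // j; rewrite nth_nil.
  have rt := IH (ltnW tH).
  have nextE p0 : (p0 < H + H)%N -> sq_next (F t p0) = run_next M x y t.
    move=> p0W; have [st _ _] := rt p0 p0W.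
    by rewrite /sq_next st scanE // ltnW.
  have hd_next (i : 'I_(tm_tapes M).+1) p1 p2 : (p1 < H + H)%N -> (p2 < H + H)%N ->
      p1%:Z - H%:Z = run_pos x y t i -> p2%:Z - H%:Z = run_pos x y t.+1 i ->
      sq_head (F t.+1 p2) i.
    move=> p1W p2W p1E; rewrite run_posS -p1E => p2E.
    have [_ hd _] := rt p1 p1W.
    have /and5P[_ _ _ _ /and3P[_ _]] := prok t p1 t.+1 p2 ltac:(lia) p1W ltac:(lia) p2W.
    rewrite eqxx /= => /forallP/(_ i); rewrite hd p1E eqxx nextE //=.
    move: p2E; case: (_.2 i).2 => /= p2E /implyP; apply; apply/eqP; lia.
  split.
  - have /and5P[_ _ _ _ /and3P[+ _ _]] := prok t p t.+1 p ltac:(lia) pW ltac:(lia) pW.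
    by rewrite eqxx /= nextE // run_stateS => /eqP.
  - move=> i; have [p1 p1W p1E] := home t i (ltnW tH).
    have [p2 p2W p2E] := home t.+1 i tH.
    have h2 := hd_next i p1 p2 p1W p2W p1E p2E.
    (* The move condition puts the head at [p2]; two squares of a row never carry the head of the
       same tape, so it is nowhere else. *)
    have [<-|ne] := eqVneq p2 p; first by rewrite h2 p2E eqxx.
    have /and5P[_ _ + _ _] := prok t.+1 p2 t.+1 p ltac:(lia) p2W ltac:(lia) pW.
    rewrite eqxx ne /= => /forallP/(_ i); rewrite h2 /= => /negPf ->.
    by apply/esym/negP => /eqP; rewrite -p2E; move: ne => /eqP; lia.
  - move=> i; have [_ hd sy] := rt p pW.
    have /and5P[_ _ _ _ /and3P[_ + _]] := prok t p t.+1 p ltac:(lia) pW ltac:(lia) pW.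
    rewrite !eqxx /= => /forallP/(_ i)/eqP ->.
    by rewrite hd sy nextE // run_conS eq_sym.
(* Any square of row T will do, as all record the halting state and the scan; acceptance then makes
   the output of the verifier [true]. *)
have [st _ _] := rows T TH 0%N ltac:(lia).
have /and5P[_ + _ _ _] := sqok T 0%N ltac:(lia) ltac:(lia).
rewrite scanE //; [|by lia|exact: rows].
rewrite st -(conf_run M x y T).1 hT /=.
by rewrite (output_unique hT hT oT) => /eqP[->].
Qed.

(** * The conflict graph of a tableau *)

Section ConflictGraph.
Variables (M : turing_machine) (H : nat).
Notation W := (H + H)%N.

Definition vertex : finType := (('I_W * 'I_W) * (bool * square M))%type.

(* Vertices carrying [false] are the candidate squares; those carrying [true]
   are dummies that make every candidate have the same degree. The flags are
   those of [pair_ok], with [pt] for the previous row. *)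
Definition link (et st pt ep sp pp : bool) (a a' : bool * square M) : bool :=
  let ok := pair_ok et st ep sp pp a.2 a'.2 && pair_ok et pt ep pp sp a'.2 a.2 in
  match a.1, a'.1 with
  | false, false => ~~ ok
  | true, true => ~~ [&& et, ep & a.2 == a'.2]
  | _, _ => ok
  end.

Definition link_at (t p t' p' : nat) : bool * square M -> bool * square M -> bool :=
  link (t == t') (t' == t.+1) (t == t'.+1) (p == p') (p' == p.+1) (p == p'.+1).

Definition vlink (u v : vertex) : bool := link_at u.1.1 u.1.2 v.1.1 v.1.2 u.2 v.2.

Lemma linkC et st pt ep sp pp a a' :
  link et st pt ep sp pp a a' = link et pt st ep pp sp a' a.
Proof.
case: a a' => [b g] [b' g']; rewrite /link /=.
by case: b; case: b'; rewrite ?(eq_sym g) // andbC.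
Qed.

Lemma vlink_sym : symmetric vlink.
Proof.
move=> u v; rewrite /vlink /link_at linkC.
by rewrite (eq_sym (val u.1.1) (val v.1.1)) (eq_sym (val u.1.2) (val v.1.2)).
Qed.

(** A candidate is therefore not joined to itself, but is joined to its own twin. *)
Lemma pair_ok_refl (g : square M) : pair_ok true false true false false g g.
Proof. by rewrite /pair_ok /= !eqxx. Qed.

Lemma gtn_eqS n : (n == n.+1) = false.
Proof. by apply/negbTE; rewrite neq_ltn ltnSn. Qed.

Definition flip (u : vertex) : vertex := (u.1, (~~ u.2.1, u.2.2)).

Lemma flipK : involutive flip.
Proof. by case=> tp [b g]; rewrite /flip /= negbK. Qed.

Lemma vlink_irr : irreflexive vlink.
Proof.
case=> [[t p] [b g]]; rewrite /vlink /link_at /link /= !eqxx !gtn_eqS pair_ok_refl.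
by case: b.
Qed.

Lemma vlink_flip_self u : vlink u (flip u).
Proof.
case: u => [[t p] [b g]]; rewrite /vlink /link_at /link /= !eqxx !gtn_eqS pair_ok_refl.
by case: b.
Qed.

Lemma vlink_flip (u v : vertex) : ~~ u.2.1 -> vlink u (flip v) = ~~ vlink u v.
Proof.
case: u v => [[t p] [[] g]] [[t' p'] [b' g']] //= _.
by rewrite /vlink /link_at /link /=; case: b' => //=; rewrite negbK.
Qed.

(** The clique of the dummies makes the graph connected: every candidate reaches it through its
    twin. *)
Lemma vlink_top (u v : vertex) : u.2.1 -> v.2.1 -> u != v -> vlink u v.
Proof.
case: u v => [[t p] [[] g]] [[t' p'] [[] g']] //= _ _; apply: contraNT.
rewrite /vlink /link_at /link /= negbK => /and3P[/eqP tt /eqP pp /eqP ->].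
by rewrite (val_inj tt) (val_inj pp).
Qed.

Definition graph : 'M[bool]_#|vertex| := \matrix_(i, j) vlink (enum_val i) (enum_val j).

Lemma graph_sym : symmetric graph.
Proof. by move=> i j; rewrite !mxE vlink_sym. Qed.

Lemma graph_irr : irreflexive graph.
Proof. by move=> i; rewrite !mxE vlink_irr. Qed.

Lemma graph_rank u v : graph (enum_rank u) (enum_rank v) = vlink u v.
Proof. by rewrite mxE !enum_rankK. Qed.

Lemma graph_conn i j : connect graph i j.
Proof.
rewrite -(enum_valK i) -(enum_valK j).
move: (enum_val i) (enum_val j) => {i j} u v.
pose top (w : vertex) : vertex := (w.1, (true, w.2.2)).
have ctop w : connect graph (enum_rank w) (enum_rank (top w)).
  case: w => [tp [[] g]]; first exact: connect0.
  by apply: connect1; rewrite graph_rank; exact: (vlink_flip_self (tp, (false, g))).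
have ctop' w : connect graph (enum_rank (top w)) (enum_rank w).
  by rewrite (sym_connect_sym graph_sym).
apply: connect_trans (ctop u) (connect_trans _ (ctop' v)).
have [->|uv] := eqVneq (top u) (top v); first exact: connect0.
by apply: connect1; rewrite graph_rank vlink_top.
Qed.

(** The involution [flip] exchanges the neighbours and the non-neighbours of a candidate. *)
Lemma graph_degree i : ~~ (enum_val i).2.1 -> (degree graph i * 2)%N = #|vertex|.
Proof.
move=> ui; pose P := [pred v | vlink (enum_val i) v].
have -> : degree graph i = #|P|.
  rewrite degreeE -(fintype.card_image (@enum_rank_inj vertex) P).
  apply: eq_card => j; rewrite -(enum_valK j) (fintype.mem_image (@enum_rank_inj vertex)) !inE.
  by rewrite mxE enum_rankK.
rewrite muln2 -addnn -(cardC P); congr (_ + _)%N.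
rewrite -(fintype.card_image (inv_inj flipK)) -[RHS](fintype.card_image (inv_inj flipK)).
rewrite fintype.card_image; last exact: inv_inj flipK.
apply: eq_card => v; rewrite -(flipK v) (fintype.mem_image (inv_inj flipK)) !inE.
by rewrite vlink_flip // negbK.
Qed.

Variables (x : bits) (B : nat).

Definition candidate (t p : nat) (a : bool * square M) : bool :=
  ~~ a.1 && square_ok (t == 0)%N (column_input x H p) (column_cert H B p) (p == H) a.2.

Definition vgood (u : vertex) : bool := candidate u.1.1 u.1.2 u.2.

Definition graph_good (i : 'I_#|vertex|) : bool := vgood (enum_val i).

Variables (V : bits -> bool) (T : nat).
Hypothesis TH : (T < H)%N.
Hypothesis HV : forall y, (size y <= B)%N ->
  tm_halting (conf M x y T).1 /\ bits_of_tape ((conf M x y T).2 ord0) = [:: V y].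

(** Different contents of the same position are incompatible, so independent candidates have
    distinct positions, and W W of them fill every position exactly once. *)
Lemma conflict_graphP :
  (exists y, (size y <= B)%N /\ V y) <->
  exists S : {set 'I_#|vertex|}, [/\ forall i, i \in S -> graph_good i,
    #|S| = (W * W)%N & {in S &, forall i j, ~~ graph i j}].
Proof.
split=> [[y [yB Vy]]|[S [gS cardS indep]]].
  pose f (tp : 'I_W * 'I_W) : vertex := (tp, (false, run_square M x y H tp.1 tp.2)).
  pose S := (fun tp => enum_rank (f tp)) @: [set: 'I_W * 'I_W].
  have [hT] := HV yB; rewrite Vy => oT.
  exists S; split.
  - move=> _ /imsetP[[t p] _ ->]; rewrite /graph_good enum_rankK /vgood /candidate /=.
    exact: run_square_ok yB hT oT.
  - rewrite card_imset ?cardsT ?card_prod ?card_ord //.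
    by move=> tp tp' /enum_rank_inj[->].
  - move=> _ _ /imsetP[[t p] _ ->] /imsetP[[t' p'] _ ->]; rewrite graph_rank.
    rewrite /vlink /link_at /link /= negbK run_pair_ok.
    by rewrite (eq_sym (val t)) (eq_sym (val p)) run_pair_ok.
have notop i : i \in S -> (enum_val i).2.1 = false.
  by move=> /gS /andP[/negbTE].
have okS i j : i \in S -> j \in S ->
    pair_ok ((enum_val i).1.1 == (enum_val j).1.1 :> nat) ((enum_val j).1.1 == (enum_val i).1.1.+1 :> nat)
      ((enum_val i).1.2 == (enum_val j).1.2 :> nat) ((enum_val j).1.2 == (enum_val i).1.2.+1 :> nat)
      ((enum_val i).1.2 == (enum_val j).1.2.+1 :> nat) (enum_val i).2.2 (enum_val j).2.2.
  move=> iS jS; have := indep i j iS jS.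
  by rewrite mxE /vlink /link_at /link !notop // negbK => /andP[].
pose loc (i : 'I_#|vertex|) := (enum_val i).1.
have loc_inj : {in S &, injective loc}.
  move=> i j iS jS ij; apply: enum_val_inj.
  have := okS i j iS jS; have := notop i iS; have := notop j jS.
  move: ij; rewrite /loc; case: (enum_val i) (enum_val j) => [tp [b g]] [tp' [b' g']] /= -> -> ->.
  by rewrite !eqxx => /andP[/eqP ->].
have loc_surj tp : exists2 i, i \in S & loc i = tp.
  have : loc @: S = [set: 'I_W * 'I_W].
    by apply/eqP; rewrite eqEcard finset.subsetT cardsT card_prod card_ord card_in_imset // cardS leqnn.
  by move=> /finset.setP/(_ tp); rewrite inE => /imsetP[i iS ->]; exists i.
(* A default for positions outside the tableau; inside, [F] never takes it. *)
pose g0 : square M := (tm_start M, [ffun => None], [ffun => false], [ffun => None], None, false).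
pose F (t p : nat) : square M :=
  if [pick i in S | ((enum_val i).1.1 == t :> nat) && ((enum_val i).1.2 == p :> nat)] is Some i
  then (enum_val i).2.2 else g0.
have FP t p : (t < W)%N -> (p < W)%N -> exists2 i, i \in S &
    [/\ (enum_val i).1.1 = t :> nat, (enum_val i).1.2 = p :> nat & (enum_val i).2.2 = F t p].
  move=> tW pW; rewrite /F; case: pickP => [i /and3P[iS /eqP ti /eqP pi]|none]; first by exists i.
  have [i iS iE] := loc_surj (Ordinal tW, Ordinal pW).
  by have := none i; rewrite iS -/(loc i) iE /= !eqxx.
apply: (tableau_sound TH HV (F := F)) => [t p tW pW|t p t' p' tW pW t'W p'W].
  have [i iS [ti pi <-]] := FP t p tW pW.
  by have := gS i iS; rewrite /graph_good /vgood /candidate ti pi => /andP[_].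
have [i iS [ti pi <-]] := FP t p tW pW; have [j jS [tj pj <-]] := FP t' p' t'W p'W.
by have := okS i j iS jS; rewrite ti pi tj pj.
Qed.

End ConflictGraph.

(** * The code of an instance *)

Lemma enum_prodE (T1 T2 : finType) :
  enum {: T1 * T2} = [seq (a, b) | a <- enum T1, b <- enum T2].
Proof. by rewrite [LHS]enumT {1}[Finite.enum]unlock. Qed.

Lemma map_enum_val (T : finType) : [seq enum_val i | i <- enum 'I_#|T|] = enum T.
Proof.
have [c0|T0] := posnP #|T|.
  rewrite (size0nil (_ : size (enum T) = 0%N)) -?cardE //.
  by apply: size0nil; rewrite size_map -cardE card_ord.
have x0 : T := enum_val (Ordinal T0).
apply: (@eq_from_nth _ x0) => [|i]; first by rewrite size_map -!cardE card_ord.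
rewrite size_map -cardE card_ord => iT.
rewrite (nth_map (Ordinal iT)) -?cardE ?card_ord // (enum_val_nth x0).
by rewrite nth_enum_ord.
Qed.

Lemma flatten_allpairs (A B C : Type) (f : A -> B -> seq C) (s : seq A) (t : seq B) :
  flatten [seq f a b | a <- s, b <- t] = flatten [seq flatten [seq f a b | b <- t] | a <- s].
Proof. by elim: s => //= a s IH; rewrite flatten_cat IH. Qed.

Lemma flatten_map_flatten (A B C : Type) (f : A -> seq B) (g : seq B -> seq C) (s : seq A) :
  (forall u v, g (u ++ v) = g u ++ g v) -> g [::] = [::] ->
  g (flatten [seq f a | a <- s]) = flatten [seq g (f a) | a <- s].
Proof. by move=> gD g0; elim: s => //= a s IH; rewrite gD IH. Qed.

Lemma flatten_enum_ord (C : Type) (W : nat) (f : nat -> seq C) :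
  flatten [seq f (val i) | i <- enum 'I_W] = flatten [seq f i | i <- iota 0 W].
Proof. by rewrite -val_enum_ord -map_comp. Qed.

(** The enumeration of the vertices is nested by row, column and content, the order in which the
    loops of the machine visit them. *)
Lemma flatten_vertex (C : Type) (M : turing_machine) (H : nat) (f : vertex M H -> seq C)
    (g : nat -> nat -> bool * square M -> seq C) :
  (forall u : vertex M H, f u = g u.1.1 u.1.2 u.2) ->
  flatten [seq f u | u <- enum (vertex M H)] =
  flatten [seq flatten [seq flatten [seq g t p a | a <- enum {: bool * square M}]
    | p <- iota 0 (H + H)] | t <- iota 0 (H + H)].
Proof.
move=> fg.
have step (A B : finType) (h : A * B -> seq C) : flatten [seq h ab | ab <- enum {: A * B}] =
    flatten [seq flatten [seq h (a, b) | b <- enum B] | a <- enum A].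
  by rewrite enum_prodE map_allpairs flatten_allpairs.
rewrite step step -flatten_enum_ord.
congr flatten; apply: eq_map => t.
rewrite -flatten_enum_ord.
by congr flatten; apply: eq_map => p; congr flatten; apply: eq_map => a; rewrite fg.
Qed.

Lemma ints_code_cat s t : ints_code (s ++ t) = ints_code s ++ ints_code t.
Proof. by rewrite /ints_code map_cat flatten_cat. Qed.

Definition icode (n : nat) : bits := int_code n%:Z.

(** Rationals are coded in lowest terms, so the machine can print a fraction directly only if it is
    already reduced. *)
Lemma rat_data_frac (a b : nat) : (0 < b)%N -> coprime a b ->
  rat_data (a%:R / b%:R) = [:: a%:Z; b%:Z].
Proof.
move=> b0 ab; rewrite /rat_data.
have -> : (a%:R / b%:R : rat) = a%:Z%:~R / b%:Z%:~R by rewrite -!pmulrn.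
rewrite coprimeq_num // coprimeq_den //.
by rewrite gtr0_sg ?mul1r // gt_eqF ?gtr0_norm.
Qed.

Lemma rat_data_nat (a : nat) : rat_data a%:R = [:: a%:Z; 1].
Proof. by rewrite -[a%:R]divr1 (rat_data_frac _ (coprimen1 a)). Qed.

Lemma rat_data_int (z : int) : rat_data z%:~R = [:: z; 1].
Proof. by rewrite /rat_data numq_int denq_int. Qed.

Section Instance.
Variables (M : turing_machine) (H : nat) (x : bits) (B : nat).
Notation W := (H + H)%N.
Hypothesis H0 : (0 < H)%N.

Definition volume : nat := #|{: square M}|.
Definition n_agents : nat := #|vertex M H|.
(* The attack [numer / den] is such that, with [tc = 1 / scale],
   [tc * theta = 1 + 3 / 4 * tc + tc / (2 * n_agents * W ^ 2)]. *)
Definition den : nat := (4 * volume * W ^ 4)%N.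
Definition scale : nat := (400 * volume ^ 2 * W ^ 4)%N.
Definition numer : nat := (1600 * volume ^ 3 * W ^ 8 + 3 * volume * W ^ 4 + 1)%N.

Lemma volume_gt0 : (0 < volume)%N.
Proof.
by apply/card_gt0P; exists (tm_start M, [ffun => None], [ffun => false], [ffun => None], None, false).
Qed.

Lemma n_agentsE : n_agents = (2 * volume * W ^ 2)%N.
Proof.
have -> : n_agents = (#|{: 'I_W * 'I_W}| * #|{: bool * square M}|)%N by exact: card_prod.
have -> : #|{: bool * square M}| = (2 * volume)%N by rewrite -card_bool; exact: card_prod.
by rewrite card_prod !card_ord; ring.
Qed.

Lemma scaleE : scale = (100 * n_agents ^ 2)%N.
Proof. by rewrite n_agentsE /scale; ring. Qed.

Lemma denE : den = (2 * n_agents * (W * W))%N.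
Proof. by rewrite n_agentsE /den; ring. Qed.

Lemma numerE : numer = (den * scale + 3 * volume * W ^ 4 + 1)%N.
Proof. by rewrite /den /scale /numer; ring. Qed.

(** No gcd has to be computed: [numer] is one more than a multiple of volume W^4, and it is odd
    because W = H + H is even. *)
Lemma coprime_numer_den : coprime numer den.
Proof.
have numE : numer = (volume * W ^ 4 * (1600 * volume ^ 2 * W ^ 4 + 3) + 1)%N.
  by rewrite /numer; ring.
have c1 : coprime numer (volume * W ^ 4).
  by rewrite numE coprime_sym /coprime [(volume * _ * _)%N]mulnC gcdnMDl gcdn1.
have c2 : coprime numer 2.
  rewrite coprime_sym prime_coprime // dvdn2 numE oddD oddM oddM oddX oddD addbb.
  by rewrite andbF.
rewrite /den -mulnA coprimeMr c1 andbT.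
by rewrite (_ : 4 = 2 ^ 2)%N // coprimeXr.
Qed.

Definition inst_cost : 'cV[rat]_n_agents :=
  \col_i (if graph_good x B i then 1 else n_agents%:R).

(** The numerator of the attack serves as the bound on the false data, an integer at least as large
    as the attack. *)
Definition inst : p1_instance :=
  @P1Instance (agents_data (graph M H) inst_cost (W * W)%:R numer%:R 2 (scale%:R^-1))
    (const_mx (numer%:R / den%:R)).

(** The code of the instance followed by the threshold W, arranged in the loops that print it. *)
Definition inst_word : bits :=
  icode n_agents ++ icode 1 ++
  flatten [seq flatten [seq flatten [seq
    flatten [seq flatten [seq flatten [seq icode (link_at t p t' p' a a')
      | a' <- enum {: bool * square M}] | p' <- iota 0 W] | t' <- iota 0 W]
    | a <- enum {: bool * square M}] | p <- iota 0 W] | t <- iota 0 W] ++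
  int_code (- 2) ++ icode 1 ++ int_code (- 1) ++ icode 1 ++ icode 1 ++ icode n_agents ++
  flatten [seq flatten [seq flatten [seq icode 0 ++ icode 1
    | a <- enum {: bool * square M}] | p <- iota 0 W] | t <- iota 0 W] ++
  flatten [seq flatten [seq flatten [seq
      icode (if candidate H x B t p a then 1 else n_agents) ++ icode 1
    | a <- enum {: bool * square M}] | p <- iota 0 W] | t <- iota 0 W] ++
  icode (W * W) ++ icode 1 ++ icode numer ++ icode 1 ++ icode 2 ++ icode 1 ++
  icode 1 ++ icode scale ++ icode numer ++ icode den ++ icode W ++ icode 1.

Let col_data (f : 'I_n_agents -> rat) :
  mx_data rat_data (\col_i f i) = flatten [seq rat_data (f i) | i <- enum 'I_n_agents].
Proof.
rewrite /mx_data flatten_allpairs; congr flatten; apply: eq_map => i.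
by rewrite enum_ordSl (_ : enum 'I_0 = [::]) /= ?cats0 ?mxE //; apply: size0nil; rewrite size_enum_ord.
Qed.

Let ints_flatten (A : Type) (f : A -> seq int) (s : seq A) :
  ints_code (flatten [seq f a | a <- s]) = flatten [seq ints_code (f a) | a <- s].
Proof. by apply: flatten_map_flatten => //; exact: ints_code_cat. Qed.

Let over_vertices (C : Type) (f : vertex M H -> seq C) :
  flatten [seq f (enum_val i) | i <- enum 'I_n_agents] =
  flatten [seq f u | u <- enum (vertex M H)].
Proof. by rewrite -(map_enum_val (vertex M H)) -map_comp. Qed.

Lemma code_graph :
  ints_code (mx_data (fun b : bool => [:: (b : nat)%:Z]) (graph M H)) =
  flatten [seq flatten [seq flatten [seq
    flatten [seq flatten [seq flatten [seq icode (link_at t p t' p' a a')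
      | a' <- enum {: bool * square M}] | p' <- iota 0 W] | t' <- iota 0 W]
    | a <- enum {: bool * square M}] | p <- iota 0 W] | t <- iota 0 W].
Proof.
rewrite /mx_data flatten_allpairs ints_flatten.
rewrite -(@flatten_vertex _ M H (fun u => flatten [seq icode (vlink u v) | v <- enum (vertex M H)])
  (fun t p a => flatten [seq flatten [seq flatten [seq icode (link_at t p t' p' a a')
      | a' <- enum {: bool * square M}] | p' <- iota 0 W] | t' <- iota 0 W])); last first.
  by move=> u; exact: (@flatten_vertex _ M H (fun v => icode (vlink u v))
    (fun t' p' a' => icode (link_at u.1.1 u.1.2 t' p' u.2 a'))).
rewrite -over_vertices; congr flatten; apply: eq_map => i.
rewrite ints_flatten -over_vertices; congr flatten; apply: eq_map => j.
by rewrite mxE /ints_code /= cats0.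
Qed.

Let ints2 (a b : int) : ints_code [:: a; b] = int_code a ++ int_code b.
Proof. by rewrite /ints_code /= cats0. Qed.

Lemma code_cost :
  ints_code (mx_data rat_data inst_cost) =
  flatten [seq flatten [seq flatten [seq
      icode (if candidate H x B t p a then 1 else n_agents) ++ icode 1
    | a <- enum {: bool * square M}] | p <- iota 0 W] | t <- iota 0 W].
Proof.
rewrite /inst_cost col_data ints_flatten.
rewrite -(@flatten_vertex _ M H (fun u => icode (if vgood x B u then 1 else n_agents) ++ icode 1)
  (fun t p a => icode (if candidate H x B t p a then 1 else n_agents) ++ icode 1)) //.
rewrite -over_vertices; congr flatten; apply: eq_map => i.
rewrite -/(vgood x B (enum_val i)) /graph_good; case: ifP => _.
  by rewrite (rat_data_nat 1) ints2.
by rewrite rat_data_nat ints2.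
Qed.

Lemma code_x0 :
  ints_code (mx_data rat_data (0 : 'cV[rat]_(n_agents * 1))) =
  flatten [seq flatten [seq flatten [seq icode 0 ++ icode 1
    | a <- enum {: bool * square M}] | p <- iota 0 W] | t <- iota 0 W].
Proof.
have -> : (0 : 'cV[rat]_(n_agents * 1)) = \col_i 0 by apply/colP => i; rewrite !mxE.
rewrite -(@flatten_vertex _ M H (fun u => icode 0 ++ icode 1) (fun t p a => icode 0 ++ icode 1)) //.
rewrite muln1 col_data ints_flatten -over_vertices; congr flatten; exact: eq_map.
Qed.

Let ints_scalar (c : rat) : mx_data rat_data (const_mx c : 'M[rat]_1) = rat_data c.
Proof.
rewrite /mx_data flatten_allpairs enum_ordSl (_ : enum 'I_0 = [::]) /= ?cats0 ?mxE //.
by apply: size0nil; rewrite size_enum_ord.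
Qed.

Lemma inst_code (R : realType) (eps : R) :
  @decision_code R (P1_time_invariant eps) (inst, W%:R) = inst_word.
Proof.
have W0 : (0 < W)%N by lia.
have mul0 (a b : nat) : (0 < a)%N -> (0 < b)%N -> (0 < a * b)%N.
  by move=> a0 b0; rewrite muln_gt0 a0.
have exp0 (a n : nat) : (0 < a)%N -> (0 < a ^ n)%N by move=> a0; rewrite expn_gt0 a0.
have v0 := volume_gt0.
have den0 : (0 < den)%N by exact: mul0 (mul0 4%N _ isT v0) (exp0 _ 4 W0).
have scale0 : (0 < scale)%N by exact: mul0 (mul0 400%N _ isT (exp0 _ 2 v0)) (exp0 _ 4 W0).
have N0 : (0 < n_agents)%N by rewrite n_agentsE; exact: mul0 (mul0 2 _ isT v0) (exp0 _ 2 W0).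
have inv (n : nat) : (0 < n)%N -> rat_data n%:R^-1 = [:: 1%:Z; n%:Z].
  by move=> n0; rewrite -[_^-1]mul1r (@rat_data_frac 1 n n0) // coprime1n.
have E : inst_ints inst = [:: n_agents%:Z; 1%:Z] ++
  mx_data (fun b : bool => [:: (b : nat)%:Z]) (graph M H) ++
  mx_data rat_data (const_mx (- 2) : 'M[rat]_1) ++
  mx_data rat_data (const_mx (- 1) : 'M[rat]_1) ++ rat_data n_agents%:R^-1 ++
  mx_data rat_data (0 : 'cV[rat]_(n_agents * 1)) ++ mx_data rat_data inst_cost ++
  rat_data (W * W)%:R ++ rat_data numer%:R ++ mx_data rat_data (const_mx 2 : 'M[rat]_1) ++
  rat_data scale%:R^-1 ++ mx_data rat_data (const_mx (numer%:R / den%:R) : 'M[rat]_1) by [].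
rewrite /decision_code /inst_word -[mp_data _]/(inst_ints inst) E !ints_scalar.
rewrite !ints_code_cat code_graph code_cost code_x0.
rewrite (rat_data_nat 2) !rat_data_nat !inv // rat_data_frac ?coprime_numer_den //.
rewrite -[- 2]/((- 2)%:~R) (rat_data_int (- 2)) -[- 1]/((- 1)%:~R) (rat_data_int (- 1)).
by rewrite !ints2 -!catA.
Qed.
End Instance.

(** * Printing an instance *)

Lemma ruler_off u st r n : u r = 0 -> ruler st r n -> ruler (off u st) r n.
Proof. by move=> ur rul z; rewrite /= ur addr0. Qed.

Section PrintInstance.
Variables (M : turing_machine) (H : nat) (x : bits) (B : nat).
Notation W := (H + H)%N.

(* Tapes 1 to 8 are rulers; the heads of tapes 9 to 18 follow the loop variables
   and see whether they are the first row, the input, the space of the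
   certificate, the home column, and the relative position of two squares. *)
Record prepared (st : state) : Prop := Prepared {
  prep_out : forall z, con st 0 z = None;
  prep_ruler : forall r, (0 < r <= 8)%N -> ruler st r W;
  prep_first : forall z, isSome (con st 9 (pos st 9 + z)) = (z == 0);
  prep_input : forall z, con st 10 (pos st 10 + z) = tape_at (tape_of_bits x) (z - H%:Z);
  prep_cert : forall z, isSome (con st 11 (pos st 11 + z)) = (0 <= z - H%:Z < B%:Z);
  prep_home : forall z, isSome (con st 12 (pos st 12 + z)) = (z == H%:Z);
  prep_eq : forall i z, i \in [:: 13; 16]%N ->
    isSome (con st i (pos st i + z)) = (z == 0);
  prep_succ : forall i z, i \in [:: 14; 17]%N ->
    isSome (con st i (pos st i + z)) = (z == 1);
  prep_pred : forall i z, i \in [:: 15; 18]%N ->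
    isSome (con st i (pos st i + z)) = (z == -1);
  prep_counter : forall z, con st counter z = None
}.

(** The heads 13 to 15 go left with the row t of the first square and right with the row t' of the
    second, so they stand t' - t cells from their start; 16 to 18 do the same for the columns. *)
Definition row_moves : moves := [:: (1, MoveRight); (9, MoveRight);
  (13, MoveLeft); (14, MoveLeft); (15, MoveLeft)]%N.
Definition column_moves : moves := [:: (2, MoveRight); (10, MoveRight); (11, MoveRight);
  (12, MoveRight); (16, MoveLeft); (17, MoveLeft); (18, MoveLeft)]%N.
Definition row_moves' : moves :=
  [:: (3, MoveRight); (13, MoveRight); (14, MoveRight); (15, MoveRight)]%N.
Definition column_moves' : moves :=
  [:: (4, MoveRight); (16, MoveRight); (17, MoveRight); (18, MoveRight)]%N.

Definition inum (ms : seq (nat * seq nat)) : cmd := Sq (emit [:: false]) (num ms).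

Lemma prints_inum ms st n :
  (forall z, con st counter z = None) -> (forall m, m \in ms -> usable st n m.2) ->
  prints (inum ms) st (num_time ms n + 5) (icode (eval ms n)).
Proof.
move=> bl us; rewrite -[icode _]/([:: false] ++ nat_code (eval ms n)).
by apply: prints_leq (prints_sq (prints_emit _ _) (prints_num bl us)); rewrite /=; lia.
Qed.

Notation squares := (enum {: bool * square M}).
Let vol := volume M.

Lemma size_icode_bool (b : bool) : (size (icode b) <= 4)%N.
Proof. by case: b. Qed.

(** Once the six flags and the content [a] are known, the links to all contents [a'] form a constant
    word, which is built into the program. *)
Definition print_links (a : bool * square M) : cmd :=
  Br 13 (fun et => Br 14 (fun st => Br 15 (fun pt => Br 16 (fun ep => Br 17 (fun sp =>
  Br 18 (fun pp => emit (flatten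
    [seq icode (link (isSome et) (isSome st) (isSome pt) (isSome ep) (isSome sp) (isSome pp) a a')
    | a' <- squares]))))))).

Definition print_graph : cmd :=
  For 1 row_moves (For 2 column_moves (seqs
    [seq For 3 row_moves' (For 4 column_moves' (print_links a)) | a <- squares])).

Definition graph_time (n : nat) : nat :=
  for_time n 5 (for_time n 7 (size squares *
    (for_time n 4 (for_time n 4 (16 * size squares + 6))).+1)).

Lemma prints_graph st : prepared st ->
  prints print_graph st (graph_time W)
    (flatten [seq flatten [seq flatten [seq
      flatten [seq flatten [seq flatten [seq icode (link_at t p t' p' a a')
        | a' <- squares] | p' <- iota 0 W] | t' <- iota 0 W]
      | a <- squares] | p <- iota 0 W] | t <- iota 0 W]).
Proof.
move=> prep.
apply: prints_for => // [|t tW]; first exact: prep_ruler prep 1%N isT.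
apply: prints_for => // [|p pW]; first by apply: ruler_off => //; exact: prep_ruler prep 2%N isT.
apply: prints_seqs => a.
apply: prints_for => // [|t' t'W].
  by do 2!(apply: ruler_off => //); exact: prep_ruler prep 3%N isT.
apply: prints_for => // [|p' p'W].
  by do 3!(apply: ruler_off => //); exact: prep_ruler prep 4%N isT.
set st4 := off _ _.
have E (i : nat) : look st4 i = con st i (pos st i +
    (disp row_moves i * t%:Z + disp column_moves i * p%:Z + disp row_moves' i * t'%:Z
     + disp column_moves' i * p'%:Z)) by rewrite /look /= !addrA.
have e13 : isSome (look st4 13) = (t == t').
  by rewrite E (prep_eq prep _ (i := 13)) //=; lia.
have e14 : isSome (look st4 14) = (t' == t.+1).
  by rewrite E (prep_succ prep _ (i := 14)) //=; lia.
have e15 : isSome (look st4 15) = (t == t'.+1).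
  by rewrite E (prep_pred prep _ (i := 15)) //=; lia.
have e16 : isSome (look st4 16) = (p == p').
  by rewrite E (prep_eq prep _ (i := 16)) //=; lia.
have e17 : isSome (look st4 17) = (p' == p.+1).
  by rewrite E (prep_succ prep _ (i := 17)) //=; lia.
have e18 : isSome (look st4 18) = (p == p'.+1).
  by rewrite E (prep_pred prep _ (i := 18)) //=; lia.
rewrite -[(16 * _ + 6)%N]/((16 * size squares + 6)%N) !addnS addn0.
do 6!(apply: prints_br => //); rewrite e13 e14 e15 e16 e17 e18.
apply: prints_leq (prints_emit _ _).
rewrite (_ : 16 = 4 * 4)%N // -mulnA leq_mul2l /=.
elim: squares => //= a' s IH; rewrite size_cat.
by apply: (leq_trans (leq_add (size_icode_bool _) IH)); lia.
Qed.

Definition print_x0 : cmd :=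
  For 1 [:: (1%N, MoveRight)] (For 2 [:: (2%N, MoveRight)]
    (emit (flatten [seq icode 0 ++ icode 1 | a <- squares]))).

Definition x0_time (n : nat) : nat :=
  for_time n 1 (for_time n 1 (4 * size (flatten [seq icode 0 ++ icode 1 | a <- squares]))).

Lemma prints_x0 st : prepared st ->
  prints print_x0 st (x0_time W)
    (flatten [seq flatten [seq flatten [seq icode 0 ++ icode 1
    | a <- squares] | p <- iota 0 W] | t <- iota 0 W]).
Proof.
move=> prep; apply: prints_for => // [|t tW]; first exact: prep_ruler prep 1%N isT.
apply: prints_for => // [|p pW]; first by apply: ruler_off => //; exact: prep_ruler prep 2%N isT.
exact: prints_emit.
Qed.

(** The rulers are parameters because those of enclosing loops are in use: inside the loops over 1
    and 2, counting is done with 3 and 4. *)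
Definition agents_poly (r r' : nat) : seq (nat * seq nat) := [:: (2 * vol, [:: r; r'])]%N.

Lemma eval1 c l n : eval [:: (c, l)] n = (c * n ^ size l)%N.
Proof. by rewrite /eval big_seq1. Qed.

Lemma eval_agents r r' : eval (agents_poly r r') W = n_agents M H.
Proof. by rewrite eval1 n_agentsE. Qed.

Definition print_cost : cmd :=
  For 1 row_moves (For 2 column_moves
   (Br 9 (fun z => Br 10 (fun xc => Br 11 (fun yc => Br 12 (fun oc => seqs
     [seq Sq (if ~~ a.1 && square_ok (isSome z) xc (isSome yc) (isSome oc) a.2
              then emit (icode 1) else inum (agents_poly 3 4)) (emit (icode 1))
     | a <- squares])))))).

Definition cost_time (n : nat) : nat :=
  for_time n 5 (for_time n 7 (size squares *
    (num_time (agents_poly 3 4) n + 40).+1 + 4)).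

Lemma prints_cost st : prepared st ->
  prints print_cost st (cost_time W)
    (flatten [seq flatten [seq flatten [seq
      icode (if candidate H x B t p a then 1 else n_agents M H) ++ icode 1
    | a <- squares] | p <- iota 0 W] | t <- iota 0 W]).
Proof.
move=> prep; apply: prints_for => // [|t tW]; first exact: prep_ruler prep 1%N isT.
apply: prints_for => // [|p pW]; first by apply: ruler_off => //; exact: prep_ruler prep 2%N isT.
set st2 := off _ _.
have E (i : nat) : look st2 i = con st i (pos st i +
    (disp row_moves i * t%:Z + disp column_moves i * p%:Z)) by rewrite /look /= !addrA.
have e9 : isSome (look st2 9) = (t == 0)%N by rewrite E (prep_first prep) //=; lia.
have e10 : look st2 10 = column_input x H p.
  by rewrite E (prep_input prep) /column_input; congr tape_at; rewrite /=; lia.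
have e11 : isSome (look st2 11) = column_cert H B p.
  by rewrite E (prep_cert prep) /column_cert /=; lia.
have e12 : isSome (look st2 12) = (p == H) by rewrite E (prep_home prep) //=; lia.
rewrite !addnS addn0.
do 4!(apply: prints_br => //); rewrite e9 e10 e11 e12.
apply: prints_seqs => a; rewrite -/(candidate H x B t p a).
case: ifP => _.
  by apply: prints_leq (prints_sq (prints_emit _ _) (prints_emit _ _)); rewrite /=; lia.
rewrite -(eval_agents 3 4).
apply: prints_leq (prints_sq (prints_inum _ _) (prints_emit _ _)).
- by rewrite /=; lia.
- exact: prep_counter prep.
- move=> m; rewrite inE => /eqP -> /=; split=> // r; rewrite !inE.
  by case/orP => /eqP ->; split=> //; do 2!(apply: ruler_off => //);
    apply: (prep_ruler prep).
Qed.

Definition print_inst : cmd :=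
  seqs [:: inum (agents_poly 1 2); emit (icode 1); print_graph;
    emit (int_code (- 2) ++ icode 1 ++ int_code (- 1) ++ icode 1 ++ icode 1);
    inum (agents_poly 1 2); print_x0; print_cost;
    inum [:: (1, [:: 1; 2])]%N; emit (icode 1);
    inum [:: (1600 * vol ^ 3, [:: 1; 2; 3; 4; 5; 6; 7; 8]); (3 * vol, [:: 1; 2; 3; 4]); (1, [::])]%N;
    emit (icode 1 ++ icode 2 ++ icode 1 ++ icode 1);
    inum [:: (400 * vol ^ 2, [:: 1; 2; 3; 4])]%N;
    inum [:: (1600 * vol ^ 3, [:: 1; 2; 3; 4; 5; 6; 7; 8]); (3 * vol, [:: 1; 2; 3; 4]); (1, [::])]%N;
    inum [:: (4 * vol, [:: 1; 2; 3; 4])]%N;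
    inum [:: (1, [:: 1])]%N; emit (icode 1)].

End PrintInstance.

(** * Preparing the tapes *)

Definition wr (s : seq nat) (c : cell) (st : state) : state :=
  State (pos st) (fun i z => if (i \in s) && (z == pos st i) then c else con st i z).

Definition wrs (s : seq nat) (c : cell) : cmd := seqs [seq Wr i c | i <- s].

Lemma does_wrs s c st : does (wrs s c) st (2 * size s) (wr s c st).
Proof.
elim: s st => [|i s IH] st /=.
  by apply: does_conv (does_skip st) => //; exact: state_ext.
apply: does_conv (does_sq (does_wr i c st) (IH _)); first by lia.
apply: state_ext => //= j z; rewrite inE.
by case: (j =P i) => [->|_] /=; case: (_ \in s); case: (z == _).
Qed.

Definition ups (s : seq nat) (d : direction) : moves := [seq (i, d) | i <- s].

Lemma disp_cat l l' i : disp (l ++ l') i = disp l i + disp l' i.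
Proof.
elim: l => [|[j d] l IH] /=; first by rewrite add0r.
by rewrite IH; case: ifP => // _; rewrite addrA.
Qed.

Lemma disp_ups s d i : uniq s -> disp (ups s d) i = if i \in s then shift d else 0.
Proof.
elim: s => //= j s IH /andP[js us]; rewrite IH // inE.
by case: eqVneq => [->|_] //=; rewrite (negPf js) addr0.
Qed.

(** The second half of [For]: from the end of a ruler back to its start. *)
Definition rewind (r : nat) (l : moves) : cmd :=
  Sq (mvs (back l)) (Sq (Wh r isSome (mvs (back l))) (mvs l)).

Definition rewind_time (n s : nat) : nat := (n * (2 * s).+2 + 4 * s + 6)%N.

Lemma does_rewind r l st n : disp l r = 1 -> ruler st r n ->
  does (rewind r l) (off (fun i => disp l i * n%:Z) st) (rewind_time n (size l)) st.
Proof.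
move=> vr rul; pose S' j := off (fun i => disp l i * (n%:Z - 1 - j%:Z)) st.
have size_back : size (back l) = size l by rewrite size_map.
have H2 : does (mvs (back l)) (off (fun i => disp l i * n%:Z) st) (2 * size l) (S' 0%N).
  have := does_mvs (back l) (off (fun i => disp l i * n%:Z) st); rewrite size_back.
  congr (does _ _ _ _); rewrite offD; apply: off_eq => i; rewrite disp_back.
  by rewrite subr0 mulrBr mulr1.
have H3 : does (Wh r isSome (mvs (back l))) (S' 0%N) (n * (2 * size l).+2).+1 (S' n).
  apply: does_wh => [j jn|].
    split; first by rewrite /look /= vr mul1r rul //; lia.
    have := does_mvs (back l) (S' j); rewrite size_back; congr (does _ _ _ _).
    rewrite offD; apply: off_eq => i; rewrite disp_back.
    by rewrite (_ : j.+1%:Z = j%:Z + 1) ?opprD ?addrA ?(mulrDr _ _ (-1)) ?mulrN1 //; lia.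
  by rewrite /look /= vr mul1r rul //; lia.
have H4 : does (mvs l) (S' n) (2 * size l) st.
  have := does_mvs l (S' n); congr (does _ _ _ _).
  rewrite offD; apply: off0 => i.
  by rewrite addrAC subrr add0r mulrN1 addrC subrr.
by apply: does_leq (does_sq H2 (does_sq H3 H4)); rewrite /rewind_time; lia.
Qed.

(* [j] marks have been appended to the tapes in [s], the heads moving by [v]. *)
Definition marked (s : seq nat) (v : nat -> int) (j : nat) (st : state) : state :=
  State (fun i => pos st i + v i * j%:Z)
        (fun i z => if (i \in s) && (0 <= z - pos st i < j%:Z) then Some true else con st i z).

Lemma marked0 s v st : marked s v 0 st = st.
Proof.
apply: state_ext => [i|i z] /=; first by rewrite mulr0 addr0.
by case: ifP => // /andP[_]; lia.
Qed.

Definition grow (s : seq nat) (l : moves) : cmd := Sq (wrs s (Some true)) (mvs l).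

Lemma does_grow s l u j st : (forall i, i \in s -> disp l i = 1) ->
  (forall i, i \in s -> u i = 0) ->
  does (grow s l) (off u (marked s (disp l) j st)) (2 * size s + 2 * size l).+1
    (off u (marked s (disp l) j.+1 st)).
Proof.
move=> v1 u0; apply: does_conv (does_sq (does_wrs _ _ _) (does_mvs _ _)) => //.
apply: state_ext => [i|i z] /=.
  rewrite (_ : j.+1%:Z = j%:Z + 1); last by lia.
  by ring.
case is_s: (i \in s) => //=; rewrite (v1 i is_s) (u0 i is_s) addr0 mul1r.
case: eqP => [->|zp]; first by case: ifP => //; lia.
by case: ifP => h; case: ifP => h' //; lia.
Qed.

(** Writes c n^k + c marks, the shape of the bounds in the definition of NP, from k unary copies of
    n. *)
Definition fill (cp : seq nat) (c : nat) (s : seq nat) (l : moves) : cmd :=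
  Sq (nest cp (rep c (grow s l))) (rep c (grow s l)).

Definition fill_time (n k c m : nat) : nat :=
  (nest_time n k (c * (2 * m).+2) + c * (2 * m).+2).+1.

Lemma does_fill cp c s l st n : uniq cp -> (forall i, i \in s -> disp l i = 1) ->
  (forall i, i \in cp -> [/\ i \notin s, disp l i = 0 & ruler st i n]) ->
  does (fill cp c s l) st (fill_time n (size cp) c (size s + size l))
    (marked s (disp l) (c * n ^ size cp + c) st).
Proof.
move=> ucp v1 cps.
have reps u j : (forall i, i \in s -> u i = 0) ->
    does (rep c (grow s l)) (off u (marked s (disp l) j st)) (c * (2 * (size s + size l)).+2)
      (off u (marked s (disp l) (j + c) st)).
  move=> u0; have := @does_rep c (grow s l) (fun m => off u (marked s (disp l) (j + m) st))
    (2 * (size s + size l)).+1.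
  rewrite addn0; apply => i _; rewrite addnS mulnDr; exact: does_grow.
have H1 := @does_nest cp (rep c (grow s l)) (fun j => marked s (disp l) (c * j) st) n
  (c * (2 * (size s + size l)).+2) ucp.
rewrite muln0 marked0 in H1; apply: (does_sq (H1 _ _)) => [j r rcp z|j u _ u0|].
- have [rs r0 rul] := cps r rcp.
  by rewrite /= (negPf rs) r0 mul0r addr0 /=; exact: rul.
- rewrite (_ : c * j.+1 = c * j + c)%N; last by rewrite mulnS addnC.
  apply: reps => i is_s; apply: u0.
  by apply/negP => /cps[]; rewrite is_s.
- have := reps (fun _ => 0) (c * n ^ size cp)%N (fun _ _ => erefl).
  by rewrite !off0.
Qed.

Definition setup_time (D d a c n : nat) : nat :=
  (200 + n * (4 * D + 20) + rewind_time n D.+1 + fill_time n d a 2 +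
   rewind_time (a * n ^ d + a) 1 + fill_time n D c 19 + fill_time n D c 16 +
   rewind_time (c * n ^ D + c + (c * n ^ D + c)) 8)%N.

Section Setup.
Variables (D d a c : nat) (x : bits).
Hypothesis dD : (d <= D)%N.
Let n := size x.
Let B := (a * n ^ d + a)%N.
Let H := (c * n ^ D + c)%N.

(** One unary copy of the input length for each of the D nested loops; the first d of them also
    serve to count n^d. *)
Let copies := iota 20 D.
Let rulers := iota 1 8.
Let marks := [:: 9; 12; 13; 14; 15; 16; 17; 18]%N.

(** Leaves the mark one cell to the right of the heads 14 and 17 and one cell to the left of 15 and
    18, for successors and predecessors. *)
Definition tracker_moves : moves :=
  [:: (14, MoveLeft); (17, MoveLeft); (15, MoveRight); (18, MoveRight)]%N.

(** The input moves to tape 10 and its length is copied in unary; tape 0 is erased to receive the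
    output. *)
Definition read_input : cmd :=
  Wh 0 isSome (Sq (Br 0 (fun b => Wr 10 b)) (Sq (wrs copies (Some true))
    (Sq (Wr 0 None) (mvs (ups (0 :: 10 :: copies)%N MoveRight))))).

(** While the rulers get their first H marks, the heads 10 to 12 go H cells to the left: column p
    then stands for the cell p - H. The second H marks are written without these moves. *)
Definition widen_moves : moves :=
  ups rulers MoveRight ++ ups [:: 10; 11; 12]%N MoveLeft.

Definition setup : cmd :=
  Sq (wrs marks (Some true)) (Sq (mvs tracker_moves) (Sq read_input
  (Sq (rewind 10 (ups (10 :: copies)%N MoveRight))
  (Sq (fill (iota 20 d) a [:: 11%N] (ups [:: 11%N] MoveRight))
  (Sq (rewind 11 (ups [:: 11%N] MoveRight))
  (Sq (fill copies c rulers widen_moves)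
  (Sq (fill copies c rulers (ups rulers MoveRight))
      (rewind 1 (ups rulers MoveRight))))))))).

Let notin i : (i < 20)%N -> (i \in copies) = false.
Proof. by rewrite mem_iota => h; lia. Qed.

Let s1 : state := off (disp tracker_moves) (wr marks (Some true) (input_state x)).

Let word_input z : word_at x z = tape_at (tape_of_bits x) z.
Proof.
rewrite tape_at_of_bits /word_at; case: z => [j|j] //.
rewrite (_ : (0 <= Posz j < (size x)%:Z) = (j < size x)%N) //.
have [jx|jx] := ltnP j (size x); last by rewrite nth_default ?size_map.
by rewrite (nth_map false).
Qed.

Let con_blank i z : (0 < i)%N -> con (input_state x) i z = None.
Proof.
move=> i0; rewrite /= tape_at_of_bits (nth_default _ (_ : size [:: x] <= i)%N) //.
by case: z => // j; rewrite nth_nil.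
Qed.

Let con1 i z : con s1 i z =
  if (i \in marks) && (z == 0) then Some true else con (input_state x) i z.
Proof. by []. Qed.

(** The state after reading and rewinding. Head 0 is not rewound: the output starts on blank tape
    where the input ended. *)
Let s3 : state := State (fun i => if i == 0%N then n%:Z else pos s1 i)
  (fun i z => if i == 0%N then None else if i == 10%N then word_at x z
    else if i \in copies then (if 0 <= z < n%:Z then Some true else None) else con s1 i z).

Let S (j : nat) : state :=
  State (fun i => if i \in (0 :: 10 :: copies)%N then j%:Z else pos s1 i)
  (fun i z => if i == 0%N then (if z < j%:Z then None else word_at x z)
    else if i == 10%N then (if z < j%:Z then word_at x z else None)
    else if i \in copies then (if 0 <= z < j%:Z then Some true else None) else con s1 i z).

Let pos1 i : i \in (0 :: 10 :: copies)%N -> pos s1 i = 0.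
Proof.
rewrite /s1 /= !inE mem_iota add0r => h.
by do 4!(case: eqP => [e|_]; first by exfalso; lia).
Qed.

Let S0 : S 0 = s1.
Proof.
apply: state_ext => [i|i z].
  rewrite -[pos (S 0) i]/(if i \in (0 :: 10 :: copies)%N then 0%:Z else pos s1 i).
  by case: ifP => // /pos1 ->.
rewrite -[con (S 0) i z]/(if i == 0%N then (if z < 0 then None else word_at x z)
    else if i == 10%N then (if z < 0 then word_at x z else None)
    else if i \in copies then (if 0 <= z < 0 then Some true else None) else con s1 i z).
have [->|i0] := eqVneq i 0%N.
  rewrite con1 /= word_input.
  by case: ifP => // z0; rewrite tape_at_of_bits; case: z z0.
rewrite con1 con_blank ?lt0n //; have [->|i10] := eqVneq i 10%N.
  by case: ifP => // z0; rewrite /word_at; case: ifP => //; lia.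
case: ifP => // ic; rewrite (_ : (i \in marks) = false) /=; last first.
  by move: ic; rewrite mem_iota !inE => ic; lia.
by case: ifP => //; lia.
Qed.

Let look_S j : look (S j) 0 = word_at x j%:Z.
Proof. by rewrite /look /S /= ltxx. Qed.

Let step_time := (2 * size copies + (2 * D + 4) + 7)%N.

Let does_read : does read_input s1 (n * step_time.+2).+1 (S n).
Proof.
rewrite -S0; apply: does_wh => [j jn|]; last first.
  rewrite look_S.
  by rewrite /word_at; case: ifP => //; lia.
have look0 : look (S j) 0 = Some (nth false x j).
  by rewrite look_S /word_at; case: ifP => //; lia.
split; first by rewrite look0.
have H1 : does (Br 0 (fun b => Wr 10 b)) (S j) 2 (write 10 (Some (nth false x j)) (S j)).
  by apply: does_br; rewrite look0; exact: does_wr.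
apply: does_conv (does_sq H1 (does_sq (does_wrs _ _ _) (does_sq (does_wr _ _ _) (does_mvs _ _)))).
  by rewrite /step_time size_map /= size_iota; lia.
have u : uniq (0 :: 10 :: copies)%N by rewrite /= !inE !notin // iota_uniq.
have posS k i : pos (S k) i = if i \in (0 :: 10 :: copies)%N then k%:Z else pos s1 i by [].
have conS k i z : con (S k) i z =
    if i == 0%N then (if z < k%:Z then None else word_at x z)
    else if i == 10%N then (if z < k%:Z then word_at x z else None)
    else if i \in copies then (if 0 <= z < k%:Z then Some true else None) else con s1 i z by [].
apply: state_ext => [i|i z].
  transitivity (pos (S j) i + disp (ups (0 :: 10 :: copies)%N MoveRight) i); first by [].
  rewrite disp_ups // !posS; case: ifP => _; last by rewrite addr0.
  by rewrite /=; lia.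
transitivity (if (i == 0%N) && (z == pos (S j) 0) then None
  else if (i \in copies) && (z == pos (S j) i) then Some true
  else if (i == 10%N) && (z == pos (S j) 10) then Some (nth false x j)
  else con (S j) i z); first by [].
rewrite !posS !conS !inE; have [->|i0] := eqVneq i 0%N.
  rewrite (@notin 0%N) //=; have [->|zj] := eqVneq z j; first by case: ifP => //; lia.
  by case: ifP => h; case: ifP => h' //; lia.
have [->|i10] /= := eqVneq i 10%N.
  rewrite (@notin 10%N) //=; have [->|zj] := eqVneq z j.
    case: ifP => h; last by lia.
    by rewrite /word_at; case: ifP => //; lia.
  by case: ifP => h; case: ifP => h' //; lia.
case ic: (i \in copies) => //=.
have [->|zj] := eqVneq z j; first by case: ifP => //; lia.
by case: ifP => h; case: ifP => h' //; lia.
Qed.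

Let v11 := disp (ups [:: 11%N] MoveRight).
Let vw := disp widen_moves.
Let vr := disp (ups rulers MoveRight).
Let s5 : state := State (pos s3) (con (marked [:: 11%N] v11 B s3)).
Let s6 : state := marked rulers vw H s5.
Let s7 : state := marked rulers vr H s6.

Definition setup_state : state :=
  State (fun i => pos s7 i - vr i * (H + H)%N%:Z) (con s7).

Let pos3 i : pos s3 i = if i == 0%N then n%:Z else pos s1 i. Proof. by []. Qed.

Let con3 i z : con s3 i z = if i == 0%N then None else if i == 10%N then word_at x z
    else if i \in copies then (if 0 <= z < n%:Z then Some true else None) else con s1 i z.
Proof. by []. Qed.

Let con5 i z : con s5 i z = if (i == 11%N) && (0 <= z - pos s3 i < B%:Z) then Some true
  else con s3 i z.
Proof. by rewrite /s5 /= inE. Qed.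

Let pos3_home i : i \in (10 :: copies)%N -> pos s3 i = 0.
Proof.
move=> h; rewrite pos3; have [e|_] := eqVneq i 0%N; first by move: h; rewrite e inE notin.
by apply: pos1; rewrite inE h orbT.
Qed.

Let copy_ge i : i \in copies -> (20 <= i)%N. Proof. by rewrite mem_iota => /andP[]. Qed.

Let ruler3 i : i \in copies -> ruler s3 i n.
Proof.
move=> ic z; rewrite pos3_home ?inE ?ic ?orbT // add0r con3 ic.
have [e|_] := eqVneq i 0%N; first by move: (copy_ge ic); rewrite e.
have [e|_] := eqVneq i 10%N; first by move: (copy_ge ic); rewrite e.
by case: ifP.
Qed.

Let ruler5 i : i \in copies -> ruler s5 i n.
Proof.
move=> ic z; rewrite -(ruler3 ic z) con5.
by case: eqVneq => // e; move: (copy_ge ic); rewrite e.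
Qed.

Let v0_copy i : i \in copies -> vw i = 0 /\ vr i = 0.
Proof.
move=> /copy_ge i20; rewrite /vw /vr /widen_moves disp_cat !disp_ups ?iota_uniq //.
rewrite mem_iota !inE.
have -> : (1 <= i < 1 + 8)%N = false by lia.
by do 3!(case: eqP => [e|_]; first by exfalso; lia).
Qed.

Let not_ruler i : i \in copies -> i \notin rulers.
Proof. by move=> /copy_ge i20; rewrite mem_iota; lia. Qed.

Let vw1 i : i \in rulers -> vw i = 1.
Proof.
move=> h; rewrite /vw /widen_moves disp_cat !disp_ups ?iota_uniq // h.
move: h; rewrite mem_iota !inE => h.
by do 3!(case: eqP => [e|_]; first by exfalso; lia).
Qed.

Let vr1 i : i \in rulers -> vr i = 1.
Proof. by move=> h; rewrite /vr disp_ups ?iota_uniq // h. Qed.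

(** The second filling starts where the first one ended, so the two blocks of H marks join. *)
Let setup_ruler r : r \in rulers -> ruler setup_state r (H + H).
Proof.
move=> rr; have r8 : (1 <= r <= 8)%N by move: rr; rewrite mem_iota; lia.
have blank z : con s5 r z = None.
  have [r0 r10 r11] : [/\ r != 0%N, r != 10%N & r != 11%N] by split; lia.
  rewrite con5 (negPf r11) con3 (negPf r0) (negPf r10) notin; last by lia.
  rewrite con1 con_blank ?lt0n //; case: ifP => // /andP[+ _].
  by rewrite !inE; lia.
move=> z; set q := pos s5 r.
have -> : pos setup_state r = q.
  transitivity (q + vw r * H%:Z + vr r * H%:Z - vr r * (H + H)%N%:Z); first by [].
  by rewrite vw1 // vr1 // !(mul1r (_ : int)); lia.
transitivity (isSome (if (r \in rulers) && (0 <= q + z - (q + vw r * H%:Z) < H%:Z) then Some true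
  else if (r \in rulers) && (0 <= q + z - q < H%:Z) then Some true else con s5 r (q + z))).
  by [].
rewrite rr vw1 // (mul1r (_ : int)) !andTb blank.
by case: ifP => h; [|case: ifP => h']; rewrite /=; lia.
Qed.

Lemma does_setup : does setup (input_state x) (setup_time D d a c n) setup_state.
Proof.
have from c0 st st0 m m' st1 : st0 = st -> (m <= m')%N -> does c0 st0 m st1 -> does c0 st m' st1.
  by move=> -> le; exact: does_leq.
have uc : uniq copies by exact: iota_uniq.
have u10 : uniq (10 :: copies)%N by rewrite /= notin.
have h4 : does (rewind 10 (ups (10 :: copies)%N MoveRight)) (S n) (rewind_time n D.+1) s3.
  apply: from (@does_rewind 10 (ups (10 :: copies)%N MoveRight) s3 n _ _).
  - apply: state_ext => [i|i z].
      transitivity (pos s3 i + disp (ups (10 :: copies)%N MoveRight) i * n%:Z); first by [].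
      rewrite disp_ups // pos3 -[pos (S n) i]/(if i \in (0 :: 10 :: copies)%N then n%:Z else pos s1 i).
      rewrite [i \in 0%N :: _]inE; have [->|i0] := eqVneq i 0%N.
        have h0 : (0%N \in (10 :: copies)%N) = false by rewrite inE notin.
        by rewrite h0 (mul0r n%:Z) addr0.
      rewrite orFb; case: ifP => h; last by rewrite (mul0r n%:Z) addr0.
      have := pos3_home h; rewrite pos3 (negPf i0) => ->.
      by rewrite add0r (mul1r n%:Z).
    transitivity (con s3 i z); first by [].
    rewrite con3 -[con (S n) i z]/(if i == 0%N then (if z < n%:Z then None else word_at x z)
      else if i == 10%N then (if z < n%:Z then word_at x z else None)
      else if i \in copies then (if 0 <= z < n%:Z then Some true else None) else con s1 i z).
    case: ifP => _; first by case: ifP => // h; rewrite /word_at; case: ifP => //; lia.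
    by case: ifP => // _; case: ifP => // h; rewrite /word_at; case: ifP => //; lia.
  - by rewrite /ups size_map /= size_iota.
  - by rewrite disp_ups // inE.
  - move=> z; rewrite pos3_home ?inE // con3 /= add0r /word_at.
    by case: ifP.
have h5 : does (fill (iota 20 d) a [:: 11%N] (ups [:: 11%N] MoveRight)) s3 (fill_time n d a 2)
    (marked [:: 11%N] v11 B s3).
  have := @does_fill (iota 20 d) a [:: 11%N] (ups [:: 11%N] MoveRight) s3 n.
  rewrite size_iota; apply; first exact: iota_uniq.
    by move=> i; rewrite inE => /eqP ->; rewrite disp_ups.
  move=> i; rewrite mem_iota => hi.
  have ic : i \in copies by rewrite mem_iota; lia.
  by split; [rewrite inE; lia | rewrite disp_ups // inE; case: eqP => // e; exfalso; lia | exact: ruler3].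
have h6 : does (rewind 11 (ups [:: 11%N] MoveRight)) (marked [:: 11%N] v11 B s3) (rewind_time B 1) s5.
  apply: from (@does_rewind 11 (ups [:: 11%N] MoveRight) s5 B _ _) => //.
  have c11 z : con s3 11 z = None by rewrite con3 (@notin 11%N) // con1 con_blank.
  by move=> z; rewrite con5 eqxx addrAC subrr add0r andTb; case: ifP => // _; rewrite c11.
have szw : (size rulers + size widen_moves = 19)%N by [].
have h7 : does (fill copies c rulers widen_moves) s5 (fill_time n D c 19) s6.
  have := @does_fill copies c rulers widen_moves s5 n uc vw1.
  rewrite szw [size copies]size_iota; apply => i ic.
  by split; [exact: not_ruler | exact: (v0_copy ic).1 | exact: ruler5].
have h8 : does (fill copies c rulers (ups rulers MoveRight)) s6 (fill_time n D c 16) s7.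
  have := @does_fill copies c rulers (ups rulers MoveRight) s6 n uc vr1.
  rewrite [size copies]size_iota; apply => i ic.
  split; [exact: not_ruler | exact: (v0_copy ic).2 |].
  move=> z; rewrite -(ruler5 ic z) /s6 /= (negPf (not_ruler ic)) /=.
  by rewrite -/vw (v0_copy ic).1 mul0r addr0.
have h9 : does (rewind 1 (ups rulers MoveRight)) s7 (rewind_time (H + H) 8) setup_state.
  apply: from (@does_rewind 1 (ups rulers MoveRight) setup_state (H + H) _ _) => //.
    by apply: state_ext => //= i; rewrite -/vr subrK.
  exact: setup_ruler.
have h1 := does_wrs marks (Some true) (input_state x).
have h2 := does_mvs tracker_moves (wr marks (Some true) (input_state x)).
apply: does_leq (does_sq h1 (does_sq h2 (does_sq does_read (does_sq h4 (does_sq h5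
  (does_sq h6 (does_sq h7 (does_sq h8 h9)))))))).
have -> : step_time = (4 * D + 11)%N by rewrite /step_time size_iota; lia.
rewrite /setup_time -/H -/B [size marks]/= [size tracker_moves]/=.
suff : (n * (4 * D + 11).+2 <= n * (4 * D + 20))%N by lia.
by rewrite leq_mul2l; lia.
Qed.

Lemma prepared_setup : prepared H x B setup_state.
Proof.
have pos10 (i : nat) : pos s1 i = disp tracker_moves i by rewrite /s1 /= add0r.
have con_plain i z : (i < 20)%N -> i \notin rulers -> i != 0%N -> i != 10%N -> i != 11%N ->
    con setup_state i z = if (i \in marks) && (z == 0) then Some true else None.
  move=> i20 ir i0 i10 i11.
  transitivity (con s5 i z).
    by rewrite /setup_state /s7 /s6 /marked [LHS]/= (negPf ir).
  by rewrite con5 (negPf i11) con3 (negPf i0) (negPf i10) notin // con1 con_blank ?lt0n.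
have posE i : i \notin rulers -> i != 0%N -> pos setup_state i = disp tracker_moves i + vw i * H%:Z.
  move=> ir i0; rewrite -pos10.
  transitivity (pos s3 i + vw i * H%:Z + vr i * H%:Z - vr i * (H + H)%N%:Z); first by [].
  rewrite pos3 (negPf i0) (_ : vr i = 0) ?(mul0r (_ : int)) ?addr0 ?subr0 //.
  by rewrite /vr disp_ups ?iota_uniq // (negPf ir).
have mk i (k : int) z : i \in marks -> pos setup_state i = k ->
    isSome (con setup_state i (pos setup_state i + z)) = (k + z == 0).
  move=> im ->; rewrite con_plain ?im; first by case: eqP.
  1-5: by move: im; rewrite !inE ?mem_iota; lia.
have posK i (k l : int) : i \notin rulers -> i != 0%N -> disp tracker_moves i = k -> vw i = l ->
    pos setup_state i = k + l * H%:Z by move=> ir i0 <- <-; exact: posE.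
have p9 := @posK 9 0 0 isT isT erefl erefl.
have p10 := @posK 10 0 (-1) isT isT erefl erefl.
have p11 := @posK 11 0 (-1) isT isT erefl erefl.
have p12 := @posK 12 0 (-1) isT isT erefl erefl.
have p13 := @posK 13 0 0 isT isT erefl erefl.
have p14 := @posK 14 (-1) 0 isT isT erefl erefl.
have p15 := @posK 15 1 0 isT isT erefl erefl.
have p16 := @posK 16 0 0 isT isT erefl erefl.
have p17 := @posK 17 (-1) 0 isT isT erefl erefl.
have p18 := @posK 18 1 0 isT isT erefl erefl.
split.
- move=> z; transitivity (con s5 0 z); first by [].
  by rewrite con5 con3.
- by move=> r r8; apply: setup_ruler; rewrite mem_iota; lia.
- by move=> z; rewrite (mk _ _ _ _ p9) //; lia.
- move=> z; rewrite p10; transitivity (con s5 10 (z - H%:Z)).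
    transitivity (con s5 10 (0 + -1 * H%:Z + z)); first by [].
    by congr (con s5 _ _); lia.
  by rewrite con5 con3 -word_input.
- move=> z; rewrite p11; transitivity (isSome (con s5 11 (z - H%:Z))).
    transitivity (isSome (con s5 11 (0 + -1 * H%:Z + z))); first by [].
    by congr (isSome (con s5 _ _)); lia.
  rewrite con5 eqxx (_ : pos s3 11 = 0) // subr0 andTb; case: ifP => // _.
  by rewrite con3 (@notin 11%N) // con1 con_blank.
- by move=> z; rewrite (mk _ _ _ _ p12) //; lia.
- by move=> i z; rewrite !inE => /orP[] /eqP ->; [rewrite (mk _ _ _ _ p13) | rewrite (mk _ _ _ _ p16)] => //; lia.
- by move=> i z; rewrite !inE => /orP[] /eqP ->; [rewrite (mk _ _ _ _ p14) | rewrite (mk _ _ _ _ p17)] => //; lia.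
- by move=> i z; rewrite !inE => /orP[] /eqP ->; [rewrite (mk _ _ _ _ p15) | rewrite (mk _ _ _ _ p18)] => //; lia.
- by move=> z; rewrite con_plain.
Qed.

End Setup.

Section PrintedInstance.
Variables (M : turing_machine) (H : nat) (x : bits) (B : nat).
Notation W := (H + H)%N.
Let vol := volume M.

Definition numer_poly : seq (nat * seq nat) :=
  [:: (1600 * vol ^ 3, [:: 1; 2; 3; 4; 5; 6; 7; 8]); (3 * vol, [:: 1; 2; 3; 4]); (1, [::])]%N.

Definition inst_time (n : nat) : nat :=
  (2 * num_time (agents_poly M 1 2) n + graph_time M n + x0_time M n + cost_time M n +
   num_time [:: (1, [:: 1; 2])] n + 2 * num_time numer_poly n +
   num_time [:: (400 * vol ^ 2, [:: 1; 2; 3; 4])] n +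
   num_time [:: (4 * vol, [:: 1; 2; 3; 4])] n + num_time [:: (1, [:: 1])] n + 300)%N.

Lemma prints_inst st : prepared H x B st -> prints (print_inst M) st (inst_time W) (inst_word M H x B).
Proof.
move=> prep.
have us (l : seq nat) : uniq l && all (fun r => 0 < r <= 8)%N l -> usable st W l.
  move=> /andP[ul /allP sub]; split=> // r /sub r8.
  by split; [lia | rewrite /counter; lia | exact: (prep_ruler prep)].
have mono c (l : seq nat) n : uniq l && all (fun r => 0 < r <= 8)%N l -> n = (c * W ^ size l)%N ->
    prints (inum [:: (c, l)]) st (num_time [:: (c, l)] W + 5) (icode n).
  move=> ok ->; rewrite -(eval1 c l); apply: prints_inum; first exact: prep_counter prep.
  by move=> m; rewrite inE => /eqP ->; exact: us.
have h1 := mono (2 * vol)%N [:: 1; 2]%N _ isT (n_agentsE M H).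
have h2 := mono 1%N [:: 1; 2]%N (W * W)%N isT (esym (mul1n _)).
have h3 := mono (400 * vol ^ 2)%N [:: 1; 2; 3; 4]%N (scale M H) isT erefl.
have h4 := mono (4 * vol)%N [:: 1; 2; 3; 4]%N (den M H) isT erefl.
have h5 := mono 1%N [:: 1]%N W isT (esym (mul1n _)).
have h6 : prints (inum numer_poly) st (num_time numer_poly W + 5) (icode (numer M H)).
  have -> : numer M H = eval numer_poly W.
    rewrite /eval /numer_poly !big_cons big_nil addn0.
    by rewrite -[size [::]]/0%N expn0 muln1 !addnA.
  apply: prints_inum; first exact: prep_counter prep.
  by move=> m; rewrite !inE => /or3P[] /eqP ->; exact: us.
have e w := prints_emit w st.
have P := prints_sq h1 (prints_sq (e (icode 1)) (prints_sq (prints_graph M prep) (prints_sq (e _)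
  (prints_sq h1 (prints_sq (prints_x0 M prep) (prints_sq (prints_cost M prep)
  (prints_sq h2 (prints_sq (e (icode 1)) (prints_sq h6 (prints_sq (e (icode 1 ++ icode 2 ++ icode 1 ++ icode 1)) (prints_sq h3
  (prints_sq h6 (prints_sq h4 (prints_sq h5 (prints_sq (e (icode 1)) (prints_skip st)))))))))))))))).
have {P} := P (int_code (- 2) ++ icode 1 ++ int_code (- 1) ++ icode 1 ++ icode 1).
rewrite /inst_word cats0 -!catA.
apply: prints_leq; rewrite -/vol.
rewrite [size (int_code _ ++ _)]/= [size (icode 1)]/= [size (icode 1 ++ _)]/=.
by rewrite /inst_time /agents_poly -/vol; lia.
Qed.
End PrintedInstance.

(** * The reduction *)

(** The output of a machine is read from the head to the right, so the head must return to its
    start. *)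
Definition rewind_out : cmd :=
  Sq (Mv 0 MoveLeft) (Sq (Wh 0 isSome (Mv 0 MoveLeft)) (Mv 0 MoveRight)).

Lemma does_rewind_out w st : (forall z, con st 0 z = None) ->
  does rewind_out (out w st) (3 * size w + 5)
    (off (fun i => if i == 0%N then - (size w)%:Z else 0) (out w st)).
Proof.
move=> blank; pose S j := off (fun i => if i == 0%N then -1 - j%:Z else 0) (out w st).
have lookS j : look (S j) 0 =
    if (j < size w)%N then Some (nth false w (size w - j.+1)) else None.
  rewrite /look /S /= con_out pos_out blank /=.
  case: ifP => h1; case: ifP => h2 //; try lia.
  by congr (Some (nth _ _ _)); lia.
have H1 : does (Mv 0 MoveLeft) (out w st) 1 (S 0%N).
  have := does_mv 0 MoveLeft (out w st); congr (does _ _ _ _).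
  by apply: state_ext => //= i; case: (i == 0%N) => //=; rewrite ?subr0 ?addr0.
have H2 : does (Wh 0 isSome (Mv 0 MoveLeft)) (S 0%N) (size w * 3).+1 (S (size w)).
  apply: does_wh => [j jw|]; last by rewrite lookS ltnn.
  rewrite lookS jw; split=> //; have := does_mv 0 MoveLeft (S j); congr (does _ _ _ _).
  by apply: state_ext => //= i; case: (i == 0%N) => //=; lia.
have := does_sq H1 (does_sq H2 (does_mv 0 MoveRight _)).
apply: does_conv; first by lia.
by apply: state_ext => //= i; case: (i == 0%N) => //=; lia.
Qed.

Definition reduction (M : turing_machine) (D d a c : nat) : cmd :=
  Sq (setup D d a c) (Sq (print_inst M) rewind_out).

(** Rewinding the output takes three steps per letter and printing at least one, whence four times
    [inst_time]. *)
Definition reduction_time (M : turing_machine) (D d a c n : nat) : nat :=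
  (setup_time D d a c n + 4 * inst_time M (c * n ^ D + c + (c * n ^ D + c)) + 20)%N.

Lemma within_sq k c1 c2 : within k c1 -> within k c2 -> within k (Sq c1 c2).
Proof. by move=> /= -> ->. Qed.

Lemma within_br k i f : (i <= k)%N -> (forall b, within k (f b)) -> within k (Br i f).
Proof. by move=> ik fk; rewrite /= ik !fk. Qed.

Lemma within_mvs k l : all (fun a => a.1 <= k)%N l -> within k (mvs l).
Proof. by elim: l => //= a l IH /andP[-> /IH]. Qed.

Lemma within_back k (l : moves) : all (fun a => a.1 <= k)%N (back l) = all (fun a => a.1 <= k)%N l.
Proof. by rewrite all_map; apply: eq_all => -[]. Qed.

Lemma within_seqs k cs : all (within k) cs -> within k (seqs cs).
Proof. by elim: cs => //= c cs IH /andP[-> /IH]. Qed.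

Lemma within_wrs k s c : all (fun i => i <= k)%N s -> within k (wrs s c).
Proof. by move=> h; apply: within_seqs; rewrite all_map. Qed.

Lemma within_for k r l c : (r <= k)%N -> all (fun a => a.1 <= k)%N l -> within k c ->
  within k (For r l c).
Proof. by move=> rk lk /= ->; rewrite rk !within_mvs // within_back. Qed.

Lemma within_nest k l c : all (fun r => r <= k)%N l -> within k c -> within k (nest l c).
Proof.
elim: l => // r l IH /andP[rk lk] ck.
by apply: within_for => //=; rewrite ?rk //; exact: IH.
Qed.

Lemma within_rep k m c : within k c -> within k (rep m c).
Proof. by move=> ck; elim: m => //= m ->; rewrite ck. Qed.

Lemma within_emit k w : within k (emit w).
Proof. by elim: w. Qed.

Lemma within_inum k ms : (19 <= k)%N -> all (fun m => all (fun r => r <= k)%N m.2) ms ->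
  within k (inum ms).
Proof.
move=> k19 msk; rewrite -[within _ _]/(within k (emit [:: false]) &&
  (within k (seqs [seq nest m.2 (rep m.1 counter_incr) | m <- ms]) && within k counter_print)).
rewrite within_emit [within k counter_print]/= /counter !k19 !andbT.
apply: within_seqs; rewrite all_map; apply: sub_all msk => m mk /=.
by apply: within_nest => //; apply: within_rep; rewrite /= /counter !k19.
Qed.

Lemma within_rewind k r l : (r <= k)%N -> all (fun a => a.1 <= k)%N l -> within k (rewind r l).
Proof. by move=> rk lk; rewrite /= rk !within_mvs // within_back. Qed.

Lemma within_fill k cp c s l : all (fun r => r <= k)%N cp -> all (fun r => r <= k)%N s ->
  all (fun a => a.1 <= k)%N l -> within k (fill cp c s l).
Proof.
move=> cpk sk lk; have h : within k (rep c (grow s l)).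
  by apply: within_rep; rewrite /= within_wrs ?within_mvs.
by rewrite /= h within_nest.
Qed.

Lemma within_reduction M D d a c : (d <= D)%N -> within (20 + D) (reduction M D d a c).
Proof.
move=> dD; set k := (20 + D)%N.
have small i : (i <= 20)%N -> (i <= k)%N by move=> h; apply: leq_trans h (leq_addr _ _).
have alls s : all (fun i => i <= 20)%N s -> all (fun i => i <= k)%N s by apply: sub_all.
have allm (l : moves) : all (fun a => a.1 <= 20)%N l -> all (fun a => a.1 <= k)%N l.
  by apply: sub_all => ? /=; exact: small.
have allu s v : all (fun i => i <= k)%N s -> all (fun a => a.1 <= k)%N (ups s v).
  by rewrite all_map.
have cps e : (e <= D)%N -> all (fun i => i <= k)%N (iota 20 e).
  by move=> eD; apply/allP => i; rewrite mem_iota /k; lia.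
have k19 : (19 <= k)%N by exact: small.
have allms (ms : seq (nat * seq nat)) : all (fun m => all (fun r => r <= 20)%N m.2) ms ->
    all (fun m => all (fun r => r <= k)%N m.2) ms by apply: sub_all => ? /=; exact: alls.
have cD := cps D (leqnn _); have cd := cps d dD.
have rd l v : all (fun i => i <= 20)%N l -> all (fun a => a.1 <= k)%N (ups l v).
  by move=> h; exact: allu (alls _ h).
apply: within_sq; last apply: within_sq => //.
  apply: within_sq; first by apply: within_wrs; exact: alls.
  apply: within_sq; first by apply: within_mvs; exact: allm.
  apply: within_sq.
    rewrite -[within _ _]/(within k (wrs (iota 20 D) (Some true)) &&
      within k (mvs (ups (0%N :: 10%N :: iota 20 D) MoveRight))).
    by rewrite within_wrs ?within_mvs ?allu.
  apply: within_sq; first by apply: within_rewind; rewrite ?small ?allu.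
  apply: within_sq; first exact: (within_fill _ cd (alls [:: 11%N] isT) (rd [:: 11%N] _ isT)).
  apply: within_sq; first exact: (within_rewind (small 11%N isT) (rd [:: 11%N] _ isT)).
  apply: within_sq; first exact: (within_fill _ cD (alls (iota 1 8) isT) (allm widen_moves isT)).
  apply: within_sq; first exact: (within_fill _ cD (alls (iota 1 8) isT) (rd (iota 1 8) _ isT)).
  exact: (within_rewind (small 1%N isT) (rd (iota 1 8) _ isT)).
have inum_k ms (h : all (fun m => all (fun r => r <= 20)%N m.2) ms) : within k (inum ms).
  exact: within_inum k19 (allms _ h).
have for_k r l cm : (r <= 20)%N -> all (fun a => a.1 <= 20)%N l -> within k cm ->
    within k (For r l cm).
  by move=> r20 /allm l20; apply: within_for (small r r20) l20.
have graph_k : within k (print_graph M).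
  apply: (for_k) => //; apply: (for_k) => //; apply: within_seqs; rewrite all_map.
  apply/allP => a0 _; apply: (for_k) => //; apply: (for_k) => //.
  have link et st pt ep sp pp : within k (emit (flatten
      [seq icode (link et st pt ep sp pp a0 a') | a' <- enum {: bool * square M}])).
    exact: within_emit.
  by rewrite /print_links; do 6!(apply: within_br => [|?]; first exact: small).
have x0_k : within k (print_x0 M) by do 2!(apply: (for_k) => //); exact: within_emit.
have cost_k : within k (print_cost M).
  do 2!(apply: (for_k) => //); do 4!(apply: within_br => [|?]; first exact: small).
  apply: within_seqs; rewrite all_map; apply/allP => a0 _; apply: within_sq (within_emit _ _).
  by case: ifP => _; [exact: within_emit | exact: inum_k].
have e := within_emit k.
by do !(apply: within_sq; first by [exact: inum_k | exact: e | exact: graph_k | exact: x0_k | exact: cost_k]).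
Qed.

Lemma runs_pos (Q : Type) (code : Q -> instr Q) n q st q' st' i :
  runs code n q st q' st' -> pos st' i - pos st i <= n%:Z.
Proof.
elim: n q st => [|n IH] q st /=; first by case=> _ <-; rewrite subrr.
case E: instr_step => [[q1 st1]|//] /IH h.
suff : pos st1 i - pos st i <= 1 by lia.
move: E; case: (code q) => //= [j d q2|j c q2|j f] [_ <-] /=; rewrite ?subrr //.
by case: ifP => _; rewrite ?subrr // addrC addKr; case: d.
Qed.

(** A head moves at most one cell per step. This bounds the length of the code by the printing time,
    without computing that length. *)
Lemma prints_size c st n w : prints c st n w -> (size w <= n)%N.
Proof.
move=> /(_ [::])[m [q [mn /(runs_pos 0) h _]]]; apply: leq_trans mn.
by move: h; rewrite !pos_out /=; lia.
Qed.

Lemma con_rewound w st (j : nat) : (forall z, con st 0 z = None) ->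
  let st' := off (fun i => if i == 0%N then - (size w)%:Z else 0) (out w st) in
  con st' 0 (pos st' 0 + j%:Z) = if (j < size w)%N then Some (nth false w j) else None.
Proof.
move=> blank /=; rewrite con_out pos_out /= blank.
case: ifP => h; case: ifP => h' //; try lia.
by congr (Some (nth _ _ _)); lia.
Qed.

Lemma reduction_computes M D d a c x : (d <= D)%N ->
  tm_computes (machine (20 + D) (reduction M D d a c)) (reduction_time M D d a c (size x)) [:: x]
    (inst_word M (c * size x ^ D + c) x (a * size x ^ d + a)).
Proof.
move=> dD; have prep := prepared_setup a c x dD.
set H := (c * _ + c)%N; set st := setup_state D d a c x in prep.
set w := inst_word _ _ _ _.
have P := prints_inst M prep; have sw := prints_size P.
apply: does_computes (within_reduction _ _ _ dD) _ _ _.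
- apply: does_leq (does_sq (does_setup a c x dD) (does_sq (P [::]) (does_rewind_out _ _))).
    by rewrite cat0s -/w; move: sw; rewrite /reduction_time -/H -/w; lia.
  exact: prep_out prep.
- by move=> j jw; rewrite (con_rewound _ _ (prep_out prep)) jw.
- by rewrite (con_rewound _ _ (prep_out prep)) ltnn.
Qed.

(** * Polynomial bounds *)

Definition poly_bounded (f : nat -> nat) : Prop :=
  exists a d, forall n, (f n <= a * n ^ d + a)%N.

Lemma poly_bounded_leq f g : (forall n, f n <= g n)%N -> poly_bounded g -> poly_bounded f.
Proof. by move=> fg [a [d h]]; exists a, d => n; exact: leq_trans (fg n) (h n). Qed.

Lemma poly_bounded_const c : poly_bounded (fun _ => c).
Proof. by exists c, 0%N => n; exact: leq_addl. Qed.

Lemma poly_bounded_id : poly_bounded id.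
Proof. by exists 1%N, 1%N => n; rewrite mul1n expn1 leq_addr. Qed.

(** The summand 1 covers n = 0, where 0^0 = 1 can exceed 0^e. *)
Lemma leq_exp1 n d e : (d <= e)%N -> (n ^ d <= n ^ e + 1)%N.
Proof.
case: n => [|n] de; first by case: d de => [|d] _; [rewrite expn0 addn1 | rewrite exp0n].
by apply: leq_trans (leq_addr _ _); rewrite leq_pexp2l.
Qed.

Lemma poly_boundedD f g : poly_bounded f -> poly_bounded g -> poly_bounded (fun n => f n + g n)%N.
Proof.
move=> [a [d hf]] [b [e hg]]; exists (2 * (a + b))%N, (d + e)%N => n.
apply: leq_trans (leq_add (hf n) (hg n)) _.
have h1 : (a * n ^ d <= a * (n ^ (d + e) + 1))%N by rewrite leq_mul2l leq_exp1 ?leq_addr ?orbT.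
have h2 : (b * n ^ e <= b * (n ^ (d + e) + 1))%N by rewrite leq_mul2l leq_exp1 ?leq_addl ?orbT.
by apply: leq_trans (leq_add (leq_add h1 (leqnn a)) (leq_add h2 (leqnn b))) _; lia.
Qed.

Lemma poly_boundedM f g : poly_bounded f -> poly_bounded g -> poly_bounded (fun n => f n * g n)%N.
Proof.
move=> [a [d hf]] [b [e hg]]; exists (3 * (a * b))%N, (d + e)%N => n.
apply: leq_trans (leq_mul (hf n) (hg n)) _.
have h1 : (n ^ d <= n ^ (d + e) + 1)%N by rewrite leq_exp1 ?leq_addr.
have h2 : (n ^ e <= n ^ (d + e) + 1)%N by rewrite leq_exp1 ?leq_addl.
have -> : ((a * n ^ d + a) * (b * n ^ e + b) = a * b * (n ^ (d + e) + n ^ d + n ^ e + 1))%N.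
  by rewrite expnD; ring.
have -> : (3 * (a * b) * n ^ (d + e) + 3 * (a * b) = a * b * (3 * n ^ (d + e) + 3))%N by ring.
by rewrite leq_mul2l; apply/orP; right; lia.
Qed.

Lemma poly_boundedX f k : poly_bounded f -> poly_bounded (fun n => f n ^ k)%N.
Proof.
move=> hf; elim: k => [|k IH]; first exact: poly_bounded_const.
apply: poly_bounded_leq (poly_boundedM hf IH) => n; by rewrite expnS.
Qed.

Lemma poly_bounded_sum (T : Type) (s : seq T) (f : T -> nat -> nat) :
  (forall i, poly_bounded (f i)) -> poly_bounded (fun n => \sum_(i <- s) f i n)%N.
Proof.
move=> hf; elim: s => [|i s IH].
  by apply: poly_bounded_leq (poly_bounded_const 0%N) => n; rewrite big_nil.
by apply: poly_bounded_leq (poly_boundedD (hf i) IH) => n; rewrite big_cons.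
Qed.

Lemma poly_bounded_for_time f s g : poly_bounded f -> poly_bounded g ->
  poly_bounded (fun n => for_time (f n) s (g n)).
Proof.
by move=> hf hg; do !(apply: poly_boundedD || apply: poly_boundedM) => //;
  exact: poly_bounded_const.
Qed.

Lemma poly_bounded_nest_time f k g : poly_bounded f -> poly_bounded g ->
  poly_bounded (fun n => nest_time (f n) k (g n)).
Proof. by move=> hf hg; elim: k => //= k IH; exact: poly_bounded_for_time. Qed.

Ltac poly_bounds := do !first
  [ assumption | exact: poly_bounded_const | exact: poly_bounded_id
  | apply: poly_bounded_nest_time | apply: poly_bounded_for_time
  | apply: poly_boundedD | apply: poly_boundedM | apply: poly_boundedX ].

Lemma poly_bounded_num_time ms f : poly_bounded f -> poly_bounded (fun n => num_time ms (f n)).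
Proof.
move=> hf; have he : poly_bounded (fun n => eval ms (f n)).
  by apply: poly_bounded_sum => m; poly_bounds.
have hs : poly_bounded (fun n => \sum_(m <- ms)
    (nest_time (f n) (size m.2) (m.1 * (8 * eval ms (f n) + 21)) + 1))%N.
  by apply: poly_bounded_sum => m; poly_bounds.
apply: (@poly_bounded_leq _ (fun n => \sum_(m <- ms)
    (nest_time (f n) (size m.2) (m.1 * (8 * eval ms (f n) + 21)) + 1) +
    30 * eval ms (f n) + 31)%N); last by poly_bounds.
by move=> n; rewrite /num_time; under [X in (_ <= X + _ + _)%N]eq_bigr do rewrite addn1.
Qed.

Lemma poly_bounded_inst_time M f : poly_bounded f -> poly_bounded (fun n => inst_time M (f n)).
Proof.
move=> hf.
have hg : poly_bounded (fun n => graph_time M (f n)).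
  apply: (@poly_bounded_leq _ (fun n => for_time (f n) 5 (for_time (f n) 7 (#|{: bool * square M}| *
    (for_time (f n) 4 (for_time (f n) 4 (16 * #|{: bool * square M}| + 6)) + 1))))%N).
    by move=> n; rewrite /graph_time -cardE addn1.
  by poly_bounds.
have hx : poly_bounded (fun n => x0_time M (f n)) by rewrite /x0_time; poly_bounds.
have hn ms := poly_bounded_num_time ms hf.
have hc : poly_bounded (fun n => cost_time M (f n)).
  apply: (@poly_bounded_leq _ (fun n => for_time (f n) 5 (for_time (f n) 7 (#|{: bool * square M}| *
    (num_time (agents_poly M 3 4) (f n) + 40 + 1) + 4)))%N).
    by move=> n; rewrite /cost_time -cardE addn1.
  by have := hn (agents_poly M 3 4) => hn'; poly_bounds.
have k c := poly_bounded_const c.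
exact: (poly_boundedD (poly_boundedD (poly_boundedD (poly_boundedD (poly_boundedD (poly_boundedD
  (poly_boundedD (poly_boundedD (poly_boundedD (poly_boundedM (k 2%N) (hn _)) hg) hx) hc) (hn _))
  (poly_boundedM (k 2%N) (hn _))) (hn _)) (hn _)) (hn _)) (k 300%N)).
Qed.

Lemma poly_bounded_reduction_time M D d a c : poly_bounded (reduction_time M D d a c).
Proof.
have hr f s : poly_bounded f -> poly_bounded (fun n => rewind_time (f n) s).
  move=> hf; apply: (@poly_bounded_leq _ (fun n => f n * (2 * s + 2) + 4 * s + 6)%N) => [n|].
    by rewrite /rewind_time addn2.
  by poly_bounds.
have hfi k e m : poly_bounded (fun n => fill_time n k e m).
  apply: (@poly_bounded_leq _ (fun n => nest_time n k (e * (2 * m + 2)) + e * (2 * m + 2) + 1)%N).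
    by move=> n; rewrite /fill_time addn1 addn2.
  by poly_bounds.
have hH : poly_bounded (fun n => c * n ^ D + c)%N by poly_bounds.
have hB : poly_bounded (fun n => a * n ^ d + a)%N by poly_bounds.
have h1 := hr _ D.+1 poly_bounded_id; have h2 := hr _ 1%N hB.
have h3 := hr _ 8%N (poly_boundedD hH hH).
have h4 := poly_bounded_inst_time M (poly_boundedD hH hH).
have h5 := hfi d a 2%N; have h6 := hfi D c 19%N; have h7 := hfi D c 16%N.
have k m := poly_bounded_const m.
exact: (poly_boundedD (poly_boundedD (poly_boundedD (poly_boundedD (poly_boundedD (poly_boundedD
  (poly_boundedD (poly_boundedD (poly_boundedD (k 200%N)
  (poly_boundedM poly_bounded_id (k (4 * D + 20)%N))) h1) h5) h2) h6) h7) h3)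
  (poly_boundedM (k 4%N) h4)) (k 20%N)).
Qed.

(** With u = volume W^4, the attack m / (4 u) is s + 3/4 + 1 / (4 u), and 4 u = 2 n k; dividing by s
    gives the three terms of the gain. *)
Lemma gain_frac (F : numFieldType) (s m u n k : nat) : (0 < s)%N -> (0 < n)%N -> (0 < k)%N ->
  (2 * n * k = 4 * u)%N -> (m = 4 * u * s + 3 * u + 1)%N ->
  s%:R^-1 * (m%:R / (4 * u)%:R) =
    1 + 3 / 4 * s%:R^-1 + s%:R^-1 / (2 * n%:R * k%:R) :> F.
Proof.
move=> s0 n0 k0 nk ->.
have u0 : (0 < u)%N by have : (0 < 2 * n * k)%N; [rewrite !muln_gt0 n0 | lia].
have -> : 2 * n%:R * k%:R = (4 * u)%:R :> F by rewrite -nk !natrM.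
have su : s%:R != 0 :> F by rewrite pnatr_eq0 -lt0n.
have uu : u%:R != 0 :> F by rewrite pnatr_eq0 -lt0n.
by rewrite 2!(natrD _ _) !natrM; field; rewrite uu su.
Qed.

Lemma tm_computes_leq M t t' ws w : (t <= t')%N -> tm_computes M t ws w -> tm_computes M t' ws w.
Proof. by move=> le [h o]; rewrite /tm_computes -(subnK le) iterD tm_step_halting. Qed.

Lemma scale_frac (F : numFieldType) (n : nat) : (0 < n)%N ->
  100 * n%:R ^+ 2 / (100 * n ^ 2)%:R = 1 :> F.
Proof.
move=> n0; rewrite natrM natrX divff // mulf_neq0 ?expf_neq0 ?pnatr_eq0 //.
by rewrite -lt0n.
Qed.

Lemma frac_le (F : numFieldType) (m n : nat) : (0 < n)%N -> m%:R / n%:R <= m%:R :> F.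
Proof.
move=> n0; rewrite ler_pdivrMr ?ltr0n // -natrM ler_nat.
exact: leq_pmulr.
Qed.

(** * Correctness of the reduction *)

Section InstanceDecision.
Variables (R : realType) (eps : R) (M : turing_machine) (H : nat) (x : bits) (B : nat).
Hypothesis H0 : (0 < H)%N.
Notation W := (H + H)%N.
Let N := n_agents M H.

Let W0 : (0 < W)%N. Proof. by rewrite addn_gt0 H0. Qed.

Let kN : (W * W < N)%N.
Proof.
have : (W * W * 1 < W * W * (2 * volume M))%N.
  by rewrite ltn_mul2l muln_gt0 W0 /=; have := volume_gt0 M; lia.
by rewrite muln1 /N n_agentsE -mulnn mulnC.
Qed.

Let k0 : (0 < W * W)%N. Proof. by rewrite muln_gt0 W0. Qed.

Let N1 : (1 < N)%N. Proof. exact: leq_ltn_trans kN. Qed.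

Let scale0 : (0 < scale M H)%N.
Proof. by rewrite scaleE muln_gt0 expn_gt0 (ltnW N1). Qed.

Let denE4 : den M H = (4 * (volume M * W ^ 4))%N.
Proof. exact: esym (mulnA _ _ _). Qed.

Lemma inst_valid : 0 < eps -> p1_well_posed (real_data R (inst_data (inst M H x B))) eps.
Proof.
move=> eps0.
apply: (agents_well_posed N1 (@graph_sym M H) (@graph_irr M H)) => //.
- exact: graph_conn.
- by move=> i; rewrite mxE; case: ifP.
- by rewrite invr_gt0 ltr0n.
Qed.

Lemma inst_decision V T : (T < H)%N ->
  (forall y, (size y <= B)%N ->
     tm_halting (conf M x y T).1 /\ bits_of_tape ((conf M x y T).2 ord0) = [:: V y]) ->
  @decision R (P1_time_invariant eps) (inst M H x B, W%:R) <->
  exists y, (size y <= B)%N /\ V y.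
Proof.
move=> TH HV; rewrite (conflict_graphP TH HV).
apply: (agents_decision eps (@graph_sym M H) (@graph_irr M H)) => //.
- by move=> i /andP[top _]; exact: graph_degree.
- by move=> i; rewrite mxE.
- by rewrite scaleE; exact: scale_frac (ltnW N1).
- rewrite mxE denE4; apply: gain_frac scale0 (ltnW N1) k0 _ _.
    by rewrite -denE4 denE.
  by rewrite numerE denE4 (mulnA 3).
- rewrite mxE; apply: frac_le; rewrite denE4.
  by rewrite muln_gt0 /= muln_gt0 volume_gt0 expn_gt0 W0.
Qed.
End InstanceDecision.

Theorem lemma2 (R : realType) (eps : R) (eps_gt0 : 0 < eps) :
  NP_hard (P1_time_invariant eps).
Proof.
move=> L [V [[M [a [d comp]]] [a' [d' LV]]]].
pose B n := (a' * n ^ d' + a')%N.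
(* The time for the longest certificate allowed. Halted machines keep their output, so it serves for
   all shorter ones too. *)
pose T n := (a * (n + B n) ^ d + a)%N.
have Tpoly : poly_bounded T.
  apply: (poly_boundedD (poly_boundedM (poly_bounded_const a) (poly_boundedX d
    (poly_boundedD poly_bounded_id _))) (poly_bounded_const a)).
  by exists a', d'.
have [b [e Tb]] := Tpoly.
(* D >= d' provides enough copies to mark the room for the certificate, and D >= e makes H exceed T:
   with c = 2 b + 1, b (n^D + 1) + b < c n^D + c. *)
pose D := maxn e d'; pose c := (2 * b + 1)%N; pose H n := (c * n ^ D + c)%N.
have TH n : (T n < H n)%N.
  apply: (@leq_ltn_trans (b * (n ^ D + 1) + b)%N).
    by apply: leq_trans (Tb n) _; rewrite leq_add2r leq_mul2l leq_exp1 ?leq_maxl ?orbT.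
  by rewrite /H /c; have := leq0n (b * n ^ D); lia.
have H0 n : (0 < H n)%N by exact: leq_ltn_trans (TH n).
exists (fun x => (inst M (H (size x)) x (B (size x)), (H (size x) + H (size x))%:R)); split.
- by move=> x; exact: inst_valid.
- have [a1 [d1 time]] := poly_bounded_reduction_time M D d' a' c.
  exists (machine (20 + D) (reduction M D d' a' c)), a1, d1 => x.
  rewrite inst_code //; apply: tm_computes_leq (time _) _.
  exact: reduction_computes (leq_maxr _ _).
- move=> x; rewrite LV.
  rewrite (@inst_decision R eps M (H (size x)) x (B (size x)) (H0 _) (V x) (T (size x))) //.
  move=> y yB; apply: tm_computes_leq (comp x y).
  rewrite /T leq_add2r leq_mul2l; apply/orP; right.
  elim: d {comp Tpoly Tb T TH} => // d IH; rewrite !expnS leq_mul ?leq_add2l //.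
Qed.
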